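(* Let $\mathbf k$ be an algebraically closed field of prime characteristic $p$, and let $\mathrm T=(\mathfrak g,\mathfrak h,\rho)$ be an abelian type of rank $n$. Fix $0\ne z\in\mathfrak g$. The following sets are naturally bijective: (i) the set of isomorphism classes of quantum $p$-groups of type $\mathrm T$ in $\mathscr X(n)$; (ii) the set of isomorphism classes (as Hopf algebras) of primitive deformations of $u(\mathrm T)$; (iii) $\mathcal H^2(\mathrm T)/\mathrm{Aut}(\mathrm T)$; (iv) $\mathscr A^+(\mathrm T)/\mathrm{Aut}(\mathrm T)$, provided that $\mathrm T$ is permissible and $p>2$.
   Context: A quantum $p$-group is a finite-dimensional connected Hopf algebra over $\mathbf k$; $\mathscr X(n)$ is the class of $p^{n+1}$-dimensional quantum $p$-groups whose primitive space is an abelian restricted Lie algebra of dimension $n$. Abelian type of rank $n$: a triple $(\mathfrak g,\mathfrak h,\rho)$ with $\mathfrak g,\mathfrak h$ abelian restricted Lie algebras over $\mathbf k$, $\dim\mathfrak g=1$, $\dim\mathfrak h=n\ge1$, and $\rho:\mathfrak g\to\mathrm{End}_{\mathbf k}(\mathfrak h)$ an algebraic representation, which here means: $\rho$ is linear, $\rho_{(x^{[p]})}=(\rho_x)^p$ and $\rho_x(a^{[p]})=0$ for $x\in\mathfrak g,a\in\mathfrak h$. Write $z^{[p]}=\lambda z$, $\lambda\in\mathbf k$. Cobar construction: $\Omega^i u(\mathfrak h)=(u(\mathfrak h)^+)^{\otimes i}$, where $u(\mathfrak h)$ is the restricted enveloping algebra and $u(\mathfrak h)^+$ its augmentation ideal,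 with $\partial^1(r)=1\otimes r-\Delta(r)+r\otimes1$ and $\partial^2(r\otimes s)=1\otimes r\otimes s-\Delta(r)\otimes s+r\otimes\Delta(s)-r\otimes s\otimes1$. $\rho_z$ is extended to $u(\mathfrak h)$ as a derivation and to tensor powers by the Leibniz rule. $\Phi_z(\pi)=\pi^p-\lambda\pi+\rho_z^{p-1}(\pi)$ for $\pi\in\Omega^iu(\mathfrak h)$, with $\pi^p$ computed in the commutative algebra $u(\mathfrak h)^{\otimes i}$. $u(\mathrm T)$ is the restricted enveloping algebra of the semiproduct $\mathfrak h\rtimes_\rho\mathfrak g$: it is generated over $u(\mathfrak h)$ by $z$ with $[z,r]=\rho_z(r)$, $z^p=\lambda z$, and $\mathfrak h,z$ primitive. For $\Theta\in u(\mathfrak h)^+$, $\chi\in(u(\mathfrak h)^+)^{\otimes2}$, write $\mathscr D=(\mathrm T,\Theta,\chi)$ (a datum) and let $u_z(\mathscr D)$ be obtained by replacing the relation and coproduct for $z$ by $z^p-\lambda z+\Theta=0$ and $\Delta(z)=z\otimes1+1\otimes z+\chi$. It is a primitive deformation of $u(\mathrm T)$, and $\mathscr D$ is a PD datum w.r.t. $z$, if $u_z(\mathscr D)$ is a quantum $p$-group of dimension $p^{n+1}$ with primitive space isomorphic to $\mathfrak h$. A quantum $p$-group in $\mathscr X(n)$ is of type $\mathrm T$ if it is isomorphic to such a $u_z(\mathscr D)$. $\mathcal H^2(\mathrm T)$: the set of equivalence classes $[(\Theta,\chi)]$ of PD data $(\mathrm T,\Theta,\chi)$ w.r.t. $z$,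 where $(\Theta,\chi)\sim(\Theta',\chi')$ iff $\Theta'-\Theta=\Phi_z(s)$ and $\chi'-\chi=\partial^1(s)$ for some $s\in u(\mathfrak h)^+$. $\mathrm{Aut}(\mathrm T)$: pairs $\phi=(\gamma,\phi_2)$ with $\gamma\in\mathbf k^\times$, $\gamma^p\lambda=\gamma\lambda$ (i.e. $z\mapsto\gamma z$ is an automorphism of $\mathfrak g$), $\phi_2$ a restricted Lie automorphism of $\mathfrak h$, and $\rho_z\phi_2=\gamma\,\phi_2\rho_z$ on $\mathfrak h$. It acts on $\mathcal H^2(\mathrm T)$ by $[(\Theta,\chi)]\mapsto[(\gamma^p\phi_2(\Theta),\gamma(\phi_2\otimes\phi_2)(\chi))]$. $\mathrm T$ is permissible if $\mathrm{Ker}\,\rho_z=\mathrm{Im}\,\Phi_z$ on $\mathfrak h$. For (iv), fix a basis $x_1,\dots,x_n$ of $\mathfrak h$ and set $\boldsymbol\omega(r)=\sum_{i=1}^{p-1}\frac{(p-1)!}{i!(p-i)!}r^i\otimes r^{p-i}$. For $P=(a_{ij},b_k)_{1\le i<j\le n,1\le k\le n}\in\mathbf k^{n(n+1)/2}$ let $\chi_P=\sum_{i<j}a_{ij}x_i\otimes x_j+\boldsymbol\omega(\sum_kb_kx_k)$. $\mathscr A^+(\mathrm T)$ is the set of nonzero $P$ such that $\Phi_z(\chi_P)=\partial^1(s)$ and $\rho_z(s)=0$ for some $s\in u(\mathfrak h)^+$. Writing $\phi_2(x_i)=\sum_jG_{ij}x_j$, $\phi=(\gamma,\phi_2)$ acts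 by $\phi(P)=(\widetilde{a_{ij}},\widetilde{b_k})$, $\widetilde{a_{ij}}=\sum_{r<s}\gamma(G_{ri}G_{sj}-G_{rj}G_{si})a_{rs}$, $\widetilde{b_k}=\sum_s\gamma^{1/p}G_{sk}b_s$. The natural maps: $[(\Theta,\chi)]\mapsto$ the isomorphism class of $u_z(\mathrm T,\Theta,\chi)$, and $[(\Theta,\chi)]\mapsto P$ where $\chi-\chi_P\in\mathrm{Im}\,\partial^1$. *)

(* Defs.v *)
From HB Require Import structures.
From mathcomp Require Import all_boot all_order all_algebra all_field.
From mathcomp Require Import mathcomp_extra boolp classical_sets functions.

Set Implicit Arguments.
Unset Strict Implicit.
Unset Printing Implicit Defensive.

Import GRing.Theory VectorInternalTheory.

Local Open Scope classical_set_scope.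
Local Open Scope ring_scope.

(* The tensor product of two finite-dimensional spaces, as the matrices of    *)
(* coordinates with respect to the bases underlying the vectType structures;  *)
(* [tens] is the universal bilinear map and [tlift] its universal property    *)
(* (see tlift_tens).                                                          *)
Definition tensor (K : fieldType) (A B : vectType K) : Type :=
  'M[K]_(dim A, dim B).

HB.instance Definition _ (K : fieldType) (A B : vectType K) :=
  Vector.on (tensor A B).

Section Tensor.
Context {K : fieldType}.
Implicit Types A B C : vectType K.

Definition tens A B (a : A) (b : B) : tensor A B := (v2r a)^T *m v2r b.

Definition tbase A (i : 'I_(dim A)) : A := r2v (delta_mx 0 i).

Definition tlift A B (C : lmodType K) (f : A -> B -> C) (t : tensor A B) : C :=
  \sum_i \sum_j t i j *: f (tbase i) (tbase j).

Definition tmap A B A' B' (f : A -> A') (g : B -> B') : tensor A B -> tensor A' B' :=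
  tlift (fun a b => tens (f a) (g b)).

Lemma tens_linearl A B (b : B) : linear (fun a : A => tens a b).
Proof.
by move=> c a a'; rewrite /tens !linearP /= mulmxDl -scalemxAl.
Qed.

Lemma tens_linearr A B (a : A) : linear (fun b : B => tens a b).
Proof.
by move=> c b b'; rewrite /tens !linearP.
Qed.

Lemma tlift_linear A B (C : lmodType K) (f : A -> B -> C) : linear (tlift f).
Proof.
move=> c t t'; rewrite /tlift scaler_sumr -big_split /=.
apply: eq_bigr => i _; rewrite scaler_sumr -big_split /=.
by apply: eq_bigr => j _; rewrite !mxE scalerDl scalerA.
Qed.

HB.instance Definition _ A B (C : lmodType K) (f : A -> B -> C) :=
  GRing.isLinear.Build K (tensor A B) C *:%R (tlift f) (tlift_linear f).
HB.instance Definition _ A B A' B' (f : A -> A') (g : B -> B') :=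
  GRing.isLinear.Build K (tensor A B) (tensor A' B') *:%R (tmap f g)
    (tlift_linear _).

Lemma tbase_sum A (a : A) : a = \sum_i v2r a 0 i *: tbase i.
Proof.
apply: (can_inj v2rK); rewrite [LHS]row_sum_delta linear_sum /=.
by apply: eq_bigr => i _; rewrite linearZ /= r2vK.
Qed.

Lemma tlift_tens A B (C : lmodType K) (f : A -> B -> C) a b :
  (forall b', linear (f^~ b')) -> (forall a', linear (f a')) ->
  tlift f (tens a b) = f a b.
Proof.
move=> fl fr.
pose Fl b' : {linear A -> C} := HB.pack (f^~ b')
  (GRing.isLinear.Build K A C *:%R _ (fl b')).
pose Fr a' : {linear B -> C} := HB.pack (f a')
  (GRing.isLinear.Build K B C *:%R _ (fr a')).
have -> : f a b = Fl b a by [].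
rewrite [in RHS](tbase_sum a) linear_sum; apply: eq_bigr => i _.
rewrite linearZ /= -[f _ b]/(Fr _ b) [in RHS](tbase_sum b) linear_sum scaler_sumr.
apply: eq_bigr => j _; rewrite linearZ /= scalerA; congr (_ *: _).
by rewrite !mxE big_ord1 !mxE.
Qed.

Lemma tensor_sum A B (t : tensor A B) :
  t = \sum_i \sum_j t i j *: tens (tbase i) (tbase j).
Proof.
rewrite {1}[t]matrix_sum_delta; apply: eq_bigr => i _; apply: eq_bigr => j _.
congr (_ *: _); rewrite /tens /tbase !r2vK trmx_delta.
by rewrite mul_delta_mx.
Qed.

Lemma tensor_ind A B (P : tensor A B -> Prop) :
  (forall c t t', P t -> P t' -> P (c *: t + t')) -> P 0 ->
  (forall a b, P (tens a b)) -> forall t, P t.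
Proof.
move=> PD P0 Pt t; rewrite [t]tensor_sum.
have PA u v : P u -> P v -> P (u + v).
  by move=> Pu Pv; rewrite -[u]scale1r; apply: PD.
apply: (big_ind P) => // i _; apply: (big_ind P) => // j _.
by rewrite -[_ *: _]addr0; apply: PD.
Qed.

Definition tassoc A B C :
    tensor (tensor A B : vectType K) C -> tensor A (tensor B C : vectType K) :=
  tlift (fun t c => tlift (fun a b => tens a (tens b c)) t).

End Tensor.

Section TensorAlgebra.
Context {K : fieldType} (A B : falgType K).
Local Notation AB := (tensor A B).

Definition tensor_one : AB := tens 1 1.

Definition tensor_mul (s t : AB) : AB :=
  tlift (fun a b => tmap ( *%R a) ( *%R b) t) s.

Lemma tensor_mul_linearl t : linear (tensor_mul^~ t).
Proof. exact: tlift_linear. Qed.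

Lemma tensor_mul_linearr s : linear (tensor_mul s).
Proof.
move=> c t t'; rewrite /tensor_mul /tlift scaler_sumr -big_split /=.
apply: eq_bigr => i _; rewrite scaler_sumr -big_split /=.
apply: eq_bigr => j _; rewrite linearP scalerDr !scalerA.
by rewrite [c * _]mulrC.
Qed.

Lemma tmap_mul_tens (a a' : A) (b b' : B) :
  tmap ( *%R a) ( *%R b) (tens a' b') = tens (a * a') (b * b').
Proof.
rewrite /tmap tlift_tens // => [y|x] c u v /=.
  by rewrite mulrDr -scalerAr; apply: tens_linearl.
by rewrite mulrDr -scalerAr; apply: tens_linearr.
Qed.

Lemma tensor_mul_tens (a a' : A) (b b' : B) :
  tensor_mul (tens a b) (tens a' b') = tens (a * a') (b * b').
Proof.
have linl (y : B) t : linear (fun x : A => tmap ( *%R x) ( *%R y) t).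
  move=> c u v; elim/(@tensor_ind K A B): t => [d t t' IH IH'||x' y'].
  - rewrite !linearP /= IH IH' !scalerDr !scalerA [d * c]mulrC.
    by rewrite addrACA.
  - by rewrite !linear0 addr0.
  - by rewrite !tmap_mul_tens mulrDl -scalerAl; apply: tens_linearl.
have linr (x : A) t : linear (fun y : B => tmap ( *%R x) ( *%R y) t).
  move=> c u v; elim/(@tensor_ind K A B): t => [d t t' IH IH'||x' y'].
  - rewrite !linearP /= IH IH' !scalerDr !scalerA [d * c]mulrC.
    by rewrite addrACA.
  - by rewrite !linear0 addr0.
  - by rewrite !tmap_mul_tens mulrDl -scalerAl; apply: tens_linearr.
by rewrite /tensor_mul tlift_tens ?tmap_mul_tens.
Qed.

Lemma tensor_mulDl : left_distributive tensor_mul +%R.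
Proof. by move=> x y t; have := tensor_mul_linearl t 1 x y; rewrite !scale1r. Qed.

Lemma tensor_mulDr : right_distributive tensor_mul +%R.
Proof. by move=> s x y; have := tensor_mul_linearr s 1 x y; rewrite !scale1r. Qed.

Lemma tensor_mul0l t : tensor_mul 0 t = 0.
Proof.
by have := tensor_mul_linearl t (-1) 0 0; rewrite !scaleN1r !addNr.
Qed.

Lemma tensor_mul0r t : tensor_mul t 0 = 0.
Proof.
by have := tensor_mul_linearr t (-1) 0 0; rewrite !scaleN1r !addNr.
Qed.

Lemma tensor_scaleAl c (s t : AB) :
  c *: tensor_mul s t = tensor_mul (c *: s) t.
Proof.
by have := tensor_mul_linearl t c s 0; rewrite tensor_mul0l !addr0.
Qed.

Lemma tensor_scaleAr c (s t : AB) :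
  c *: tensor_mul s t = tensor_mul s (c *: t).
Proof.
by have := tensor_mul_linearr s c t 0; rewrite tensor_mul0r !addr0.
Qed.

Lemma tensor_mulA : associative tensor_mul.
Proof.
move=> x y z.
elim/(@tensor_ind K A B): x => [c x x' IH IH'||a b].
- by rewrite !tensor_mulDl -!tensor_scaleAl IH IH'.
- by rewrite !tensor_mul0l.
elim/(@tensor_ind K A B): y => [c y y' IH IH'||a' b'].
- rewrite tensor_mulDl -tensor_scaleAl !tensor_mulDr -!tensor_scaleAr.
  by rewrite tensor_mulDl -tensor_scaleAl IH IH'.
- by rewrite !(tensor_mul0l, tensor_mul0r).
elim/(@tensor_ind K A B): z => [c z z' IH IH'||a'' b''].
- by rewrite !tensor_mulDr -!tensor_scaleAr IH IH'.
- by rewrite !tensor_mul0r.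
by rewrite !tensor_mul_tens !mulrA.
Qed.

Lemma tensor_mul1l : left_id tensor_one tensor_mul.
Proof.
elim/(@tensor_ind K A B) => [c t t' IH IH'||a b].
- by rewrite tensor_mulDr -tensor_scaleAr IH IH'.
- by rewrite tensor_mul0r.
by rewrite tensor_mul_tens !mul1r.
Qed.

Lemma tensor_mul1r : right_id tensor_one tensor_mul.
Proof.
elim/(@tensor_ind K A B) => [c t t' IH IH'||a b].
- by rewrite tensor_mulDl -tensor_scaleAl IH IH'.
- by rewrite tensor_mul0l.
by rewrite tensor_mul_tens !mulr1.
Qed.

Lemma tensor_one_neq0 : tensor_one != 0.
Proof.
have nz (C : falgType K) : exists i, v2r (1 : C) 0 i != 0.
  case: (pickP (fun i => v2r (1 : C) 0 i != 0)) => [i ?|h]; first by exists i.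
  have /eqP[] := oner_neq0 C; apply: (can_inj v2rK); rewrite linear0.
  by apply/rowP => i; rewrite mxE; apply/eqP; rewrite -[_ == _]negbK h.
have [[i hi] [j hj]] := (nz A, nz B).
apply/eqP => /matrixP/(_ i j); rewrite !mxE big_ord1 !mxE => /eqP.
by rewrite mulf_eq0 (negPf hi) (negPf hj).
Qed.

HB.instance Definition _ := GRing.Zmodule_isNzRing.Build AB
  tensor_mulA tensor_mul1l tensor_mul1r tensor_mulDl tensor_mulDr
  tensor_one_neq0.
HB.instance Definition _ := GRing.Lmodule_isLalgebra.Build K AB tensor_scaleAl.
HB.instance Definition _ := GRing.Lalgebra_isAlgebra.Build K AB tensor_scaleAr.
HB.instance Definition _ := Algebra_isFalgebra.Build K AB.

End TensorAlgebra.

(* Same as set_bij, which the universe of classical_sets.set prevents from     *)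
(* being used for sets of classes of Hopf algebras.                            *)
Definition bij_between (X Y : Type) (A : X -> Prop) (B : Y -> Prop) (f : X -> Y) :=
  [/\ forall a, A a -> B (f a),
      forall a a', A a -> A a' -> f a = f a' -> a = a' &
      forall b, B b -> exists2 a, A a & f a = b].

HB.mixin Record isHopf (K : fieldType) H of Falgebra K H := {
  comul : {lrmorphism H -> tensor H H};
  counit : {lrmorphism H -> K^o};
  antipode : {linear H -> H};
  comulA : forall x, tassoc (tmap comul idfun (comul x)) = tmap idfun comul (comul x);
  counitl : forall x, tlift (fun a b => counit a *: b) (comul x) = x;
  counitr : forall x, tlift (fun a b => counit b *: a) (comul x) = x;
  antipodel : forall x, tlift (fun a b => antipode a * b) (comul x) = (counit x)%:A;
  antipoder : forall x, tlift (fun a b => a * antipode b) (comul x) = (counit x)%:A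
}.

#[short(type="hopfType")]
HB.structure Definition Hopf (K : fieldType) :=
  {H of isHopf K H & Falgebra K H}.

Lemma tens_mul (K : fieldType) (A B : falgType K) (a a' : A) (b b' : B) :
  (tens a b : tensor A B) * tens a' b' = tens (a * a') (b * b').
Proof. exact: tensor_mul_tens. Qed.

Section Coalgebra.
Context {K : fieldType}.
Implicit Types H : hopfType K.

(* C ⊗ C as a subspace of H ⊗ H. *)
Definition tens_square H (C : {vspace H}) : {vspace tensor H H} :=
  <<[seq tens a b | a <- vbasis C, b <- vbasis C]>>%VS.

Definition subcoalgebra H (C : {vspace H}) : Prop :=
  forall x, x \in C -> comul x \in tens_square C.

Definition simple_subcoalgebra H (C : {vspace H}) : Prop :=
  [/\ subcoalgebra C, C != 0%VS &
      forall D : {vspace H}, subcoalgebra D -> (D <= C)%VS -> D = 0%VS \/ D = C].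

(* The coradical is the sum of all simple subcoalgebras. *)
Definition is_coradical H (V : {vspace H}) : Prop :=
  (forall C, simple_subcoalgebra C -> (C <= V)%VS) /\
  (forall W : {vspace H},
     (forall C, simple_subcoalgebra C -> (C <= W)%VS) -> (V <= W)%VS).

Definition connected_hopf H : Prop :=
  exists2 V : {vspace H}, is_coradical V & \dim V = 1%N.

Definition primitives H : {vspace H} :=
  lker (linfun (fun x : H => comul x - (tens x 1 + tens 1 x))).

Definition augmentation_ideal H : {vspace H} := lker (linfun (@counit K H)).

Lemma primitivesP H (x : H) :
  x \in primitives H <-> comul x = tens x 1 + tens 1 x.
Proof.
have lin : linear (fun y : H => comul y - (tens y 1 + tens 1 y)).
  move=> c u v; rewrite linearP tens_linearl tens_linearr addrACA -scalerDr.
  by rewrite opprD addrACA -scalerBr.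
pose F : {linear H -> tensor H H} := HB.pack
  (fun y : H => comul y - (tens y 1 + tens 1 y))
  (GRing.isLinear.Build K H (tensor H H) *:%R _ lin).
rewrite memv_ker -[linfun _]/(linfun F) lfunE /=.
by rewrite subr_eq0; split=> [/eqP | ->].
Qed.

Lemma augmentation_idealP H (x : H) : x \in augmentation_ideal H <-> counit x = 0.
Proof. by rewrite memv_ker lfunE; split=> [/eqP | hx]; last apply/eqP. Qed.

Definition hopf_morphism H H' (f : {lrmorphism H -> H'}) : Prop :=
  (forall x, comul (f x) = tmap f f (comul x)) /\
  (forall x, counit (f x) = counit x).

Definition hopf_iso H H' : Prop :=
  exists2 f : {lrmorphism H -> H'}, hopf_morphism f & bijective f.

Definition iso_class H : hopfType K -> Prop := hopf_iso H.

(* The differential ∂^1 of the cobar construction. *)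
Definition cobar1 H (r : H) : tensor H H := tens 1 r - comul r + tens r 1.

End Coalgebra.

(* An abelian restricted Lie algebra in characteristic p: the bracket is zero *)
(* so that a p-map is the same as a p-semilinear map.                         *)
HB.mixin Record isAbelianRestrictedLie (K : fieldType) (p : nat) L
    of Vector K L := {
  rpow : L -> L;
  rpowD : forall a b, rpow (a + b) = rpow a + rpow b;
  rpowZ : forall c a, rpow (c *: a) = c ^+ p *: rpow a
}.

#[short(type="abelianRLieType")]
HB.structure Definition AbelianRestrictedLie (K : fieldType) (p : nat) :=
  {L of isAbelianRestrictedLie K p L & Vector K L}.

Section Types.
Context {K : fieldType} {p : nat}.

(* Homomorphisms of restricted Lie algebras from h to (B, [,], ^p). *)
Definition restricted_morphism (h : abelianRLieType K p) (B : algType K)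
    (f : {linear h -> B}) : Prop :=
  (forall a, f (rpow a) = f a ^+ p) /\ (forall a b, f a * f b = f b * f a).

(* A restricted enveloping algebra u(h), given by its universal property,     *)
(* with the Hopf structure for which h is primitive.                          *)
Record restricted_env (h : abelianRLieType K p) := RestrictedEnv {
  env :> hopfType K;
  env_in : {linear h -> env};
  env_inP : restricted_morphism env_in;
  env_univ : forall (B : algType K) (f : {linear h -> B}), restricted_morphism f ->
    exists2 g : {lrmorphism env -> B}, (forall a, g (env_in a) = f a) &
      forall g' : {lrmorphism env -> B}, (forall a, g' (env_in a) = f a) -> g' =1 g;
  env_in_prim : forall a, comul (env_in a) = tens (env_in a) 1 + tens 1 (env_in a)
}.

Record abelian_type (n : nat) := AbelianType {
  type_g : abelianRLieType K p;
  type_h : abelianRLieType K p;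
  type_rho : {linear type_g -> 'End(type_h)};
  dim_type_g : \dim {: type_g} = 1%N;
  dim_type_h : \dim {: type_h} = n;
  rank_gt0 : (0 < n)%N;
  type_rho_rpow : forall x a, type_rho (rpow x) a = iter p (type_rho x) a;
  type_rho_rpow0 : forall x a, type_rho x (rpow a) = 0
}.

(* P(H) ≅ h as restricted Lie algebras. *)
Definition primitives_iso (H : hopfType K) (h : abelianRLieType K p) : Prop :=
  exists f : {linear h -> H}, [/\ restricted_morphism f, injective f &
    forall x, x \in primitives H <-> exists a, x = f a].

Definition class_X (n : nat) (H : hopfType K) : Prop :=
  [/\ connected_hopf H, \dim {: H} = (p ^ n.+1)%N, \dim (primitives H) = n &
      forall x y, x \in primitives H -> y \in primitives H -> x * y = y * x].

End Types.

Arguments abelian_type : clear implicits.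
Arguments class_X {K} p n H.

Definition ltpair (n : nat) : finType :=
  {ij : 'I_n * 'I_n | (ij.1 < ij.2)%N}.

(* The tuples (a_ij, b_k) in k^(n(n+1)/2). *)
Definition param (K : fieldType) (n : nat) : Type :=
  ({ffun ltpair n -> K} * {ffun 'I_n -> K})%type.

Section PrimitiveDeformations.
Context {K : fieldType} {p n : nat} (T : abelian_type K p n).
Context (z : type_g T) (lambda : K) (U : restricted_env (type_h T)).
(* rhoU is the extension of rho_z to a derivation of u(h), see rho_extension *)
Context (rhoU : {linear U -> U}).
Local Notation h := (type_h T).
Local Notation iota := (env_in U).
Local Notation Uplus := (augmentation_ideal U).

Definition rho_extension : Prop :=
  (forall r s, rhoU (r * s) = rhoU r * s + r * rhoU s) /\
  (forall a, rhoU (iota a) = iota (type_rho T z a)).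

Definition rhoU2 (t : tensor U U) : tensor U U :=
  tmap rhoU idfun t + tmap idfun rhoU t.

Definition Phi_op (A : algType K) (delta : A -> A) (t : A) : A :=
  t ^+ p - lambda *: t + iter p.-1 delta t.

Definition Phi1 : U -> U := Phi_op rhoU.
Definition Phi2 : tensor U U -> tensor U U := Phi_op rhoU2.

Definition permissible : Prop :=
  iota @` [set a | type_rho T z a = 0] = Phi1 @` range iota.

(* The pairs (Theta, chi). *)
Definition datum : Type := (U * tensor U U)%type.

Definition datum_relations (B : algType K) (f : U -> B) (b : B) (D : datum) : Prop :=
  (forall r, b * f r - f r * b = f (rhoU r)) /\
  b ^+ p - lambda *: b + f D.1 = 0.

(* H is u_z(T, Theta, chi): the algebra presented over u(h) by the generator  *)
(* z and the above relations, with the prescribed coproduct. In particular    *)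
(* is_uz (0, 0) characterizes u(T).                                           *)
Definition is_uz (D : datum) (H : hopfType K) : Prop :=
  exists (j : {lrmorphism U -> H}) (zeta : H),
  [/\ datum_relations j zeta D,
      forall (B : algType K) (f : {lrmorphism U -> B}) (b : B),
        datum_relations f b D ->
        exists2 g : {lrmorphism H -> B}, (forall r, g (j r) = f r) /\ g zeta = b &
          forall g' : {lrmorphism H -> B},
            (forall r, g' (j r) = f r) /\ g' zeta = b -> g' =1 g,
      hopf_morphism j &
      comul zeta = tens zeta 1 + tens 1 zeta + tmap j j D.2].

Definition PD_datum : set datum :=
  [set D | [/\ D.1 \in Uplus, D.2 \in tens_square Uplus &
    exists H : hopfType K, [/\ is_uz D H, connected_hopf H,
      \dim {: H} = (p ^ n.+1)%N & primitives_iso H h]]].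

Definition primitive_deformation (H : hopfType K) : Prop :=
  exists2 D, PD_datum D & is_uz D H.

Definition of_type (H : hopfType K) : Prop :=
  exists2 H', primitive_deformation H' & hopf_iso H H'.

Definition quantum_group_classes (c : hopfType K -> Prop) : Prop :=
  exists2 H, class_X p n H /\ of_type H & c = iso_class H.

Definition primitive_deformation_classes (c : hopfType K -> Prop) : Prop :=
  exists2 H, primitive_deformation H & c = iso_class H.

Definition datum_equiv (D D' : datum) : Prop :=
  exists2 s, s \in Uplus & D'.1 - D.1 = Phi1 s /\ D'.2 - D.2 = cobar1 s.

Definition H2_class (D : datum) : set datum :=
  [set D' | PD_datum D' /\ datum_equiv D D'].

Definition H2 : set (set datum) := H2_class @` PD_datum.

(* The pairs (gamma, phi_2). *)
Definition Aut_type : set (K * 'End(h)) :=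
  [set phi : K * 'End(h) | [/\ phi.1 != 0 /\ phi.1 ^+ p * lambda = phi.1 * lambda,
    bijective phi.2, forall a, phi.2 (rpow a) = rpow (phi.2 a) &
    forall a, type_rho T z (phi.2 a) = phi.1 *: phi.2 (type_rho T z a)]].

(* D' = phi(D); F is the endomorphism of u(h) induced by phi_2. *)
Definition Aut_act (phi : K * 'End(h)) (D D' : datum) : Prop :=
  exists2 F : {lrmorphism U -> U}, (forall a, F (iota a) = iota (phi.2 a)) &
    D' = (phi.1 ^+ p *: F D.1, phi.1 *: tmap F F D.2).

Definition Aut_act_class (phi : K * 'End(h)) (c : set datum) : set datum :=
  [set D' | exists2 D, c D & Aut_act phi D D'].

Definition H2_orbit (c : set datum) : set (set datum) :=
  [set Aut_act_class phi c | phi in Aut_type].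

Definition H2_mod_Aut : set (set (set datum)) := H2_orbit @` H2.

Section Param.
Context (x : n.-tuple h).

Definition omega (r : U) : tensor U U :=
  \sum_(1 <= i < p)
     ((p.-1)`!%:R / (i`!%:R * (p - i)`!%:R)) *: tens (r ^+ i) (r ^+ (p - i)).

Definition chi_of (P : param K n) : tensor U U :=
  \sum_(ij : ltpair n) P.1 ij *:
     tens (iota (tnth x (val ij).1)) (iota (tnth x (val ij).2))
  + omega (iota (\sum_k P.2 k *: tnth x k)).

Definition Aplus : set (param K n) :=
  [set P | P != 0 /\
    exists2 s, s \in Uplus & Phi2 (chi_of P) = cobar1 s /\ rhoU s = 0].

(* gamma^(1/p), unique by injectivity of Frobenius when p is the              *)
(* characteristic, and existing when K is closed.                             *)
Definition proot (c : K) : K := xget 0 [set d | d ^+ p = c].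

Definition Aut_act_param (phi : K * 'End(h)) (P : param K n) : param K n :=
  let G i j := coord x j (phi.2 (tnth x i)) in
  ([ffun ij : ltpair n => \sum_(rs : ltpair n)
      let: (i, j) := val ij in let: (r, s) := val rs in
      phi.1 * (G r i * G s j - G r j * G s i) * P.1 rs],
   [ffun k => \sum_s proot phi.1 * G s k * P.2 s]).

Definition param_orbit (P : param K n) : set (param K n) :=
  [set Aut_act_param phi P | phi in Aut_type].

Definition Aplus_mod_Aut : set (set (param K n)) := param_orbit @` Aplus.

End Param.
End PrimitiveDeformations.

(* Main.v *)
(* Let D = (Theta, chi) be a datum. If u_z(D) is a Hopf algebra, it is free    *)
(* over u(h) on 1, z, ..., z^(p-1), and pairing a tensor factor with the       *)
(* coefficient of z shows that an isomorphism u_z(D) -> u_z(D') restricts to   *)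
(* an automorphism of h and maps z to c z' + s with c in k^x, s in u(h)^+.     *)
(* Comparing relations and coproducts, such maps correspond exactly to an      *)
(* automorphism of T followed by a change of representative                    *)
(* (Theta, chi) -> (Theta + Phi_z(s), chi + d^1(s)), whence (ii) = (iii).      *)
(*                                                                             *)
(* D is a PD datum iff rho_z(Theta) = 0, chi is a cocycle but no coboundary,   *)
(* and Phi_z(chi) = d^1(Theta): Jacobson's formula then makes the coproduct    *)
(* compatible with the relations, conilpotency gives the antipode (Takeuchi)   *)
(* and connectedness, and a primitive j(u) + c z with c <> 0 would make chi a  *)
(* coboundary. For p > 2 the pairings of a cocycle with the basis of u(h)^*    *)
(* dual to the divided-power monomials show that it is cohomologous to exactly *)
(* one chi_P. Two data with the same chi have Theta's that differ by a         *)
(* primitive element killed by rho_z, that is, by an element of Phi_z(h) when  *)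
(* T is permissible.                                                           *)

From HB Require Import structures.
Require Import Defs.
From mathcomp Require Import all_boot all_order all_algebra all_field.
From mathcomp Require Import ring.
From mathcomp Require Import mathcomp_extra boolp classical_sets functions.

Set Implicit Arguments.
Unset Strict Implicit.
Unset Printing Implicit Defensive.

Import GRing.Theory VectorInternalTheory.

Local Open Scope classical_set_scope.
Local Open Scope ring_scope.

(** * Tensor products of algebras *)

(** Coordinates on u(h). The map from h to u(h) is injective ([env_in_inj]), which yields
    functionals dual to the divided-power monomials ([dual_basis]) whose convolution adds the
    indices ([dual_comul]). In these coordinates a cocycle of degree two is a function c(a, b) with
    c(a + b, c') = c(a, b + c'), and it is a coboundary exactly when it is symmetric on pairs of
    generators and vanishes at (x_k, x_k^(p-1)) for all k ([coboundary_criterion],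
    [coboundary_coef2]). For p > 2 the normal forms chi_P realise every value of these invariants
    exactly once ([chi_class]).

    Isomorphisms. For a PD datum D the powers 1, z, ..., z^(p-1) are a basis of u_z(D) over u(h), by
    generation and a dimension count. Pairing the right tensor factor with the coefficient of z
    turns the coproduct into d/dz, so an element that is primitive up to a term in u(h) (x) u(h) is
    linear in z ([almost_primitive]). An isomorphism hence preserves h and sends z to c z' + s;
    comparing relations and coproducts makes it a [transport] ([iso_transported]). Conversely a
    transport only changes the generators of one Hopf algebra ([is_uz_transport]). Orbits of classes
    under Aut(T) are exactly the classes of data under transport ([H2_orbitP]), so (ii) and (iii)
    agree; (i) and (ii) agree by [quantum_group_classesE].

    Which data occur. A PD datum satisfies rho(Theta) = 0, d^2(chi) = 0 and Phi(chi) = d^1(Theta)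
    ([PD_theta]), and chi is no coboundary ([PD_not_coboundary]). Under these conditions the Hopf
    algebra is constructed on a free u(h)-module of rank p ([uz_exists]), and its primitives are h
    ([PD_of_relations]). So the parameters P of the classes of PD data are exactly those in A^+(T)
    ([class_param_Aplus], [PD_of_Aplus]). If T is permissible, data with the same chi are
    equivalent, because their Theta's differ by an element of h killed by rho; this identifies (iii)
    with (iv) ([transportedP]). *)

Definition mklin (K : fieldType) (V W : lmodType K) (f : V -> W)
    (fl : linear f) : {linear V -> W} :=
  HB.pack f (GRing.isLinear.Build K V W *:%R f fl).

Definition mkalg (K : fieldType) (A B : algType K) (f : A -> B)
    (fl : linear f) (f1 : f 1 = 1) (fM : forall a b, f (a * b) = f a * f b) :
    {lrmorphism A -> B} :=
  HB.pack f (GRing.isLinear.Build K A B *:%R f fl)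
    (GRing.isMonoidMorphism.Build A B f (f1, fM)).

Section TensorTheory.
Context {K : fieldType}.
Implicit Types A B C : vectType K.

Lemma tensDl A B (a a' : A) (b : B) : tens (a + a') b = tens a b + tens a' b.
Proof. by have := tens_linearl b 1 a a'; rewrite !scale1r. Qed.

Lemma tensDr A B (a : A) (b b' : B) : tens a (b + b') = tens a b + tens a b'.
Proof. by have := tens_linearr a 1 b b'; rewrite !scale1r. Qed.

Lemma tens0l A B (b : B) : tens (0 : A) b = 0.
Proof. by rewrite /tens linear0 trmx0 mul0mx. Qed.

Lemma tens0r A B (a : A) : tens a (0 : B) = 0.
Proof. by rewrite /tens linear0 mulmx0. Qed.

Lemma tensZl A B c (a : A) (b : B) : tens (c *: a) b = c *: tens a b.
Proof. by have := tens_linearl b c a 0; rewrite tens0l !addr0. Qed.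

Lemma tensZr A B c (a : A) (b : B) : tens a (c *: b) = c *: tens a b.
Proof. by have := tens_linearr a c b 0; rewrite tens0r !addr0. Qed.

Lemma tensNl A B (a : A) (b : B) : tens (- a) b = - tens a b.
Proof. by rewrite -scaleN1r tensZl scaleN1r. Qed.

Lemma tensNr A B (a : A) (b : B) : tens a (- b) = - tens a b.
Proof. by rewrite -scaleN1r tensZr scaleN1r. Qed.

Lemma tens_suml A B (I : Type) (r : seq I) (P : pred I) (F : I -> A) (b : B) :
  tens (\sum_(i <- r | P i) F i) b = \sum_(i <- r | P i) tens (F i) b.
Proof. exact: (linear_sum (mklin (tens_linearl b))). Qed.

Lemma tens_sumr A B (I : Type) (r : seq I) (P : pred I) (F : I -> B) (a : A) :
  tens a (\sum_(i <- r | P i) F i) = \sum_(i <- r | P i) tens a (F i).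
Proof. exact: (linear_sum (mklin (tens_linearr a))). Qed.

Lemma tensor_ext A B (C : lmodType K) (f g : tensor A B -> C) :
  linear f -> linear g -> (forall a b, f (tens a b) = g (tens a b)) -> f =1 g.
Proof.
move=> fl gl fg; apply: tensor_ind => [c t t' IH IH'||//].
  by rewrite fl gl IH IH'.
by rewrite -[f 0]/(mklin fl 0) -[g 0]/(mklin gl 0) !linear0.
Qed.

Lemma tlift_ext A B (C : lmodType K) (f g : A -> B -> C) t :
  (forall a b, f a b = g a b) -> tlift f t = tlift g t.
Proof.
by move=> fg; apply: eq_bigr => i _; apply: eq_bigr => j _; rewrite fg.
Qed.

Lemma tlift_comp A B (C D : lmodType K) (f : A -> B -> C) (g : {linear C -> D}) t :
  g (tlift f t) = tlift (fun a b => g (f a b)) t.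
Proof.
rewrite linear_sum; apply: eq_bigr => i _; rewrite linear_sum.
by apply: eq_bigr => j _; rewrite linearZ.
Qed.

Lemma tliftM A B (R : algType K) (f : {linear A -> R}) (g : {linear B -> R}) a b :
  tlift (fun a b => f a * g b) (tens a b) = f a * g b.
Proof.
apply: tlift_tens => [b'|a'] c u v.
  by rewrite linearP mulrDl scalerAl.
by rewrite linearP mulrDr scalerAr.
Qed.

Lemma tliftZ A B (C : lmodType K) (f : {linear A -> K^o}) (g : {linear B -> C}) a b :
  tlift (fun a b => f a *: g b) (tens a b) = f a *: g b.
Proof.
apply: tlift_tens => [b'|a'] c u v.
  by rewrite linearP scalerDl -scalerA.
by rewrite linearP scalerDr !scalerA [c * _]mulrC.
Qed.

Lemma tmap_tens A B A' B' (f : {linear A -> A'}) (g : {linear B -> B'}) a b :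
  tmap f g (tens a b) = tens (f a) (g b).
Proof.
apply: tlift_tens => [b'|a'] c u v.
  by rewrite linearP tens_linearl.
by rewrite linearP tens_linearr.
Qed.

Lemma tmap_comp A B A' B' A'' B'' (f : {linear A -> A'}) (g : {linear B -> B'})
    (f' : {linear A' -> A''}) (g' : {linear B' -> B''}) t :
  tmap f' g' (tmap f g t) = tmap (f' \o f) (g' \o g) t.
Proof.
move: t; apply: tensor_ext => [c u v|c u v|a b]; rewrite ?linearP //.
by rewrite !tmap_tens.
Qed.

Lemma eq_tmap A B A' B' (f f' : A -> A') (g g' : B -> B') t :
  f =1 f' -> g =1 g' -> tmap f g t = tmap f' g' t.
Proof. by move=> ff gg; apply: tlift_ext => a b; rewrite ff gg. Qed.

Lemma tmap_id A B (t : tensor A B) : tmap idfun idfun t = t.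
Proof. by rewrite [RHS]tensor_sum. Qed.

Lemma tassoc_tens A B C (a : A) (b : B) (c : C) :
  tassoc (tens (tens a b : tensor A B) c) = tens a (tens b c : tensor B C).
Proof.
rewrite /tassoc tlift_tens => [|c'|t] //=.
- rewrite tlift_tens // => [b'|a'] e u v.
    by rewrite tens_linearl.
  by rewrite tens_linearl tens_linearr.
- by move=> e u v; apply: tlift_linear.
move=> e u v; rewrite /tlift !scaler_sumr -big_split; apply: eq_bigr => i _ /=.
rewrite scaler_sumr -big_split; apply: eq_bigr => j _ /=.
by rewrite !tens_linearr scalerDr !scalerA [_ * e]mulrC.
Qed.

Lemma tassoc_linear A B C : linear (@tassoc K A B C).
Proof. exact: tlift_linear. Qed.

End TensorTheory.

HB.instance Definition _ (K : fieldType) (A B C : vectType K) :=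
  GRing.isLinear.Build K _ _ *:%R (@tassoc K A B C) (@tassoc_linear K A B C).

Section TensorAlgebraTheory.
Context {K : fieldType}.
Implicit Types A B C : falgType K.

Lemma tens11 A B : tens 1 1 = 1 :> tensor A B.
Proof. by []. Qed.

Lemma tensX A B (a : A) (b : B) m :
  (tens a b : tensor A B) ^+ m = tens (a ^+ m) (b ^+ m).
Proof.
elim: m => [|m IH]; first by rewrite !expr0.
by rewrite !exprS IH tens_mul.
Qed.

(** The four linear maps to which [tensor_ext] is applied when an identity f(x y) = f(x) f(y) is
    reduced to pure tensors. *)
Lemma linear_mulP (R S : algType K) (f : R -> S) : linear f ->
  (forall y, linear (fun x => f (x * y))) * (forall y, linear (fun x => f (y * x)))
  * (forall y, linear (fun x => f x * y)) * (forall y, linear (fun x => y * f x)).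
Proof.
move=> fl; do ![split] => y c u v.
- by rewrite mulrDl -scalerAl fl.
- by rewrite mulrDr -scalerAr fl.
- by rewrite fl mulrDl -scalerAl.
- by rewrite fl mulrDr -scalerAr.
Qed.

Lemma tensor_multiplicative A B (R : algType K) (f : tensor A B -> R) :
  linear f ->
  (forall a b a' b', f (tens (a * a') (b * b')) = f (tens a b) * f (tens a' b')) ->
  forall s t, f (s * t) = f s * f t.
Proof.
move=> fl fM s t; have [[[Hl Hr] Kl] Kr] := linear_mulP fl.
move: s; apply: tensor_ext => // a b; move: t; apply: tensor_ext => // a' b'.
by rewrite tens_mul.
Qed.

Lemma tmapM A B A' B' (f : {lrmorphism A -> A'}) (g : {lrmorphism B -> B'}) s t :
  tmap f g (s * t) = tmap f g s * tmap f g t.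
Proof.
apply: tensor_multiplicative => [|a b a' b']; first exact: tlift_linear.
by rewrite !tmap_tens tens_mul !rmorphM.
Qed.

Lemma tmap1 A B A' B' (f : {lrmorphism A -> A'}) (g : {lrmorphism B -> B'}) :
  tmap f g 1 = 1.
Proof. by rewrite -tens11 tmap_tens !rmorph1. Qed.

HB.instance Definition _ A B A' B' (f : {lrmorphism A -> A'})
    (g : {lrmorphism B -> B'}) :=
  GRing.isMonoidMorphism.Build (tensor A B) (tensor A' B') (tmap f g)
    (tmap1 f g, tmapM f g).

Lemma tassocM A B C s t :
  @tassoc K A B C (s * t) = tassoc s * tassoc t.
Proof.
have [[[Hl Hr] Kl] Kr] := linear_mulP (@tassoc_linear K A B C).
move: s; apply: tensor_ext => // s c; move: t; apply: tensor_ext => // t c'.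
move: s; apply: tensor_ext => [e u v|e u v|a b].
- by rewrite tens_linearl mulrDl -scalerAl linearP.
- by rewrite tens_linearl linearP mulrDl -scalerAl.
move: t; apply: tensor_ext => [e u v|e u v|a' b'].
- by rewrite tens_linearl mulrDr -scalerAr linearP.
- by rewrite tens_linearl linearP mulrDr -scalerAr.
by rewrite !tassoc_tens !tens_mul tassoc_tens.
Qed.

Lemma tassoc1 A B C : @tassoc K A B C 1 = 1.
Proof. exact: tassoc_tens. Qed.

HB.instance Definition _ A B C :=
  GRing.isMonoidMorphism.Build _ _ (@tassoc K A B C)
    (@tassoc1 A B C, @tassocM A B C).

End TensorAlgebraTheory.

Section Subalgebra.
Context {K : fieldType} {B : algType K} (Q : B -> Prop).
Hypothesis Q1 : Q 1.
Hypothesis QP : forall c x y, Q x -> Q y -> Q (c *: x + y).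
Hypothesis QM : forall x y, Q x -> Q y -> Q (x * y).

Let q : {pred B} := fun x => `[< Q x >].

Fact subalgebra_closed : subalg_closed q.
Proof.
split=> [|c x y|x y]; rewrite !unfold_in; first exact/asboolP.
  by move=> /asboolP ? /asboolP ?; apply/asboolP/QP.
by move=> /asboolP ? /asboolP ?; apply/asboolP/QM.
Qed.

HB.instance Definition _ := GRing.isSubalgClosed.Build K B q subalgebra_closed.

Record subalgebra := Subalgebra { subalgebra_val : B; _ : subalgebra_val \in q }.

HB.instance Definition _ := [isSub for subalgebra_val].
HB.instance Definition _ := [Choice of subalgebra by <:].
HB.instance Definition _ := [SubChoice_isSubAlgebra of subalgebra by <:].

(** This serves the induction principles [env_ind] and [uz_ind]: a universal property maps into the
    subalgebra, and uniqueness then forces the subalgebra to be everything. *)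
Lemma subalgebra_of_pred : exists (S : algType K) (v : {lrmorphism S -> B}),
  [/\ injective v, forall s, Q (v s) & forall x, Q x -> exists s, v s = x].
Proof.
exists subalgebra.
have vl : linear (\val : subalgebra -> B) by exact: linearP.
have v1 : \val (1 : subalgebra) = 1 :> B by exact: rmorph1.
have vM (x y : subalgebra) : \val (x * y) = \val x * \val y :> B by exact: rmorphM.
pose v : {lrmorphism subalgebra -> B} := mkalg vl v1 vM.
exists v; split=> [|s|x Qx]; first exact: val_inj.
  by case: s => x xq; apply/asboolP.
have xq : x \in q by apply/asboolP.
by exists (Subalgebra xq).
Qed.

End Subalgebra.

(** * Jacobson's formula *)

Section CharP.
Context {K : fieldType} {p : nat} (charK : p \in [pchar K]).

Lemma pchar_alg (B : algType K) : p \in [pchar B].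
Proof.
apply/andP; split; first exact: pcharf_prime charK.
by rewrite -scaler_nat (pcharf0 charK) scale0r.
Qed.

Lemma natr_small_neq0 m : (0 < m < p)%N -> m%:R != 0 :> K.
Proof.
case/andP=> m0 mp; rewrite -(dvdn_pcharf charK).
by apply: contraL mp => /dvdn_leq -/(_ m0); rewrite -leqNgt.
Qed.

Lemma fact_small_neq0 m : (m < p)%N -> m`!%:R != 0 :> K.
Proof.
elim: m => [|m IH] mp; first by rewrite fact0 oner_neq0.
by rewrite factS natrM; apply: mulf_neq0; [apply: natr_small_neq0|apply/IH/ltnW].
Qed.

(** Pascal's rule and the divisibility of binomial(p, j+1) by p give binomial(p-1, j+1) = -
    binomial(p-1, j) in characteristic p. *)
Lemma bin_p1 (R : nzRingType) j : p \in [pchar R] -> (j < p)%N ->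
  (-1) ^+ j * 'C(p.-1, j)%:R = 1 :> R.
Proof.
move=> chR; elim: j => [|j IH] jp; first by rewrite expr0 bin0 mul1r.
have p_gt0 : (0 < p)%N by exact: leq_ltn_trans jp.
have: 'C(p, j.+1)%:R = 0 :> R.
  by apply/eqP; rewrite -(dvdn_pcharf chR) prime_dvd_bin ?(pcharf_prime chR).
rewrite -(prednK p_gt0) binS prednK // natrD => /eqP; rewrite addr_eq0 => /eqP ->.
by rewrite exprS mulN1r mulrNN IH // ltnW.
Qed.

(* Write [L] and [R] for the left and right multiplications by [x]; then      *)
(* [(L - R)^(p-1) = \sum_j L^j R^(p-1-j)] since [(-1)^j binomial(p-1, j) = 1] *)
(* modulo [p].                                                                *)
Lemma iter_ad (R : nzRingType) (x y : R) m :
  iter m (fun w => x * w - w * x) y =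
  \sum_(j < m.+1) (-1) ^+ j * 'C(m, j)%:R * (x ^+ (m - j) * y * x ^+ j).
Proof.
elim: m => [|m IH].
  by rewrite big_ord_recl big_ord0 !expr0 bin0 /= !(mul1r, mulr1) addr0.
rewrite iterS {}IH mulr_sumr mulr_suml.
rewrite [in RHS]big_ord_recl /= [X in _ = X + _]/= subn0 bin0 mulr1 expr0 !mul1r mulr1.
under [in RHS]eq_bigr => j _ do
  rewrite /bump /= add1n binS natrD mulrDr mulrDl subSS.
rewrite big_split /= addrA; congr (_ + _).
  rewrite [in LHS]big_ord_recl /= subn0 bin0 expr0 !mul1r mulr1 mulrA -exprS.
  congr (_ + _); rewrite [in RHS]big_ord_recr /= bin_small // mulr0 mul0r addr0.
  apply: eq_bigr => j _; rewrite /bump /= add1n.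
  have cx : GRing.comm x ((-1) ^+ j.+1 * 'C(m, j.+1)%:R).
    by apply: commrM; [apply: commr_sign|apply: commr_nat].
  by rewrite mulrA cx -[_ * x * _]mulrA; congr (_ * _); rewrite !mulrA -exprS subnSK.
rewrite -sumrN; apply: eq_bigr => j _.
by rewrite exprS !mulNr !mul1r -!mulrA -exprSr.
Qed.

Lemma iter_ad_p1 (R : nzRingType) (x y : R) : p \in [pchar R] ->
  iter p.-1 (fun w => x * w - w * x) y = \sum_(j < p) x ^+ (p.-1 - j) * y * x ^+ j.
Proof.
move=> chR; have p_gt0 := prime_gt0 (pcharf_prime chR).
rewrite iter_ad prednK //; apply: eq_bigr => j _.
by rewrite bin_p1 ?mul1r // (ltn_ord j).
Qed.

End CharP.

(** The derivative stays in the middle because [q] need not commute with it; this is the sum that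
    [iter_ad_p1] recognises as an iterated commutator. *)
Lemma derivX_noncomm (R : nzRingType) (q : {poly R}) m :
  (q ^+ m)^`() = \sum_(j < m) q ^+ (m.-1 - j) * q^`() * q ^+ j.
Proof.
elim: m => [|m IH]; first by rewrite expr0 derivE big_ord0.
rewrite exprS derivM IH big_ord_recr /= subnn expr0 mul1r addrC; congr (_ + _).
rewrite mulr_sumr; apply: eq_bigr => j _.
rewrite !mulrA -exprS; congr (q ^+ _ * _ * _).
by case: m j {IH} => [[]//|m] j; rewrite /= subSn // -ltnS.
Qed.

(* Jacobson's formula: in [B[t]] the [p]-th power of [a + t b] has derivative *)
(* [ad(a + t b)^(p-1)(b) = ad(a)^(p-1)(b)], which is constant, so only the    *)
(* coefficients of [1], [t] and [t^p] survive.                                *)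
Lemma jacobson (K : fieldType) (p : nat) (charK : p \in [pchar K])
    (B : algType K) (a b : B) :
  (forall i, GRing.comm b (iter i (fun w => a * w - w * a) b)) ->
  (a + b) ^+ p = a ^+ p + b ^+ p + iter p.-1 (fun w => a * w - w * a) b.
Proof.
move=> cb; have pr := pcharf_prime charK.
have p_gt0 := prime_gt0 pr; have p_gt1 := prime_gt1 pr.
pose q : {poly B} := a%:P + b%:P * 'X.
have q' : q^`() = b%:P by rewrite derivD derivC add0r derivM derivC mul0r add0r derivX mulr1.
have chP : p \in [pchar {poly B}] by rewrite pchar_poly (pchar_alg charK).
have adq i : iter i (fun w => q * w - w * q) b%:P =
    (iter i (fun w => a * w - w * a) b)%:P.
  elim: i => [//|i IH]; rewrite !iterS IH /q mulrDl mulrDr -mulrA -commr_polyX.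
  by rewrite !mulrA -!polyCM cb opprD addrACA subrr addr0 -polyCB.
have dq : (q ^+ p)^`() = (iter p.-1 (fun w => a * w - w * a) b)%:P.
  rewrite derivX_noncomm -adq (iter_ad_p1 _ _ chP).
  by apply: eq_bigr => j _; rewrite q'.
have szq m : (size (q ^+ m) <= m.+1)%N.
  apply: leq_trans (size_exp_leq _ _) _; rewrite ltnS.
  have sq : (size q <= 2)%N.
    by rewrite /q addrC size_MXaddC; case: ifP => // _; rewrite ltnS size_polyC leq_b1.
  have sq1 : ((size q).-1 <= 1)%N by case: (size q) sq => [|[|[]]].
  by rewrite -[leqRHS]mul1n leq_mul.
have coef_mid i : (1 < i < p)%N -> (q ^+ p)`_i = 0.
  move=> /andP[i1 ip]; have := congr1 (fun r : {poly B} => r`_i.-1) dq.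
  rewrite /= coef_deriv coefC prednK ?(ltnW i1) //.
  have -> : (i.-1 == 0)%N = false by case: i i1 {ip} => [|[]].
  rewrite -scaler_nat => /eqP; rewrite scaler_eq0 => /orP[|/eqP //].
  by rewrite (negPf (natr_small_neq0 charK _)) // ip ltnW.
have coef1 : (q ^+ p)`_1 = iter p.-1 (fun w => a * w - w * a) b.
  by have := congr1 (fun r : {poly B} => r`_0) dq; rewrite /= coef_deriv coefC.
have ev : q.[1] = a + b by rewrite hornerD hornerC hornerMX hornerC mulr1.
have evX : (q ^+ p).[1] = (a + b) ^+ p.
  by rewrite -ev horner_exp_comm // /comm_poly mul1r mulr1.
have coef0 : (q ^+ p)`_0 = a ^+ p.
  rewrite -horner_coef0 horner_exp_comm /comm_poly ?mul0r ?mulr0 //.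
  by rewrite hornerD hornerC hornerMX mulr0 addr0.
have coefX m : (q ^+ m)`_m = b ^+ m.
  elim: m => [|m IH]; first by rewrite !expr0 polyseq1.
  rewrite exprS {1}/q mulrDl -mulrA -commr_polyX mulrA coefD coefCM coefMX /=.
  by rewrite coefCM IH -exprS nth_default ?mulr0 ?add0r.
rewrite -evX (horner_coef_wide _ (szq p)).
rewrite big_ord_recr /= expr1n mulr1 coefX addrAC; congr (_ + _).
rewrite -(big_mkord xpredT (fun i => (q ^+ p)`_i * 1 ^+ i)) big_ltn // big_ltn //.
rewrite coef0 coef1 !expr1n !mulr1 big_nat_cond big1 ?addr0 // => i.
by rewrite andbT => /coef_mid ->; rewrite mul0r.
Qed.

(** * Restricted enveloping algebras *)

Section HopfBasics.
Context {K : fieldType}.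
Implicit Types H : hopfType K.

Definition counit_lin H : {linear H -> K^o} := counit.

Lemma counit1 H : @counit K H 1 = 1 :> K.
Proof. exact: rmorph1. Qed.

Lemma counit0 H : @counit K H 0 = 0 :> K.
Proof. exact: linear0. Qed.

Lemma counitZ H c (x : H) : counit (c *: x) = c * counit x :> K.
Proof. by rewrite linearZ. Qed.

Lemma counit_alg H c : @counit K H c%:A = c :> K.
Proof. by rewrite counitZ counit1 mulr1. Qed.

Lemma counit_primitive H (x : H) :
  comul x = tens x 1 + tens 1 x -> counit x = 0 :> K.
Proof.
move=> dx; have := counitl x; rewrite dx linearD /=.
rewrite !(tliftZ (counit_lin H) idfun) /= counit1 scale1r.
rewrite -[RHS]add0r => /addIr /(congr1 (fun y => counit y : K)).
by rewrite counit_alg linear0.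
Qed.

Lemma tens_squareS H (C : {vspace H}) a b :
  a \in C -> b \in C -> tens a b \in tens_square C.
Proof.
move=> aC bC; rewrite (coord_vbasis aC) tens_suml memv_suml // => i _.
rewrite tensZl memvZ // (coord_vbasis bC) tens_sumr memv_suml // => j _.
rewrite tensZr memvZ // memv_span //; apply/allpairsP.
by exists ((vbasis C)`_i, (vbasis C)`_j); rewrite !mem_nth ?size_tuple.
Qed.

Lemma tens_square_ind H (C : {vspace H}) (P : tensor H H -> Prop) :
  (forall c t t', P t -> P t' -> P (c *: t + t')) -> P 0 ->
  (forall a b, a \in C -> b \in C -> P (tens a b)) ->
  forall t, t \in tens_square C -> P t.
Proof.
move=> PP P0 Pt t /(@coord_span _ _ _ (in_tuple _)) ->; apply: (big_ind P) => // [u v Pu Pv|i _].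
  by rewrite -[u]scale1r; apply: PP.
rewrite -[_ *: _]addr0; apply: PP => //.
have /allpairsP[[a b] /= [aC bC ->]] := mem_nth 0 (ltn_ord i).
by apply: Pt; apply: vbasis_mem.
Qed.

Lemma augmentation_proj H (x : H) : x - (counit x : K)%:A \in augmentation_ideal H.
Proof.
by apply/augmentation_idealP; rewrite linearB /= counit_alg subrr.
Qed.

Definition counit_left H : tensor H H -> H :=
  tlift (fun a b : H => (counit a : K) *: b).
Definition counit_right H : tensor H H -> H :=
  tlift (fun a b : H => (counit b : K) *: a).

HB.instance Definition _ H := GRing.isLinear.Build K _ _ *:%R (@counit_left H)
  (tlift_linear (fun a b : H => (counit a : K) *: b)).
HB.instance Definition _ H := GRing.isLinear.Build K _ _ *:%R (@counit_right H)
  (tlift_linear (fun a b : H => (counit b : K) *: a)).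

Lemma counit_left_tens H (a b : H) : counit_left (tens a b) = (counit a : K) *: b.
Proof. exact: (tliftZ (counit_lin H) idfun). Qed.

Lemma counit_right_tens H (a b : H) : counit_right (tens a b) = (counit b : K) *: a.
Proof.
apply: tlift_tens => [b'|a'] c u v; first by rewrite scalerDr !scalerA mulrC.
by rewrite linearP scalerDl scalerA.
Qed.

(** Applying the projection x - counit(x) 1 to both factors lands in the tensor square of the
    augmentation ideal, and it changes a tensor only by terms built from its two partial counits. *)
Lemma tens_square_augP H (t : tensor H H) :
  t \in tens_square (augmentation_ideal H) <-> counit_left t = 0 /\ counit_right t = 0.
Proof.
split.
  move: t; apply: tens_square_ind => [c t t' [l r] [l' r']||a b]; rewrite ?linear0 //.
    by rewrite !linearP /= l r l' r' !scaler0 !addr0.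
  move=> /augmentation_idealP ea /augmentation_idealP eb.
  by rewrite counit_left_tens counit_right_tens ea eb !scale0r.
case=> l r; pose q : H -> H := fun x => x - (counit x : K)%:A.
have ql : linear q.
  move=> c u v; rewrite /q linearP /= scalerDl -[counit u]/(counit u : K).
  by rewrite -[in LHS]scalerA opprD addrACA scalerBr.
(* [e] is the projection [q] on both factors, written out with the partial counits. *)
pose e t : tensor H H := t - tens 1 (counit_left t) - tens (counit_right t) 1
   + (counit (counit_left t) : K)%:A.
have el : linear e.
  move=> c u v; rewrite /e !linearP /= tens_linearl tens_linearr.
  rewrite -/(counit (counit_left u) : K) scalerDl -scalerA.
  rewrite !opprD [c *: u + v + _]addrACA [X in X + _]addrACA [LHS]addrACA.
  by rewrite !scalerDr !scalerN.
have -> : t = tmap (mklin ql) (mklin ql) t.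
  have -> : tmap (mklin ql) (mklin ql) t = e t.
    rewrite {l r}; move: t; apply: tensor_ext => // [c u v|a b]; first by rewrite linearP.
    rewrite tmap_tens /= /q /e counit_left_tens counit_right_tens counitZ.
    rewrite tensDl !tensDr !tensNl !tensNr !tensZl !tensZr tens11 opprK scalerA.
    by rewrite addrA [X in X + _]addrAC.
  by rewrite /e l r tens0l tens0r counit0 scale0r !subr0 addr0.
rewrite {l r}; move: t; apply: tensor_ind => [c t t' Ht Ht'||a b].
- by rewrite linearP rpredD ?rpredZ.
- by rewrite linear0 mem0v.
- by rewrite tmap_tens; apply: tens_squareS; apply: augmentation_proj.
Qed.

End HopfBasics.

Section Enveloping.
Context {K : fieldType} {p : nat} {h : abelianRLieType K p} (U : restricted_env h).
Local Notation iota := (env_in U).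

(** The universal property maps u(h) to the subalgebra cut out by [Q]; followed by the inclusion,
    this map agrees with the identity on h, hence everywhere by uniqueness. *)
Lemma env_ind (Q : U -> Prop) : Q 1 ->
  (forall c x y, Q x -> Q y -> Q (c *: x + y)) ->
  (forall x y, Q x -> Q y -> Q (x * y)) -> (forall a, Q (iota a)) -> forall u, Q u.
Proof.
move=> Q1 QP QM Qi u.
have [S [v [vi vQ vS]]] := subalgebra_of_pred Q1 QP QM.
have [f fv] : exists f : h -> S, forall a, v (f a) = iota a.
  by exists (fun a => projT1 (cid (vS _ (Qi a)))) => a; case: cid.
have fl : linear f by move=> c a b; apply: vi; rewrite fv !linearP /= !fv.
have fr : restricted_morphism (mklin fl).
  have [ip ic] := env_inP U.
  by split=> [a|a b]; apply: vi; rewrite ?rmorphXn ?rmorphM /= !fv.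
have [g gf _] := env_univ U fr.
have [w _ wu] := env_univ U (env_inP U).
pose vg : {lrmorphism U -> U} := v \o g.
have vgi a : vg (iota a) = iota a by rewrite /= gf fv.
have e1 := wu vg vgi u; have e2 := wu idfun (fun a => erefl) u.
have -> : u = v (g u) by exact: etrans e2 (esym e1).
exact: vQ.
Qed.

Lemma env_alg_ext (B : algType K) (f g : {lrmorphism U -> B}) :
  (forall a, f (iota a) = g (iota a)) -> f =1 g.
Proof.
move=> fg; apply: env_ind => [|c x y fx fy|x y fx fy|//].
- by rewrite !rmorph1.
- by rewrite !linearP /= fx fy.
- by rewrite !rmorphM /= fx fy.
Qed.

Lemma env_mulC (u v : U) : u * v = v * u.
Proof.
have comm_lin (y x x' : U) c :
    x * y = y * x -> x' * y = y * x' -> (c *: x + x') * y = y * (c *: x + x').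
  by move=> e e'; rewrite mulrDl mulrDr -scalerAl -scalerAr e e'.
have comm_mul (y x x' : U) :
    x * y = y * x -> x' * y = y * x' -> (x * x') * y = y * (x * x').
  by move=> e e'; rewrite -mulrA e' mulrA e mulrA.
have ci a x : x * iota a = iota a * x.
  elim/env_ind: x => [|c x y|x y|b].
  - by rewrite mulr1 mul1r.
  - exact: comm_lin.
  - exact: comm_mul.
  - by case: (env_inP U).
elim/env_ind: u => [|c x y|x y|a].
- by rewrite mulr1 mul1r.
- exact: comm_lin.
- exact: comm_mul.
- by rewrite ci.
Qed.

Lemma env2_mulC (s t : tensor U U) : s * t = t * s.
Proof.
have sub (x y y' : tensor U U) c :
    y * x = x * y -> y' * x = x * y' -> (c *: y + y') * x = x * (c *: y + y').
  by move=> e e'; rewrite mulrDl mulrDr -scalerAl -scalerAr e e'.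
move: s; apply: tensor_ind => [c s s'||a b]; first exact: sub.
  by rewrite mulr0 mul0r.
move: t; apply: tensor_ind => [c t t' /esym e /esym e'||a' b'].
- exact/esym/sub.
- by rewrite mulr0 mul0r.
by rewrite !tens_mul ![_ * a']env_mulC ![_ * b']env_mulC.
Qed.

Lemma counit_env a : counit (iota a) = 0 :> K.
Proof. exact/counit_primitive/env_in_prim. Qed.

Lemma env_hopf_morphism (H : hopfType K) (f : {lrmorphism U -> H}) :
  (forall a, comul (f (iota a)) = tens (f (iota a)) 1 + tens 1 (f (iota a))) ->
  hopf_morphism f.
Proof.
move=> fp; split.
  apply: (@env_alg_ext _ (comul \o f) (tmap f f \o comul)) => a /=.
  by rewrite fp env_in_prim linearD /= !tmap_tens rmorph1.
apply: (@env_alg_ext _ (counit \o f) counit) => a /=.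
rewrite counit_env; exact: (counit_primitive (fp a)).
Qed.

End Enveloping.

(** * Injectivity of the map from h to u(h) *)

Lemma vector_seq_dependent (K : fieldType) (V : vectType K) (v : nat -> V) :
  exists m (d : nat -> K), v m = \sum_(i < m) d i *: v i.
Proof.
pose s := fix s m := if m is m'.+1 then v m' :: s m' else [::].
have sz m : size (s m) = m by elim: m => //= m ->.
have [m vm] : exists m, v m \in <<s m>>%VS.
  apply/not_existsP => nv.
  have fr m : free (s m).
    elim: m => [|m IH] /=; first by rewrite nil_free.
    by rewrite free_cons IH andbT; apply/negP/nv.
  have := fr (dim V).+1; rewrite -[s _]/(val (in_tuple (s _))) => /eqP /= e.
  have := dimvS (subvf <<s (dim V).+1>>%VS).
  by rewrite e sz dimvf ltnn.
exists m; move: (v m) vm => x; elim: m x => [|m IH] x /=.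
  by rewrite span_nil memv0 => /eqP ->; exists (fun=> 0); rewrite big_ord0.
rewrite span_cons => /memv_addP[y /vlineP[c ->] [y' /IH[d ->] ->]].
exists (fun i => if i == m then c else d i).
rewrite big_ord_recr /= eqxx addrC; congr (_ + _).
by apply: eq_bigr => i _; rewrite ltn_eqF.
Qed.

Section FrobeniusRoot.
Context {K : closedFieldType} {p : nat} (charK : p \in [pchar K]).

Lemma prootK (c : K) : @proot K p c ^+ p = c.
Proof.
have p_gt0 := prime_gt0 (pcharf_prime charK).
have [x xp] := @solve_monicpoly K p (fun i => if i == 0 then c else 0) p_gt0.
have ex : [set d : K | d ^+ p = c] x.
  rewrite /= xp -(prednK p_gt0) big_ord_recl /= expr0 mulr1 big1 ?addr0 // => i _.
  by rewrite mul0r.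
exact: xgetPex (ex_intro _ x ex).
Qed.

Lemma frobenius_inj (c d : K) : c ^+ p = d ^+ p -> c = d.
Proof. exact: (fmorph_inj (pFrobenius_aut charK)). Qed.

Lemma exprDp (c d : K) : (c + d) ^+ p = c ^+ p + d ^+ p.
Proof. exact: (rmorphD (pFrobenius_aut charK)). Qed.

End FrobeniusRoot.

Section Faithful.
Context {K : closedFieldType} {p : nat} (charK : p \in [pchar K]).
Context {h : abelianRLieType K p}.

Section Functional.
Variable g : {linear h -> K^o}.

(** The i-th twist satisfies rfun_i(a)^(p^i) = g(b), where b is the i-fold p-map of a. The p-th root
    taken at each stage undoes the semilinearity of the p-map, so every twist is linear. *)
Fixpoint rfun i (a : h) : K :=
  if i is i'.+1 then @proot K p (rfun i' (rpow a)) else g a.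

Lemma rfunS i a : rfun i.+1 a ^+ p = rfun i (rpow a).
Proof. exact: prootK. Qed.

Lemma rfun_linear i c a b : rfun i (c *: a + b) = c * rfun i a + rfun i b.
Proof.
elim: i c a b => [|i IH] c a b; first exact: linearP.
apply: (frobenius_inj charK); rewrite (exprDp charK) exprMn !rfunS.
by rewrite rpowD rpowZ IH.
Qed.

(* If the [m]-th twist of [g] is the combination [\sum_(i < m) d_i g_i] of    *)
(* the previous ones, then [a |-> \sum_(i < m) g_i(a) s_i] is a restricted    *)
(* morphism as soon as [s_i^p = s_(i-1) + d_i^p s_(m-1)] with [s_(-1) = 0].   *)
(* Starting from [s_(m-1) = X] this determines [s_(m-1-j) = twist_poly j] and *)
(* the relation [twist_poly m = 0].                                           *)
Section Model.
Variables (m : nat) (d : nat -> K).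
Hypothesis dep : forall a, rfun m a = \sum_(i < m) d i * rfun i a.

Fixpoint twist_poly j : {poly K} :=
  if j is j'.+1 then twist_poly j' ^+ p - d (m.-1 - j') ^+ p *: 'X else 'X.

Lemma twist_poly_monic j : size (twist_poly j) = (p ^ j).+1 /\ twist_poly j \is monic.
Proof.
have p_gt1 := prime_gt1 (pcharf_prime charK).
elim: j => [|j [IHs IHm]]; first by rewrite size_polyX monicX.
have sp : size (twist_poly j ^+ p) = (p ^ j.+1).+1.
  have nz : twist_poly j ^+ p != 0 by rewrite expf_neq0 // monic_neq0.
  by rewrite -[LHS]prednK ?size_poly_gt0 // size_exp IHs /= expnSr.
have lt : (size (- (d (m.-1 - j) ^+ p *: 'X : {poly K})) < size (twist_poly j ^+ p))%N.
  rewrite size_polyN sp (leq_ltn_trans (size_scale_leq _ _)) // size_polyX ltnS.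
  apply: (leq_trans p_gt1). rewrite -{1}[p]expn1. by rewrite leq_exp2l //.
split; first by rewrite /= size_polyDl.
by rewrite monicE lead_coefDl // -monicE monic_exp.
Qed.

Let Q := twist_poly m.
Let f a : {poly %/ Q} := in_qpoly Q (\sum_(i < m) rfun i a *: twist_poly (m.-1 - i)).

(** [{poly %/ Q}] silently replaces a modulus that is constant or not monic; this excludes it for
    [Q]. *)
Lemma mk_monic_twist : mk_monic Q = Q.
Proof.
have p_gt0 := prime_gt0 (pcharf_prime charK).
have [sQ mQ] := twist_poly_monic m.
by rewrite /mk_monic sQ mQ ltnS expn_gt0 p_gt0.
Qed.

Lemma model_linear : linear f.
Proof.
move=> c a b; rewrite /f -linearP; congr (in_qpoly _ _).
rewrite scaler_sumr -big_split; apply: eq_bigr => i _ /=.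
by rewrite rfun_linear scalerDl scalerA.
Qed.

(** Raising to the p-th power moves each term one step along the recursion of [twist_poly]. The
    corrections d_i^p X add up, by the dependence relation, to the missing term rfun_m(a)^p X, and
    the term containing [twist_poly m] vanishes in the quotient. *)
Lemma model_rpow a : f (rpow a) = f a ^+ p.
Proof.
have chP : p \in [pchar {poly K}] by rewrite pchar_poly.
rewrite /f -rmorphXn /= -(pFrobenius_autE chP) (rmorph_sum (pFrobenius_aut chP)) /=.
have e i : (i < m)%N -> pFrobenius_aut chP (rfun i a *: twist_poly (m.-1 - i)) =
    rfun i a ^+ p *: twist_poly (m - i) + (d i * rfun i a) ^+ p *: 'X.
  move=> im; rewrite pFrobenius_autE exprZn.
  have -> : (m - i = (m.-1 - i).+1)%N by rewrite -subSn ?(ltn_predK im) // -ltnS (ltn_predK im).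
  rewrite /= scalerBr scalerA exprMn.
  have -> : (m.-1 - (m.-1 - i) = i)%N by rewrite subKn // -ltnS (ltn_predK im).
  by rewrite [d i ^+ p * _]mulrC subrK.
under [in RHS]eq_bigr => i _ do rewrite e //.
rewrite big_split /= -scaler_suml.
have -> : \sum_(i < m) (d i * rfun i a) ^+ p = rfun m a ^+ p.
  rewrite dep -(pFrobenius_autE charK) rmorph_sum.
  by apply: eq_bigr => i _.
under [in LHS]eq_bigr => i _ do rewrite -rfunS.
have -> : rfun m a ^+ p *: 'X = rfun m a ^+ p *: twist_poly (m - m) by rewrite subnn.
transitivity (in_qpoly Q (\sum_(i < m.+1) rfun i a ^+ p *: twist_poly (m - i)));
  last by rewrite big_ord_recr.
rewrite big_ord_recl /= subn0 linearD /= linearZ /=.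
have -> : in_qpoly Q Q = 0.
  by apply: val_inj; rewrite /= mk_monic_twist Pdiv.Ring.rmodpp //; apply: mulrC.
rewrite scaler0 add0r; congr (in_qpoly _ _).
apply: eq_bigr => i _; rewrite /bump /= add1n.
by rewrite -subn1 -subnDA add1n.
Qed.

(** The terms have the distinct degrees p^(m-1-i), all below p^m. So nothing is reduced modulo [Q],
    and the coefficient of X^(p^(m-1)) is g(a) itself. *)
Lemma model_eq0 a : f a = 0 -> (0 < m)%N -> g a = 0.
Proof.
move=> fa m_gt0; have p_gt1 := prime_gt1 (pcharf_prime charK).
have szle (i : 'I_m) : (size (twist_poly (m.-1 - i)) <= (p ^ m.-1).+1)%N.
  by rewrite (twist_poly_monic _).1 ltnS leq_exp2l // leq_subr.
have := congr1 (fun q => val q) fa; rewrite /= Pdiv.CommonRing.rmodp_small; last first.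
  rewrite mk_monic_twist (twist_poly_monic m).1.
  apply: leq_ltn_trans (size_sum _ _ _) _; rewrite ltnS; apply/bigmax_leqP => i _.
  apply: leq_trans (size_scale_leq _ _) _; apply: leq_trans (szle i) _.
  by rewrite ltn_exp2l // ltn_predL.
move=> /(congr1 (fun q : {poly K} => q`_(p ^ m.-1))); rewrite coef0 coef_sum.
rewrite -(big_mkord xpredT (fun i => (rfun i a *: twist_poly (m.-1 - i))`_(p ^ m.-1))).
rewrite big_ltn // subn0.
have [s0 /monicP l0] := twist_poly_monic m.-1.
have e0 : (twist_poly m.-1)`_(p ^ m.-1) = 1 by rewrite -l0 lead_coefE s0.
rewrite coefZ e0 mulr1 big_nat_cond big1 ?addr0 // => i.
rewrite andbT => /andP[i0 im]; rewrite coefZ nth_default ?mulr0 //.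
by rewrite (twist_poly_monic _).1 ltn_exp2l // ltn_subrL i0 -ltnS (ltn_predK im) (leq_trans _ im).
Qed.

End Model.

(** The twists of g lie in the finite-dimensional dual of h, so one of them depends on the earlier
    ones, which is what the model requires. If this is already the 0-th one, then g = 0. *)
Lemma restricted_model : exists (B : algType K) (f : {linear h -> B}),
  restricted_morphism f /\ forall a, f a = 0 -> g a = 0.
Proof.
have rl i : linear (rfun i : h -> K^o) by move=> c a b; apply: rfun_linear.
have [m [d md]] := vector_seq_dependent (fun i => linfun (mklin (rl i))).
have dep a : rfun m a = \sum_(i < m) d i * rfun i a.
  have /lfunP/(_ a) := md; rewrite (lfunE (mklin (rl m))) /= => ->.
  by rewrite sum_lfunE; apply: eq_bigr => i _; rewrite scale_lfunE (lfunE (mklin (rl i))).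
exists {poly %/ twist_poly m d m}, (mklin (model_linear m d)); split.
  by split=> [a|a b]; [apply: model_rpow|rewrite mulrC].
move=> a /=; case: (posnP m) => [m0 _|m_gt0 fa]; last exact: model_eq0 fa m_gt0.
by have := dep a; rewrite m0 big_ord0.
Qed.

End Functional.

(** The universal property extends the model of a functional g to u(h), so g vanishes at every
    element of h that becomes 0 there. This is applied to the coordinate functionals of h. *)
Lemma env_in_inj (U : restricted_env h) : injective (env_in U).
Proof.
move=> a b /eqP; rewrite -subr_eq0 -linearB => /eqP e0; apply/eqP.
rewrite -subr_eq0; move: (a - b) e0 => x ix; apply/eqP.
apply: (can_inj v2rK); rewrite linear0; apply/rowP => i; rewrite mxE.
have gl : linear (fun y : h => v2r y 0 i : K^o).
  by move=> c u v; rewrite linearP !mxE.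
have [B [f [fr f0]]] := restricted_model (mklin gl).
have [F Fi _] := env_univ U fr.
by apply: (f0 x); rewrite -Fi ix linear0.
Qed.

End Faithful.

(** * Divided-power monomials and their dual basis *)

Section Pairing.
Context {K : fieldType}.
Implicit Types A B : vectType K.

Definition tpair A B (f : A -> K^o) (g : B -> K^o) : tensor A B -> K^o :=
  tlift (fun a b => f a * g b : K^o).

HB.instance Definition _ A B (f : A -> K^o) (g : B -> K^o) :=
  GRing.isLinear.Build K (tensor A B) K^o *:%R (tpair f g) (tlift_linear _).

Lemma tpair_tens A B (f : {linear A -> K^o}) (g : {linear B -> K^o}) a b :
  tpair f g (tens a b) = f a * g b.
Proof. exact: tliftM. Qed.

Lemma tpair_tmap A B A' B' (f : {linear A' -> K^o}) (g : {linear B' -> K^o})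
    (u : {linear A -> A'}) (v : {linear B -> B'}) t :
  tpair f g (tmap u v t) = tpair (f \o u) (g \o v) t.
Proof.
move: t; apply: tensor_ext => [c s t|c s t|a b]; rewrite ?linearP //.
by rewrite tmap_tens !tpair_tens.
Qed.

Lemma tensor_expansion A B (I J : finType) (f : I -> {linear A -> K^o}) (a : I -> A)
    (g : J -> {linear B -> K^o}) (b : J -> B) :
  (forall u, u = \sum_i f i u *: a i) -> (forall u, u = \sum_j g j u *: b j) ->
  forall t, t = \sum_i \sum_j tpair (f i) (g j) t *: tens (a i) (b j).
Proof.
move=> fa gb t.
have E : linear (fun t => \sum_i \sum_j tpair (f i) (g j) t *: tens (a i) (b j)).
  move=> c u v; rewrite scaler_sumr -big_split; apply: eq_bigr => i _ /=.
  rewrite scaler_sumr -big_split; apply: eq_bigr => j _ /=.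
  by rewrite linearP scalerDl scalerA.
move: t; apply: tensor_ext => // u v.
rewrite {1}(fa u) {1}(gb v) tens_suml; apply: eq_bigr => i _.
rewrite tens_sumr; apply: eq_bigr => j _.
by rewrite tensZl tensZr scalerA tpair_tens.
Qed.

End Pairing.

Section MultiIndex.
Context {n : nat}.

Definition mindex := {ffun 'I_n -> nat}.
Implicit Types a b c : mindex.

Definition madd a b : mindex := [ffun i => a i + b i]%N.
Definition mzero : mindex := [ffun=> 0%N].
Definition meps (k : 'I_n) : mindex := [ffun i => nat_of_bool (i == k)].
Definition mdeg a := (\sum_i a i)%N.

Lemma maddC a b : madd a b = madd b a.
Proof. by apply/ffunP => i; rewrite !ffunE addnC. Qed.

Lemma maddA a b c : madd a (madd b c) = madd (madd a b) c.
Proof. by apply/ffunP => i; rewrite !ffunE addnA. Qed.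

Lemma madd0 a : madd a mzero = a.
Proof. by apply/ffunP => i; rewrite !ffunE addn0. Qed.

Lemma mdegD a b : mdeg (madd a b) = (mdeg a + mdeg b)%N.
Proof. by rewrite /mdeg -big_split; apply: eq_bigr => i _; rewrite ffunE. Qed.

Lemma mdeg_eps k : mdeg (meps k) = 1%N.
Proof.
rewrite /mdeg (bigD1 k) //= ffunE eqxx big1 ?addn0 // => i /negPf ik.
by rewrite ffunE ik.
Qed.

Lemma mdeg_eq0 a : (mdeg a == 0)%N = (a == mzero).
Proof.
rewrite /mdeg sum_nat_eq0; apply/forallP/eqP => [H|-> i]; last by rewrite ffunE.
by apply/ffunP => i; rewrite ffunE; apply/eqP/(implyP (H i)).
Qed.

Lemma mdeg0 : mdeg mzero = 0%N.
Proof. by apply/eqP; rewrite mdeg_eq0. Qed.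

Lemma meps_split a : a != mzero -> exists k b, a = madd (meps k) b.
Proof.
rewrite -mdeg_eq0 sum_nat_eq0 => /forallPn[k]; rewrite /= => ak.
exists k, [ffun i => a i - meps k i]%N; apply/ffunP => i; rewrite !ffunE.
by case: (eqVneq i k) => [->|_]; rewrite ?subn0 // subnKC // lt0n.
Qed.

End MultiIndex.
Arguments mindex : clear implicits.

Section DividedPowers.
Context {K : fieldType} {p : nat} (charK : p \in [pchar K]).

(* For [m >= p] this is [0], because [m! = 0] in [K] and [0^-1 = 0]. *)
Definition divpow (R : lalgType K) m (y : R) : R := m`!%:R^-1 *: y ^+ m.

Lemma divpow0 (R : lalgType K) (y : R) : divpow 0 y = 1.
Proof. by rewrite /divpow fact0 invr1 scale1r expr0. Qed.

Lemma divpow1 (R : lalgType K) (y : R) : divpow 1 y = y.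
Proof. by rewrite /divpow factS fact0 invr1 scale1r expr1. Qed.

Lemma divpow_big (R : lalgType K) m (y : R) : (p <= m)%N -> divpow m y = 0.
Proof.
move=> pm; rewrite /divpow; have /eqP -> : m`!%:R == 0 :> K; last by rewrite invr0 scale0r.
by rewrite -(dvdn_pcharf charK) dvdn_fact // pm prime_gt0 ?(pcharf_prime charK).
Qed.

Lemma divpowS (R : algType K) m (y : R) : (m.+1 < p)%N ->
  y * divpow m y = m.+1%:R *: divpow m.+1 y.
Proof.
move=> mp; rewrite /divpow scalerA -scalerAr -exprS; congr (_ *: _).
rewrite factS natrM invfM mulrA divff ?mul1r //.
exact: (natr_small_neq0 charK).
Qed.

(** The factorials absorb the binomial coefficients. The sum is indexed by all of ['I_p] so that
    [comul_mono] can distribute a product of such sums over functions. *)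
Lemma divpow_primitive (H : hopfType K) (y : H) m : (m < p)%N ->
  comul y = tens y 1 + tens 1 y ->
  comul (divpow m y) = \sum_(j < p | (j <= m)%N) tens (divpow j y) (divpow (m - j) y).
Proof.
move=> mp dy; rewrite /divpow linearZ /= rmorphXn /= dy.
rewrite addrC exprDn_comm; last by red; rewrite !tens_mul !(mulr1, mul1r).
rewrite -(big_ord_widen p (fun j => tens (divpow j y) (divpow (m - j) y)) mp).
rewrite scaler_sumr; apply: eq_bigr => j _.
have jm : (j <= m)%N by rewrite -ltnS.
rewrite !tensX !expr1n tens_mul mulr1 mul1r tensZl tensZr scalerA -scaler_nat scalerA.
congr (_ *: _); rewrite -(bin_fact jm) !natrM !invfM mulrAC.
rewrite mulVf ?mul1r // ; last first.
  by have := fact_small_neq0 charK mp; rewrite -(bin_fact jm) natrM mulf_eq0 => /norP[].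
Qed.

End DividedPowers.

Section Monomials.
Context {K : closedFieldType} {p : nat} (charK : p \in [pchar K]).
Context {h : abelianRLieType K p} (U : restricted_env h) {n : nat} (x : n.-tuple h).
Hypothesis x_basis : basis_of fullv x.
Local Notation iota := (env_in U).
Local Notation mindex := (mindex n).
Implicit Types a b c : mindex.

Let p_gt1 : (1 < p)%N := prime_gt1 (pcharf_prime charK).
Let p_gt0 : (0 < p)%N := prime_gt0 (pcharf_prime charK).

Definition msmall a := [forall i, (a i < p)%N].
Definition mono a : U := \prod_i divpow (a i) (iota (tnth x i)).
Definition mval (f : {ffun 'I_n -> 'I_p}) : mindex := [ffun i => nat_of_ord (f i)].

Lemma mval_small f : msmall (mval f).
Proof. by apply/forallP => i; rewrite ffunE. Qed.

Lemma mval_inj : injective mval.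
Proof.
by move=> f g /ffunP e; apply/ffunP => i; apply: val_inj; have := e i; rewrite !ffunE.
Qed.

Lemma msmallP a : msmall a -> exists f, mval f = a.
Proof.
move=> /forallP sa; exists [ffun i => Ordinal (sa i)].
by apply/ffunP => i; rewrite !ffunE.
Qed.

Lemma mono_big a : ~~ msmall a -> mono a = 0.
Proof.
case/forallPn => k; rewrite -leqNgt => pk; rewrite /mono.
suff H s : k \in s -> \prod_(i <- s) divpow (a i) (iota (tnth x i)) = 0.
  by apply: H; rewrite mem_index_enum.
elim: s => // i s IH; rewrite inE big_cons => /orP[/eqP <-|/IH ->].
  by rewrite (divpow_big charK) // mul0r.
by rewrite mulr0.
Qed.

Lemma mono0 : mono mzero = 1.
Proof. by rewrite /mono big1 // => i _; rewrite ffunE divpow0. Qed.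

Definition mrest k a : U := \prod_(i | i != k) divpow (a i) (iota (tnth x i)).

Lemma mono_split k a : mono a = divpow (a k) (iota (tnth x k)) * mrest k a.
Proof.
(* Commutativity of [U] is only the lemma [env_mulC]; repacking [U] as a commutative ring allows a
   factor to be pulled out of the product. *)
pose UC : comNzRingType := HB.pack (Hopf.sort U)
  (GRing.PzRing_hasCommutativeMul.Build U (@env_mulC _ _ _ U)).
have D1 (F : 'I_n -> UC) : \prod_i F i = F k * \prod_(i | i != k) F i by rewrite (bigD1 k).
exact: (D1 (fun i => divpow (a i) (iota (tnth x i)))).
Qed.

Lemma mrest_eq k a b : (forall i, i != k -> a i = b i) -> mrest k a = mrest k b.
Proof. by move=> ab; apply: eq_bigr => i /ab ->. Qed.

Lemma mono_eps k : mono (meps k) = iota (tnth x k).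
Proof.
rewrite (mono_split k) ffunE eqxx divpow1 /mrest big1 ?mulr1 // => i /negPf ik.
by rewrite ffunE ik divpow0.
Qed.

Lemma mulX_mono k a : ((a k).+1 < p)%N ->
  iota (tnth x k) * mono a = (a k).+1%:R *: mono (madd (meps k) a).
Proof.
move=> ak; rewrite !(mono_split k) mulrA (divpowS charK) // -scalerAl.
rewrite !ffunE eqxx add1n; congr (_ *: (_ * _)).
by apply: mrest_eq => i /negPf ik; rewrite !ffunE ik.
Qed.

Lemma comul_mono a : msmall a -> comul (mono a) =
  \sum_(f : {ffun 'I_n -> 'I_p} | [forall i, (f i <= a i)%N])
    tens (mono (mval f)) (mono [ffun i => (a i - f i)%N]).
Proof.
move=> /forallP sa; rewrite /mono rmorph_prod /=.
under eq_bigr => i _ do rewrite (divpow_primitive charK (sa i) (env_in_prim U _)).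
rewrite bigA_distr_big_dep; apply: eq_big => [f|f _]; first exact/familyP/forallP.
have e1 : \prod_i divpow (mval f i) (iota (tnth x i)) =
    \prod_i divpow (f i) (iota (tnth x i)).
  by apply: eq_bigr => i _; rewrite ffunE.
have e2 : \prod_i divpow ([ffun i => (a i - f i)%N] i) (iota (tnth x i)) =
    \prod_i divpow (a i - f i) (iota (tnth x i)).
  by apply: eq_bigr => i _; rewrite ffunE.
rewrite e1 e2.
elim: (index_enum _) => [|i s IH]; first by rewrite !big_nil.
by rewrite !big_cons /= IH tens_mul.
Qed.

Lemma counit_mono a : counit (mono a) = (a == mzero)%:R :> K.
Proof.
case: eqVneq => [->|]; first by rewrite mono0 counit1.
rewrite -mdeg_eq0 sum_nat_eq0 => /forallPn[k]; rewrite /= -lt0n => ak.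
rewrite (mono_split k) -(prednK ak) /divpow exprS -scalerAl -mulrA counitZ.
rewrite [counit _](_ : _ = 0 :> K) ?mulr0 //.
by rewrite rmorphM /= [counit _](counit_env U _) mul0r.
Qed.

Definition mono_comb (u : U) := exists c : {ffun 'I_n -> 'I_p} -> K, u = \sum_f c f *: mono (mval f).

(** The span of the monomials is stable under multiplication by each generator x_k, by induction on
    the degree: when the exponent of x_k reaches p, the power x_k^p is the p-map of x_k, a linear
    combination of generators, and it multiplies a monomial of smaller degree from which x_k is
    gone. *)
Lemma mono_combP : forall u, mono_comb u.
Proof.
have Clin e u v : mono_comb u -> mono_comb v -> mono_comb (e *: u + v).
  move=> [c ->] [d ->]; exists (fun f => e * c f + d f).
  rewrite scaler_sumr -big_split; apply: eq_bigr => f _ /=.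
  by rewrite scalerDl scalerA.
have C0 : mono_comb 0.
  by exists (fun=> 0); rewrite big1 // => f _; rewrite scale0r.
have CZ e u : mono_comb u -> mono_comb (e *: u) 
  by move=> Cu; have := Clin e u 0 Cu C0; rewrite addr0.
have Csum (I : finType) (P : pred I) (F : I -> U) :
    (forall i, mono_comb (F i)) -> mono_comb (\sum_(i | P i) F i).
  move=> CF; apply: big_ind => // u v Cu Cv; rewrite -[u]scale1r; exact: Clin.
have Cmono a : mono_comb (mono a).
  case: (boolP (msmall a)) => [/msmallP[f <-]|/mono_big -> //].
  exists (fun g => (g == f)%:R); rewrite (bigD1 f) //= eqxx scale1r big1 ?addr0 // => g.
  by move=> /negPf ->; rewrite scale0r.
have CX k a : mono_comb (iota (tnth x k) * mono a).
  elim: (mdeg a) {-2}a (leqnn (mdeg a)) k => [|d IH] {}a ad k.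
    move: ad; rewrite leqn0 mdeg_eq0 => /eqP ->.
    by rewrite mono0 mulr1 -mono_eps.
  case: (ltnP (a k).+1 p) => [ak|]; first by rewrite mulX_mono //; apply/CZ/Cmono.
  case: (boolP (msmall a)) => [/forallP/(_ k) ak pk|/mono_big ->]; last first.
    by rewrite mulr0.
  have akp : a k = p.-1 by apply/eqP; rewrite -eqSS prednK // eqn_leq ak pk.
  pose a' : mindex := [ffun i => if i == k then 0%N else a i].
  have am : mono a = divpow (a k) (iota (tnth x k)) * mono a'.
    rewrite (mono_split k) (mono_split k a') ffunE eqxx divpow0 mul1r.
    by congr (_ * _); apply: mrest_eq => i /negPf ik; rewrite ffunE ik.
  have da' : (mdeg a' <= d)%N.
    rewrite -ltnS; apply: leq_trans ad.
    rewrite /mdeg [ltnRHS](bigD1 k) //= (bigD1 k) //= ffunE eqxx add0n.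
    rewrite (eq_bigr a) => [|i /negPf ik]; last by rewrite ffunE ik.
    by rewrite -[ltnLHS]add0n ltn_add2r akp -ltnS prednK.
  rewrite am /divpow -scalerAl -scalerAr mulrA -exprS akp prednK //.
  apply: (CZ); rewrite -(env_inP U).1 (coord_basis x_basis (memvf (rpow (tnth x k)))).
  rewrite linear_sum mulr_suml; apply: (Csum) => i.
  by rewrite linearZ -scalerAl; apply: (CZ); rewrite -tnth_nth; apply: IH.
have CM u : forall v, mono_comb v -> mono_comb (u * v).
  elim/(@env_ind _ _ _ U): u => [v|e u w Cu Cw v Cv|u w Cu Cw v Cv|y v [c ->]].
  - by rewrite mul1r.
  - by rewrite mulrDl -scalerAl; apply: (Clin); auto.
  - by rewrite -mulrA; auto.
  rewrite mulr_sumr; apply: (Csum) => f; rewrite -scalerAr; apply: (CZ).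
  rewrite (coord_basis x_basis (memvf y)) linear_sum mulr_suml; apply: (Csum) => i.
  by rewrite linearZ -scalerAl; apply: (CZ); rewrite -tnth_nth; apply: CX.
by move=> u; rewrite -[u]mulr1 -mono0; apply/CM/Cmono.
Qed.

End Monomials.

Section LinearDim.
Context {K : fieldType}.
Implicit Types V W : vectType K.

Lemma linfun_lker0 V W (f : {linear V -> W}) : injective f -> lker (linfun f) == 0%VS.
Proof. by move=> fi; apply/lker0P => u v; rewrite !lfunE; apply: fi. Qed.

Lemma linfun_limg V W (f : {linear V -> W}) :
  (forall w, exists v, f v = w) -> limg (linfun f) = fullv.
Proof.
move=> fs; apply/vspaceP => w; rewrite memvf; have [v <-] := fs w.
by rewrite -(lfunE f) memv_img ?memvf.
Qed.

Lemma dim_linear_bij V W (f : {linear V -> W}) : injective f ->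
  (forall w, exists v, f v = w) -> dim V = dim W.
Proof.
move=> /linfun_lker0 fi /linfun_limg fs; rewrite -!dimvf -fs limg_dim_eq //.
by rewrite (eqP fi) capv0.
Qed.

Lemma linear_surj_inj V W (f : {linear V -> W}) :
  (forall w, exists v, f v = w) -> (dim V <= dim W)%N -> injective f.
Proof.
move=> /linfun_limg fs d u v fuv; have := limg_ker_dim (linfun f) fullv.
rewrite fs !dimvf capfv => e.
have /eqP k0 : \dim (lker (linfun f)) == 0%N.
  by rewrite -leqn0 -(leq_add2r (dim W)) e add0n.
have /lker0P : lker (linfun f) == 0%VS by rewrite -dimv_eq0 k0.
by apply; rewrite !lfunE.
Qed.

End LinearDim.

Section DualBasis.
Context {K : closedFieldType} {p : nat} (charK : p \in [pchar K]).
Context {h : abelianRLieType K p} (U : restricted_env h) {n : nat} (x : n.-tuple h).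
Hypothesis x_basis : basis_of fullv x.
Local Notation iota := (env_in U).
Local Notation mindex := (mindex n).
Local Notation mono := (mono U x).
Local Notation msmall := (@msmall p n).
Local Notation mval := (@mval p n).
Implicit Types a b c : mindex.

Let p_gt1 : (1 < p)%N := prime_gt1 (pcharf_prime charK).

Lemma msmall_eps k : msmall (meps k).
Proof. by apply/forallP => i; rewrite ffunE; case: eqP => _ /=; rewrite ?(ltnW p_gt1). Qed.

Lemma msmallDl a b : msmall (madd a b) -> msmall a.
Proof.
move=> /forallP s; apply/forallP => i; have := s i; rewrite ffunE.
exact/leq_ltn_trans/leq_addr.
Qed.

Lemma tpair_comul_mono (f g : {linear U -> K^o}) c : msmall c ->
  tpair f g (comul (mono c)) =
  \sum_(b : {ffun 'I_n -> 'I_p} | [forall i, (b i <= c i)%N])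
     f (mono (mval b)) * g (mono [ffun i => (c i - b i)%N]).
Proof.
move=> sc; rewrite (comul_mono charK) // linear_sum; apply: eq_bigr => b _.
by rewrite /= tpair_tens.
Qed.

Lemma sum_delta_split (f g : mindex -> K) a b c : msmall c ->
  (forall u v, c = madd u v -> f u * g v = (u == a)%:R * (v == b)%:R) ->
  \sum_(u : {ffun 'I_n -> 'I_p} | [forall i, (u i <= c i)%N])
     f (mval u) * g [ffun i => (c i - u i)%N] = (madd a b == c)%:R.
Proof.
move=> sc fg.
rewrite (eq_bigr (fun u => (mval u == a)%:R * ([ffun i => (c i - u i)%N] == b)%:R)); last first.
  move=> u /forallP uc; apply: fg; apply/ffunP => i; rewrite !ffunE.
  by rewrite subnKC.
case: eqVneq => [abc|abc].
  have [u ua] : exists u, mval u = a by apply: msmallP; apply: (@msmallDl a b); rewrite abc.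
  have uE i : u i = a i :> nat by rewrite -ua ffunE.
  rewrite (bigD1 u) /=; last by apply/forallP => i; rewrite -abc ffunE uE leq_addr.
  have -> : [ffun i => (c i - u i)%N] = b.
    by apply/ffunP => i; rewrite -abc !ffunE uE addKn.
  rewrite ua !eqxx mulr1 big1 ?addr0 // => v /andP[_ vu].
  have /negPf -> : mval v != a by rewrite -ua (inj_eq (@mval_inj p n)).
  by rewrite mul0r.
rewrite big1 // => u /forallP uc; case: eqVneq => [ua|]; last by rewrite mul0r.
case: eqVneq => [cb|]; last by rewrite mulr0.
case/eqP: abc; apply/ffunP => i; rewrite -ua -cb !ffunE subnKC //.
Qed.

(** The functionals are built degree by degree. Up to degree one they are the counit and the
    coordinates of a left inverse of the map from h to u(h). In the new top degree the convolution
    of the functionals of e_k and a - e_k works, since the coproduct of a divided-power monomial is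
    the sum of its decompositions. The lower functionals are then corrected so as to vanish on the
    new monomials. *)
Lemma dual_functionals d : exists th : mindex -> {linear U -> K^o}, forall a b,
  msmall a -> msmall b -> (mdeg a <= d.+1)%N -> (mdeg b <= d.+1)%N ->
  th a (mono b) = (a == b)%:R.
Proof.
elim: d => [|d [th thP]].
  pose j := (linfun iota)^-1%VF.
  have ji (y : h) : j (iota y) = y.
    have := @lker0_lfunK _ _ _ (linfun iota); rewrite -/j => jK.
    rewrite -[iota y]lfunE jK //; apply/lker0P => u v; rewrite !lfunE.
    exact: (env_in_inj charK).
  (* Subtracting the counit makes the functional vanish at 1. *)
  have yl k : linear (fun u : U => coord x k (j (u - (counit u : K)%:A)) : K^o).
    move=> e u v; rewrite [counit _]linearP /= scalerDl -scalerA opprD addrACA.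
    by rewrite -scalerBr !linearP.
  exists (fun a => if [pick k | a == meps k] is Some k then mklin (yl k)
                   else counit_lin U).
  have deg1 a : (mdeg a <= 1)%N -> a != mzero -> exists k, a = meps k.
    move=> a1 /meps_split[k [b ab]]; exists k; rewrite ab.
    have : mdeg b == 0%N by move: a1; rewrite ab mdegD mdeg_eps add1n ltnS leqn0.
    by rewrite mdeg_eq0 => /eqP ->; rewrite madd0.
  move=> a b _ _ a1 b1; case: pickP => [k /eqP -> {a1}|nk] /=; last first.
    have -> : a = mzero by apply/eqP/negP => /negP /(deg1 _ a1)[k e]; have := nk k; rewrite e eqxx.
    by rewrite counit_mono eq_sym.
  case: (eqVneq b mzero) => [->|/(deg1 _ b1)[l ->]].
    rewrite mono0 counit1 scale1r subrr !linear0.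
    have /negPf -> // : meps k != mzero by rewrite -mdeg_eq0 mdeg_eps.
  rewrite mono_eps [counit _]counit_env scale0r subr0 ji (tnth_nth 0).
  rewrite coord_free ?(basis_free x_basis) //; congr (_%:R); congr nat_of_bool.
  apply/eqP/eqP => [->//|/ffunP/(_ l)]; rewrite !ffunE eqxx.
  by case: eqVneq => // ->.
pose th' a : {linear U -> K^o} :=
  if [pick k | (0 < a k)%N] is Some k then
    (tpair (th (meps k)) (th [ffun i => (a i - meps k i)%N]) \o comul)
  else counit_lin U.
have th'P a b : msmall a -> msmall b -> mdeg a = d.+2 -> (mdeg b <= d.+2)%N ->
    th' a (mono b) = (a == b)%:R.
  move=> sa sb da db; rewrite /th'; case: pickP => [k ak|a0]; last first.
    have : mdeg a == 0%N.
      by rewrite sum_nat_eq0; apply/forallP => k; rewrite /= -leqn0 leqNgt a0.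
    by rewrite da.
  set a' : mindex := [ffun i => (a i - meps k i)%N].
  have aE : a = madd (meps k) a'.
    apply/ffunP => i; rewrite !ffunE; case: (eqVneq i k) => [->|_]; last by rewrite subn0.
    by rewrite subnKC.
  have da' : mdeg a' = d.+1.
    by move: da; rewrite aE mdegD mdeg_eps add1n => -[].
  have sa' : msmall a' by apply: (@msmallDl _ (meps k)); rewrite maddC -aE.
  rewrite /= tpair_comul_mono // {1}aE.
  apply: (sum_delta_split (f := fun u => th (meps k) (mono u))
           (g := fun v => th a' (mono v))) => // u v bE.
  have su : msmall u by apply: (@msmallDl _ v); rewrite -bE.
  have sv : msmall v by apply: (@msmallDl _ u); rewrite maddC -bE.
  (* If [u] takes the whole degree d + 2, nothing is known about [th (meps k)] on it; but then v =
     0, and the other factor vanishes. *)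
  have [du|du] := leqP (mdeg u) d.+1; last first.
    have v0 : v = mzero.
      apply/eqP; rewrite -mdeg_eq0 -leqn0 -(leq_add2l (mdeg u)) -mdegD -bE addn0.
      exact: leq_trans db du.
    have s0 : msmall mzero by rewrite -v0.
    rewrite v0 [th a' _]thP ?mdeg0 ?da' //.
    have /negPf -> : a' != mzero by rewrite -mdeg_eq0 da'.
    have /negPf -> : u != meps k.
      by apply: contraTneq du => ->; rewrite mdeg_eps.
    by rewrite mulr0 mul0r.
  rewrite [th (meps k) _]thP ?mdeg_eps ?msmall_eps //.
  rewrite [meps k == u]eq_sym; case: eqVneq => [ue|]; last by rewrite !mul0r.
  have dv : (mdeg v <= d.+1)%N.
    by move: db; rewrite bE ue mdegD mdeg_eps add1n ltnS.
  by rewrite thP ?da' // eq_sym.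
pose th2 a : U -> K^o := fun u => th a u -
  \sum_(f | mdeg (mval f) == d.+2) th a (mono (mval f)) * th' (mval f) u.
have th2l a : linear (th2 a).
  have sl : linear (fun u : U =>
      \sum_(f | mdeg (mval f) == d.+2) th a (mono (mval f)) * th' (mval f) u : K^o).
    move=> e u v; rewrite scaler_sumr -big_split; apply: eq_bigr => f _ /=.
    by rewrite linearP mulrDr; congr (_ + _); apply: mulrCA.
  by move=> e u v; rewrite /th2 linearP sl opprD addrACA scalerBr.
exists (fun a => if mdeg a == d.+2 then th' a else mklin (th2l a)) => a b sa sb da db.
case: eqVneq => [da2|da2]; first exact: th'P.
have da1 : (mdeg a <= d.+1)%N by rewrite -ltnS ltn_neqAle da2.
rewrite /= /th2; case: (eqVneq (mdeg b) d.+2) => [db2|db2].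
  have [f fb] := msmallP sb.
  rewrite (bigD1 f) /= ?fb ?db2 // th'P // eqxx mulr1 opprD addrA subrr add0r.
  rewrite big1 ?oppr0 => [|g /andP[/eqP dg gf]].
    by have /negPf -> : a != b by apply: contraNneq da2 => ->; rewrite db2.
  rewrite th'P ?mval_small // -fb (inj_eq (@mval_inj p n)) (negPf gf) mulr0 //.
have db1 : (mdeg b <= d.+1)%N by rewrite -ltnS ltn_neqAle db2.
rewrite thP // big1 ?subr0 // => g /eqP dg.
rewrite th'P ?mval_small //; have /negPf -> : mval g != b by apply: contraNneq db2 => <-; rewrite dg.
by rewrite mulr0.
Qed.

(** Indices with an entry at least p receive the zero functional, so that [dual_comul] holds without
    a bound on a + b. *)
Lemma dual_basis : exists th : mindex -> {linear U -> K^o},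
  forall a b, msmall b -> th a (mono b) = (a == b)%:R.
Proof.
have [th thP] := dual_functionals (n * p).
have bound a : msmall a -> (mdeg a <= (n * p).+1)%N.
  move=> /forallP sa; apply: leqW; rewrite /mdeg.
  apply: (@leq_trans (\sum_(i < n) p)%N); last by rewrite sum_nat_const card_ord.
  by apply: leq_sum => i _; apply: ltnW.
have zl : linear ((fun=> 0) : U -> K^o) by move=> ? ? ? /=; rewrite scaler0 addr0.
exists (fun a => if msmall a then th a else mklin zl) => a b sb.
case: ifP => [sa|/negP nsa]; first by rewrite thP ?bound.
by have /negPf -> : a != b by apply: contra_notN nsa => /eqP ->.
Qed.

Section Theory.
Variable th : mindex -> {linear U -> K^o}.
Hypothesis thP : forall a b, msmall b -> th a (mono b) = (a == b)%:R.

Lemma dual_expansion u :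
  u = \sum_(f : {ffun 'I_n -> 'I_p}) th (mval f) u *: mono (mval f).
Proof.
have [c {1 2}->] := mono_combP charK x_basis u; apply: eq_bigr => f _; congr (_ *: _).
rewrite linear_sum (bigD1 f) //= linearZ /= thP ?mval_small // eqxx.
rewrite big1 ?addr0 => [|g gf]; first by rewrite /GRing.scale /= mulr1.
rewrite linearZ /= thP ?mval_small // (inj_eq (@mval_inj p n)) eq_sym (negPf gf).
exact: mulr0.
Qed.

Lemma mono_ext (C : lmodType K) (F G : U -> C) : linear F -> linear G ->
  (forall b, msmall b -> F (mono b) = G (mono b)) -> F =1 G.
Proof.
move=> Fl Gl FG u; rewrite (dual_expansion u).
rewrite -[F _]/(mklin Fl _) -[G _]/(mklin Gl _) !linear_sum; apply: eq_bigr => f _.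
by rewrite !linearZ /= FG ?mval_small.
Qed.

Lemma dual_overflow a u : ~~ msmall a -> th a u = 0.
Proof.
move=> sa; have zl : linear ((fun=> 0) : U -> K^o) by move=> ? ? ? /=; rewrite scaler0 addr0.
move: u; apply: mono_ext => // [|b sb]; first exact: linearP.
by rewrite thP //; have /negPf -> : a != b by apply: contraNneq sa => ->.
Qed.

(** The convolution algebra dual to u(h) is k[t_1, ..., t_n] modulo the t_k^p, with [th a] the
    monomial t^a; [dual_overflow] expresses t_k^p = 0. *)
Lemma dual_comul a b u : tpair (th a) (th b) (comul u) = th (madd a b) u.
Proof.
move: u; apply: mono_ext => [e u v|e u v|c sc]; rewrite ?linearP //.
rewrite tpair_comul_mono // thP //.
apply: (sum_delta_split (f := fun u => th a (mono u)) (g := fun v => th b (mono v))) => //.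
move=> u v cE; rewrite !thP // 1?[a == _]eq_sym 1?[b == _]eq_sym //.
  by apply: (@msmallDl _ u); rewrite maddC -cE.
by apply: (@msmallDl _ v); rewrite -cE.
Qed.

Lemma dual_counit u : th mzero u = counit u.
Proof.
move: u; apply: mono_ext => [e u v|e u v|c sc]; rewrite ?linearP //.
by rewrite thP // counit_mono eq_sym.
Qed.

Lemma dual_eps k y : th (meps k) (iota y) = coord x k y.
Proof.
rewrite {1}(coord_basis x_basis (memvf y)) !linear_sum (bigD1 k) //=.
rewrite !linearZ /= -tnth_nth -mono_eps thP ?msmall_eps // eqxx big1 ?addr0 => [|l lk].
  exact: mulr1.
rewrite !linearZ /= -tnth_nth -mono_eps thP ?msmall_eps //.
have /negPf -> : meps k != meps l; last exact: mulr0.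
by apply: contraNneq lk => /ffunP/(_ l); rewrite !ffunE eqxx; case: eqVneq.
Qed.

Lemma dual_inj u v : (forall a, th a u = th a v) -> u = v.
Proof.
move=> uv; rewrite (dual_expansion u) (dual_expansion v).
by apply: eq_bigr => f _; rewrite uv.
Qed.

Lemma dual2_inj (s t : tensor U U) :
  (forall a b, tpair (th a) (th b) s = tpair (th a) (th b) t) -> s = t.
Proof.
move=> st; have E := @tensor_expansion K _ _ _ _ _ _ _ _ dual_expansion dual_expansion.
by rewrite (E s) (E t); apply: eq_bigr => f _; apply: eq_bigr => g _; rewrite st.
Qed.

Lemma dual3_inj (s t : tensor U (tensor U U)) :
  (forall a b c, tpair (th a) (tpair (th b) (th c)) s =
                 tpair (th a) (tpair (th b) (th c)) t) -> s = t.
Proof.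
move=> st.
have E2 (r : tensor U U) : r = \sum_(fg : {ffun 'I_n -> 'I_p} * {ffun 'I_n -> 'I_p})
    tpair (th (mval fg.1)) (th (mval fg.2)) r *: tens (mono (mval fg.1)) (mono (mval fg.2)).
  rewrite {1}(@tensor_expansion K _ _ _ _ _ _ _ _ dual_expansion dual_expansion r).
  by rewrite pair_bigA.
have E := @tensor_expansion K _ _ _ _ _ _ _ _ dual_expansion E2.
by rewrite (E s) (E t); apply: eq_bigr => f _; apply: eq_bigr => g _; rewrite st.
Qed.

Lemma dim_env : dim U = (p ^ n)%N.
Proof.
pose F (c : {ffun {ffun 'I_n -> 'I_p} -> K^o}) : U := \sum_f c f *: mono (mval f).
have Fl : linear F.
  move=> e u v; rewrite /F scaler_sumr -big_split; apply: eq_bigr => f _ /=.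
  by rewrite !ffunE scalerDl scalerA.
have -> : dim U = dim {ffun {ffun 'I_n -> 'I_p} -> K^o}.
  apply/esym/(@dim_linear_bij _ _ _ (mklin Fl)) => [c d /= cd|u].
    have thF e g : th (mval g) (F e) = e g.
      rewrite /F linear_sum (bigD1 g) //= linearZ /= thP ?mval_small // eqxx.
      rewrite big1 ?addr0 => [|f fg]; first exact: mulr1.
      rewrite linearZ /= thP ?mval_small // (inj_eq (@mval_inj p n)) eq_sym (negPf fg).
      exact: mulr0.
    by apply/ffunP => g; rewrite -!thF cd.
  by exists [ffun f => th (mval f) u]; rewrite [RHS]dual_expansion; apply: eq_bigr => f _; rewrite ffunE.
by rewrite /dim /= card_ffun !card_ord muln1.
Qed.

End Theory.

End DualBasis.

(** * Cocycles of degree two of the cobar complex *)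

Section Cocycles.
Context {K : fieldType}.
Implicit Types H : hopfType K.

(** The equation d^2(chi) = 0 of the cobar complex, with the negative terms moved to the right and
    [tassoc] matching the two bracketings. *)
Definition cocycle2 H (chi : tensor H H) : Prop :=
  tens 1 chi + tmap idfun comul chi =
  tassoc (tmap comul idfun chi) + tassoc (tens chi 1) :> tensor H (tensor H H).

Lemma tpair_tassoc H (f g k : {linear H -> K^o}) (w : tensor (tensor H H) H) :
  tpair f (tpair g k) (tassoc w) = tpair (tpair f g) k w.
Proof.
move: w; apply: tensor_ext => [e u v|e u v|w c]; rewrite ?linearP //.
move: w; apply: tensor_ext => [e u v|e u v|a b].
- by rewrite tens_linearl !linearP.
- by rewrite tens_linearl !linearP.
by rewrite tassoc_tens tpair_tens /= !tpair_tens /= tpair_tens mulrA.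
Qed.

Lemma eq_tpair (A B : vectType K) (f f' : A -> K^o) (g g' : B -> K^o) t :
  f =1 f' -> g =1 g' -> tpair f g t = tpair f' g' t.
Proof. by move=> ff gg; apply: tlift_ext => a b; rewrite ff gg. Qed.

Lemma cobar1_linear H : linear (@cobar1 K H).
Proof.
move=> e u v; rewrite /cobar1 linearP /= tens_linearl tens_linearr opprD.
by rewrite [_ + (- _ - _)]addrACA [LHS]addrACA -scalerBr -scalerDr.
Qed.

HB.instance Definition _ H := GRing.isLinear.Build K H (tensor H H) *:%R (@cobar1 K H)
  (@cobar1_linear H).

Lemma cobar1_aug H (s : H) : s \in augmentation_ideal H ->
  cobar1 s \in tens_square (augmentation_ideal H).
Proof.
move=> /augmentation_idealP es; apply/tens_square_augP; rewrite /cobar1.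
rewrite !linearD !linearN /= !counit_left_tens !counit_right_tens.
rewrite [counit_left (comul s)]counitl [counit_right (comul s)]counitr.
by rewrite !counit1 es !scale1r !scale0r addr0 add0r subrr addNr.
Qed.

Definition cohomologous H (chi chi' : tensor H H) : Prop :=
  exists2 s, s \in augmentation_ideal H & chi - chi' = cobar1 s.

End Cocycles.

Section SecondCohomology.
Context {K : closedFieldType} {p : nat} (charK : p \in [pchar K]).
Context {h : abelianRLieType K p} (U : restricted_env h) {n : nat} (x : n.-tuple h).
Hypothesis x_basis : basis_of fullv x.
Local Notation mindex := (mindex n).
Local Notation mono := (mono U x).
Local Notation msmall := (@msmall p n).
Local Notation Uplus := (augmentation_ideal U).
Implicit Types a b c : mindex.
Variable th : mindex -> {linear U -> K^o}.
Hypothesis thP : forall a b, msmall b -> th a (mono b) = (a == b)%:R.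

Let p_gt1 : (1 < p)%N := prime_gt1 (pcharf_prime charK).
Let p_gt0 : (0 < p)%N := prime_gt0 (pcharf_prime charK).

Definition coef2 a b : tensor U U -> K^o := tpair (th a) (th b).

HB.instance Definition _ a b :=
  GRing.isLinear.Build K (tensor U U) K^o *:%R (coef2 a b) (tlift_linear _).

Lemma dual_one a : th a 1 = (a == mzero)%:R.
Proof.
rewrite -(mono0 U x) thP //; apply/forallP => i; rewrite ffunE; exact: p_gt0.
Qed.

Lemma coef2_aug chi : chi \in tens_square Uplus ->
  (forall b, coef2 mzero b chi = 0) /\ (forall a, coef2 a mzero chi = 0).
Proof.
move: chi; apply: tens_square_ind => [e s t [s1 s2] [t1 t2]||a b].
- by split=> c; rewrite linearP /= ?s1 ?t1 ?s2 ?t2 scaler0 addr0.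
- by split=> c; rewrite linear0.
move=> /augmentation_idealP ea /augmentation_idealP eb.
split=> c; rewrite /coef2 tpair_tens (dual_counit charK x_basis thP) ?ea ?eb.
  exact: mul0r.
exact: mulr0.
Qed.

Lemma coef2_cobar1 a b s :
  coef2 a b (cobar1 s) = (a == mzero)%:R * th b s - th (madd a b) s + th a s * (b == mzero)%:R.
Proof.
rewrite /cobar1 linearD linearB /= /coef2 !tpair_tens !dual_one.
by rewrite (dual_comul charK x_basis thP).
Qed.

Definition coef_cocycle chi := forall a b c, a != mzero -> b != mzero -> c != mzero ->
  coef2 (madd a b) c chi = coef2 a (madd b c) chi.

(** Pairing with three dual functionals turns the coproducts into addition of indices. The terms 1
    (x) chi and chi (x) 1 only enter when an outer index is 0, and the equations with a zero index
    hold because chi lies in the tensor square of the augmentation ideal. *)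
Lemma cocycle2P chi : chi \in tens_square Uplus -> cocycle2 chi <-> coef_cocycle chi.
Proof.
move=> chiU; have [c0l c0r] := coef2_aug chiU.
have E a b c : let P := tpair (th a) (tpair (th b) (th c)) in
  [/\ P (tens 1 chi) = (a == mzero)%:R * coef2 b c chi,
      P (tmap idfun comul chi) = coef2 a (madd b c) chi,
      P (tassoc (tmap comul idfun chi)) = coef2 (madd a b) c chi &
      P (tassoc (tens chi 1)) = coef2 a b chi * (c == mzero)%:R].
  split.
  - by rewrite tpair_tens dual_one.
  - rewrite tpair_tmap; apply: eq_tpair => // u /=; exact: (dual_comul charK x_basis thP).
  - rewrite tpair_tassoc tpair_tmap; apply: eq_tpair => // u /=.
    exact: (dual_comul charK x_basis thP).
  - by rewrite tpair_tassoc tpair_tens dual_one.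
split=> [e a b c a0 b0 c0|cc].
  have := congr1 (tpair (th a) (tpair (th b) (th c))) e.
  rewrite !linearD /=; have [-> -> -> ->] := E a b c.
  by rewrite (negPf a0) (negPf c0) mul0r mulr0 add0r addr0.
apply: (dual3_inj charK x_basis thP) => a b c; rewrite !linearD /=.
have [-> -> -> ->] := E a b c; rewrite {E}.
have madd0l d : madd mzero d = d by rewrite maddC madd0.
case: (eqVneq a mzero) => [->|a0].
  by rewrite madd0l !c0l mul0r mul1r addrC.
case: (eqVneq c mzero) => [->|c0].
  by rewrite madd0 !c0r mulr0 mulr1.
rewrite mul0r mulr0 add0r addr0; case: (eqVneq b mzero) => [->|b0].
  by rewrite madd0 madd0l.
by rewrite cc.
Qed.

(** The cocycle identity moves all but one unit e_k of the first index into the second. Two such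
    pairs (e_k, e_l + w) and (e_l, e_k + w) both have the coefficient at (e_k + e_l, w) when w is
    not 0; for w = 0 the symmetry hypothesis applies. *)
Lemma coef_cocycle_shift chi a b a' b' : coef_cocycle chi ->
  (forall i j, coef2 (meps i) (meps j) chi = coef2 (meps j) (meps i) chi) ->
  a != mzero -> b != mzero -> a' != mzero -> b' != mzero ->
  madd a b = madd a' b' -> coef2 a b chi = coef2 a' b' chi.
Proof.
move=> cc sym.
have maddI (u v w : mindex) : madd u v = madd u w -> v = w.
  by move=> /ffunP e; apply/ffunP => i; have := e i; rewrite !ffunE => /addnI.
have first_eps u v : u != mzero -> v != mzero ->
    exists k w, [/\ w != mzero, madd u v = madd (meps k) w &
                  coef2 u v chi = coef2 (meps k) w chi].
  move=> u0 v0; have [k [u' uE]] := meps_split u0; exists k, (madd u' v).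
  have k0 : meps k != mzero by rewrite -mdeg_eq0 mdeg_eps.
  rewrite uE; split; rewrite ?maddA //.
    by rewrite -mdeg_eq0 mdegD addn_eq0 !mdeg_eq0 negb_and v0 orbT.
  case: (eqVneq u' mzero) => [->|u'0]; last exact: cc.
  by rewrite madd0 [madd mzero v]maddC madd0.
move=> /first_eps H /H{H}[k [w [w0 -> ->]]] /first_eps H /H{H}[l [w' [w'0 -> ->]]] e.
case: (eqVneq k l) e => [-> /maddI -> //|kl e].
have [w'' wE] : exists w'', w = madd (meps l) w''.
  exists [ffun i => (w i - meps l i)%N]; apply/ffunP => i; rewrite !ffunE.
  case: (eqVneq i l) => [->|_]; last by rewrite subn0.
  have /ffunP/(_ l) := e; rewrite !ffunE eqxx eq_sym (negPf kl) add0n => ->.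
  by rewrite subnKC.
have w'E : w' = madd (meps k) w''.
  by apply: (maddI (meps l) w' _); rewrite -e wE !maddA [madd (meps l) _]maddC.
rewrite wE w'E; case: (eqVneq w'' mzero) => [->|w''0]; first by rewrite !madd0.
have eps0 i : meps i != mzero :> mindex by rewrite -mdeg_eq0 mdeg_eps.
by rewrite -!cc // maddC.
Qed.

Definition mscale m (k : 'I_n) : mindex := [ffun i => (m * (i == k))%N].

Lemma mdeg_mscale m k : mdeg (mscale m k) = m.
Proof.
rewrite /mdeg (bigD1 k) //= ffunE eqxx muln1 big1 ?addn0 // => i /negPf ik.
by rewrite ffunE ik muln0.
Qed.

Lemma mscaleS m k : mscale m.+1 k = madd (meps k) (mscale m k).
Proof. by apply/ffunP => i; rewrite !ffunE mulSn. Qed.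

Lemma mscale_overflow k : ~~ msmall (mscale p k).
Proof. by apply/forallPn; exists k; rewrite ffunE eqxx muln1 ltnn. Qed.

(* By coef_cocycle_shift the coefficient at [(a, b)] only depends on [a + b]. *)
(* If some [a_i + b_i >= p] then either [a + b = p e_i], or the coefficient   *)
(* can be moved to [(p e_i, a + b - p e_i)], where it vanishes since          *)
(* [x_i^p / p! = 0] does not occur in [U].                                    *)
Lemma coboundary_criterion chi : chi \in tens_square Uplus -> coef_cocycle chi ->
  (forall i j, coef2 (meps i) (meps j) chi = coef2 (meps j) (meps i) chi) ->
  (forall k, coef2 (meps k) (mscale p.-1 k) chi = 0) ->
  exists2 s, s \in Uplus & chi = cobar1 s.
Proof.
move=> chiU cc sym top; have shift := coef_cocycle_shift cc sym.
have eps0 i : meps i != mzero :> mindex by rewrite -mdeg_eq0 mdeg_eps.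
(* [sigma d] is the common value of the coefficients at the decompositions of [d] into two nonzero
   indices, and 0 if there is none. *)
pose sigma (d : mindex) : K :=
  if [pick k | (0 < d k)%N && ([ffun i => (d i - meps k i)%N] != mzero :> mindex)] is Some k
  then coef2 (meps k) [ffun i => (d i - meps k i)%N] chi else 0.
have sigmaD a b : a != mzero -> b != mzero -> sigma (madd a b) = coef2 a b chi.
  move=> a0 b0; rewrite /sigma; case: pickP => [k /andP[dk d0]|nk].
    apply: shift => //; apply/ffunP => i; rewrite !ffunE.
    case: eqVneq => [->|_]; last by rewrite subn0.
    by rewrite subnKC //; move: dk; rewrite ffunE.
  have [k [a' aE]] := meps_split a0.
  have := nk k; rewrite aE !ffunE eqxx /= => /negbT/negP[].
  have -> : [ffun i => (madd (madd (meps k) a') b i - meps k i)%N] = madd a' b.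
    by apply/ffunP => i; rewrite !ffunE -addnA addKn.
  by rewrite -mdeg_eq0 mdegD addn_eq0 !mdeg_eq0 negb_and b0 orbT.
(* The sign is that of the coproduct in d^1: at nonzero (a, b) the coefficient of d^1(s) is minus
   the value of [th (madd a b)] at s. *)
pose s := - \sum_(f : {ffun 'I_n -> 'I_p}) sigma (mval f) *: mono (mval f).
have ths a : msmall a -> th a s = - sigma a.
  move=> /msmallP[f <-]; rewrite /s linearN linear_sum (bigD1 f) //= linearZ /=.
  rewrite thP ?mval_small // eqxx big1 ?addr0 => [|g gf].
    by congr (- _); apply: mulr1.
  rewrite linearZ /= thP ?mval_small // (inj_eq (@mval_inj p n)) eq_sym (negPf gf).
  exact: mulr0.
have s0 : th mzero s = 0.
  rewrite ths; last by apply/forallP => i; rewrite ffunE.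
  by rewrite /sigma; case: pickP => [k|]; rewrite ?oppr0 // ffunE.
have [c0l c0r] := coef2_aug chiU.
exists s; first by apply/augmentation_idealP; rewrite -(dual_counit charK x_basis thP).
apply: (dual2_inj charK x_basis thP) => a b.
rewrite -[LHS]/(coef2 a b chi) -[RHS]/(coef2 a b (cobar1 s)) coef2_cobar1.
have madd0l d : madd mzero d = d by rewrite maddC madd0.
case: (eqVneq a mzero) => [->|a0].
  by rewrite c0l madd0l mul1r subrr add0r s0 mul0r.
case: (eqVneq b mzero) => [->|b0].
  by rewrite c0r madd0 mul0r mulr1 add0r addNr.
rewrite mul0r mulr0 addr0 add0r.
case: (boolP (msmall (madd a b))) => [sab|nab].
  by rewrite ths // opprK sigmaD.
rewrite (dual_overflow charK x_basis thP) // oppr0.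
have /forallPn[k] := nab; rewrite -leqNgt => pk.
pose d : mindex := [ffun i => (madd a b i - mscale p k i)%N].
have dE : madd a b = madd (mscale p k) d.
  apply/ffunP => i; rewrite !ffunE; case: (eqVneq i k) => [->|_].
    by rewrite muln1 subnKC //; move: pk; rewrite ffunE.
  by rewrite muln0 subn0.
case: (eqVneq d mzero) => [d0|d0].
  have pk0 : mscale p.-1 k != mzero.
    by rewrite -mdeg_eq0 mdeg_mscale -lt0n -ltnS prednK.
  have abE : madd a b = madd (meps k) (mscale p.-1 k).
    by rewrite dE d0 madd0 -mscaleS prednK.
  by rewrite (@shift a b (meps k) (mscale p.-1 k)).
have pk0 : mscale p k != mzero by rewrite -mdeg_eq0 mdeg_mscale -lt0n.
rewrite (@shift a b (mscale p k) d) //.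
move: (mscale_overflow k) => /(dual_overflow charK x_basis thP) ov.
rewrite {chiU cc sym top shift sigma sigmaD s ths s0 c0l c0r}/coef2.
have -> : tpair (th (mscale p k)) (th d) chi = tpair (fun=> 0) (th d) chi.
  by apply: eq_tpair => // u; rewrite ov.
by apply: big1 => i _; apply: big1 => j _; rewrite mul0r scaler0.
Qed.

(** At nonzero (a, b) the coefficient of d^1(s) depends on a + b only, hence is symmetric, and it
    vanishes when a + b = p e_k by [dual_overflow]. *)
Lemma coboundary_coef2 s : s \in Uplus ->
  (forall i j, coef2 (meps i) (meps j) (cobar1 s) = coef2 (meps j) (meps i) (cobar1 s)) /\
  (forall k, coef2 (meps k) (mscale p.-1 k) (cobar1 s) = 0).
Proof.
move=> _; have eps0 i : (meps i == mzero :> mindex) = false.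
  by apply/negbTE; rewrite -mdeg_eq0 mdeg_eps.
split=> [i j|k]; rewrite !coef2_cobar1 !eps0 !mul0r ?mulr0 ?addr0.
  by rewrite maddC.
have /negPf -> : mscale p.-1 k != mzero.
  by rewrite -mdeg_eq0 mdeg_mscale -lt0n -ltnS prednK.
rewrite mulr0 addr0 add0r -mscaleS prednK //.
by rewrite (dual_overflow charK x_basis thP) ?oppr0 // mscale_overflow.
Qed.

End SecondCohomology.

(** * Numerical invariants of classes of degree two *)

Section CartierClasses.
Context {K : closedFieldType} {p : nat} (charK : p \in [pchar K]).
Context {n : nat} {T : abelian_type K p n} (U : restricted_env (type_h T)).
Local Notation h := (type_h T).
Variable x : n.-tuple h.
Hypothesis x_basis : basis_of fullv x.
Local Notation iota := (env_in U).
Local Notation mindex := (mindex n).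
Local Notation mono := (mono U x).
Local Notation msmall := (@msmall p n).
Local Notation Uplus := (augmentation_ideal U).
Implicit Types a b c : mindex.
Variable th : mindex -> {linear U -> K^o}.
Hypothesis thP : forall a b, msmall b -> th a (mono b) = (a == b)%:R.
Local Notation coef2 := (coef2 th).

Let p_gt1 : (1 < p)%N := prime_gt1 (pcharf_prime charK).
Let p_gt0 : (0 < p)%N := prime_gt0 (pcharf_prime charK).

(** Below p no exponent is reduced, so v^m is a combination of monomials of degree exactly m. *)
Lemma dual_pow v m a : (m < p)%N -> mdeg a != m -> th a (iota v ^+ m) = 0.
Proof.
elim: m a => [|m IH] a mp am.
  by rewrite expr0 (dual_one charK thP) -mdeg_eq0 (negPf am).
rewrite exprS {1}(coord_basis x_basis (memvf v)) linear_sum mulr_suml linear_sum.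
rewrite big1 // => k _; rewrite !linearZ /= -scalerAl linearZ /= -tnth_nth.
rewrite [X in _ *: X](_ : _ = 0) ?scaler0 //.
rewrite (dual_expansion charK x_basis thP (iota v ^+ m)) mulr_sumr linear_sum big1 // => f _.
rewrite -scalerAr linearZ /=.
case: (eqVneq (mdeg (mval f)) m) => [fm|fm]; last by rewrite IH ?scale0r // ltnW.
have fk : ((mval f k).+1 < p)%N.
  apply: leq_ltn_trans mp; rewrite ltnS -fm /mdeg (bigD1 k) //=; exact: leq_addr.
rewrite (mulX_mono charK) // linearZ /=.
have e0 : th a (mono (madd (meps k) (mval f))) = 0.
  have ne : a != madd (meps k) (mval f).
    by apply: contraNneq am => ->; rewrite mdegD mdeg_eps fm.
  case: (boolP (msmall (madd (meps k) (mval f)))) => [s|/(mono_big charK) ->].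
    by rewrite thP // (negPf ne).
  by rewrite linear0.
by rewrite e0 !scaler0.
Qed.

(** [th (madd a b)] is a convolution product, and only one term of the binomial expansion of (v (x)
    1 + 1 (x) v)^(|a|+|b|) has bidegree (|a|, |b|). *)
Lemma dual_powD v a b : (mdeg a + mdeg b < p)%N ->
  th (madd a b) (iota v ^+ (mdeg a + mdeg b)) =
  'C(mdeg a + mdeg b, mdeg a)%:R * (th a (iota v ^+ mdeg a) * th b (iota v ^+ mdeg b)).
Proof.
move=> ab; rewrite -(dual_comul charK x_basis thP) rmorphXn /= env_in_prim addrC.
rewrite exprDn_comm; last by red; rewrite !tens_mul !(mulr1, mul1r).
have lt : (mdeg a < (mdeg a + mdeg b).+1)%N by rewrite ltnS leq_addr.
rewrite linear_sum (bigD1 (Ordinal lt)) //= big1 ?addr0 => [|j ja].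
  by rewrite addKn !tensX !expr1n tens_mul mulr1 mul1r raddfMn /= tpair_tens mulr_natl.
rewrite !tensX !expr1n tens_mul mulr1 mul1r raddfMn /= tpair_tens.
rewrite dual_pow ?mul0r ?mul0rn //; last by apply: contraNneq ja => e; apply/eqP/val_inj.
by apply: leq_ltn_trans ab; rewrite -ltnS.
Qed.

Definition omega_coef i : K := (p.-1)`!%:R / (i`!%:R * (p - i)`!%:R).

Lemma coef2_omega v a b : coef2 a b (omega (iota v)) =
  if [&& a != mzero, b != mzero & mdeg a + mdeg b == p]%N
  then omega_coef (mdeg a) * (th a (iota v ^+ mdeg a) * th b (iota v ^+ mdeg b)) else 0.
Proof.
have E : coef2 a b (omega (iota v)) = \sum_(1 <= i < p)
    omega_coef i * (th a (iota v ^+ i) * th b (iota v ^+ (p - i))).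
  by rewrite linear_sum; apply: eq_bigr => i _; rewrite linearZ /= /coef2 tpair_tens.
rewrite E; case: ifP => [/and3P[a0 b0 /eqP ab]|nab].
  have a1 : (0 < mdeg a)%N by rewrite lt0n mdeg_eq0.
  have b1 : (0 < mdeg b)%N by rewrite lt0n mdeg_eq0.
  have ap : (mdeg a < p)%N by rewrite -ab -[ltnLHS]addn0 ltn_add2l.
  rewrite (bigD1_seq (mdeg a)) ?iota_uniq ?mem_index_iota ?a1 //=.
  have -> : (p - mdeg a)%N = mdeg b by rewrite -ab addKn.
  rewrite big_nat_cond big1 ?addr0 // => i /andP[/andP[_ ip] ia].
  by rewrite dual_pow ?mul0r ?mulr0 // eq_sym.
rewrite big_nat_cond big1 // => i; rewrite andbT => /andP[i0 ip].
case: (eqVneq (mdeg a) i) => [ai|ai]; last by rewrite dual_pow // mul0r mulr0.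
case: (eqVneq (mdeg b) (p - i)%N) => [bi|bi]; last first.
  by rewrite [th b _]dual_pow ?mulr0 // ltn_subrL i0.
by move: nab; rewrite -!mdeg_eq0 ai bi subnKC ?(ltnW ip) // eqxx -!lt0n i0 subn_gt0 ip.
Qed.

(** Both sides equal (p-1)! / (i! j! l!). *)
Lemma omega_coef_bin i j l : (i + j + l = p)%N -> (0 < i)%N -> (0 < j)%N -> (0 < l)%N ->
  omega_coef (i + j) * 'C(i + j, i)%:R = omega_coef i * 'C(j + l, j)%:R.
Proof.
move=> ijl i0 j0 l0.
have nz m : (m < p)%N -> m`!%:R != 0 :> K by apply: (fact_small_neq0 charK).
have ip : (i < p)%N by rewrite -ijl -addnA -[ltnLHS]addn0 ltn_add2l addn_gt0 j0.
have jp : (j < p)%N.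
  by rewrite -ijl [(i + j)%N]addnC -addnA -[ltnLHS]addn0 ltn_add2l addn_gt0 i0.
have lp : (l < p)%N by rewrite -ijl -[ltnLHS]add0n ltn_add2r addn_gt0 i0.
have ijp : (i + j < p)%N by rewrite -ijl -[ltnLHS]addn0 ltn_add2l.
have jlp : (j + l < p)%N by rewrite -ijl -addnA -[ltnLHS]add0n ltn_add2r.
have e1 : (p - (i + j) = l)%N by rewrite -ijl addKn.
have e2 : (p - i = j + l)%N by rewrite -ijl -addnA addKn.
have b1 : 'C(i + j, i)%:R = (i + j)`!%:R / (i`!%:R * j`!%:R) :> K.
  rewrite -(@bin_fact (i + j) i) ?leq_addr // addKn !natrM mulfK //.
  by rewrite mulf_neq0 ?nz.
have b2 : 'C(j + l, j)%:R = (j + l)`!%:R / (j`!%:R * l`!%:R) :> K.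
  rewrite -(@bin_fact (j + l) j) ?leq_addr // addKn !natrM mulfK //.
  by rewrite mulf_neq0 ?nz.
rewrite /omega_coef e1 e2 b1 b2; field; rewrite ?nz //.
Qed.

Lemma omega_cocycle v : coef_cocycle th (omega (iota v)).
Proof.
move=> a b c a0 b0 c0; rewrite !coef2_omega a0 c0 /=.
have -> : madd a b != mzero.
  by rewrite -mdeg_eq0 mdegD addn_eq0 !mdeg_eq0 negb_and a0.
have -> : madd b c != mzero.
  by rewrite -mdeg_eq0 mdegD addn_eq0 !mdeg_eq0 negb_and b0.
rewrite /= !mdegD addnA; case: eqP => [abc|//].
have [a1 b1 c1] : [/\ 0 < mdeg a, 0 < mdeg b & 0 < mdeg c]%N.
  by rewrite !lt0n !mdeg_eq0.
have ab : (mdeg a + mdeg b < p)%N by rewrite -abc -[ltnLHS]addn0 ltn_add2l.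
have bc : (mdeg b + mdeg c < p)%N by rewrite -abc -addnA -[ltnLHS]add0n ltn_add2r.
rewrite !dual_powD //.
rewrite !mulrA [omega_coef (mdeg a + mdeg b) * _](omega_coef_bin abc) //.
by do 2 congr (_ * _); apply: mulrAC.
Qed.

Lemma omega_aug v : omega (iota v) \in tens_square Uplus.
Proof.
rewrite /omega big_nat_cond; apply: memv_suml => i; rewrite andbT => /andP[i0 ip].
have aug m : (0 < m)%N -> iota v ^+ m \in Uplus.
  case: m => // m _; apply/augmentation_idealP.
  by rewrite exprS rmorphM /= [counit _](counit_env U v) mul0r.
by rewrite memvZ // tens_squareS ?aug // subn_gt0.
Qed.

Lemma tens_aug u v : tens (iota u) (iota v) \in tens_square Uplus.
Proof. by apply: tens_squareS; apply/augmentation_idealP; apply: counit_env. Qed.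

Lemma dual_env_deg v a : mdeg a != 1%N -> th a (iota v) = 0.
Proof. by move=> a1; rewrite -[iota v]expr1 dual_pow. Qed.

Lemma tens_cocycle u v : coef_cocycle th (tens (iota u) (iota v)).
Proof.
have deg a b : a != mzero -> b != mzero -> mdeg (madd a b) != 1%N.
  rewrite -!mdeg_eq0 mdegD; case: (mdeg a) => // i _; case: (mdeg b) => // j _.
  by rewrite addnS.
move=> a b c a0 b0 c0; rewrite /coef2 !tpair_tens.
by rewrite [th (madd a b) _]dual_env_deg ?[th (madd b c) _]dual_env_deg ?deg // mul0r mulr0.
Qed.

Lemma coef_cocycleP e s t : coef_cocycle th s -> coef_cocycle th t ->
  coef_cocycle th (e *: s + t).
Proof. by move=> cs ct a b c a0 b0 c0; rewrite !linearP /= cs ?ct. Qed.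

Lemma coef_cocycle0 : coef_cocycle th 0.
Proof. by move=> a b c *; rewrite !linear0. Qed.

(** The two families of invariants of a class: the antisymmetric part of the coefficients on pairs
    of generators, and the coefficient at x_k and the divided power of x_k of order p - 1. Both
    vanish on coboundaries ([coboundary_coef2]). *)
Definition alt_coef i j chi : K^o := coef2 (meps i) (meps j) chi - coef2 (meps j) (meps i) chi.
Definition frob_coef k chi : K^o := coef2 (meps k) (mscale p.-1 k) chi.

Lemma coef2P a b e s t : coef2 a b (e *: s + t) = e * coef2 a b s + coef2 a b t :> K.
Proof. by rewrite linearP. Qed.

Lemma alt_coefP i j e s t : alt_coef i j (e *: s + t) = e * alt_coef i j s + alt_coef i j t :> K.
Proof. by rewrite /alt_coef !coef2P; ring. Qed.

Lemma frob_coefP k e s t : frob_coef k (e *: s + t) = e * frob_coef k s + frob_coef k t :> K.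
Proof. by rewrite /frob_coef coef2P. Qed.

(** The invariants are linear, so only the difference matters; for a cocycle their vanishing is what
    [coboundary_criterion] asks for. *)
Lemma cohomologousP chi chi' :
  chi \in tens_square Uplus -> chi' \in tens_square Uplus ->
  coef_cocycle th chi -> coef_cocycle th chi' ->
  cohomologous chi chi' <->
  (forall i j : 'I_n, (i < j)%N -> alt_coef i j chi = alt_coef i j chi') /\
  (forall k, frob_coef k chi = frob_coef k chi').
Proof.
move=> chiU chiU' cc cc'.
have -> : chi = 1 *: (chi - chi') + chi' by rewrite scale1r subrK.
have dU : chi - chi' \in tens_square Uplus by rewrite rpredB.
have dc : coef_cocycle th (chi - chi').
  by rewrite -scaleN1r addrC; apply: coef_cocycleP.
move: (chi - chi') dU dc => d dU dc {chi chiU cc}.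
split=> [[s sU dE0]|[alt frob]].
  have dE : d = cobar1 s by move: dE0; rewrite scale1r addrK.
  have [sym top] := coboundary_coef2 charK x_basis thP sU.
  split=> [i j _|k]; rewrite ?alt_coefP ?frob_coefP mul1r.
    by rewrite /alt_coef dE sym subrr add0r.
  by rewrite /frob_coef dE top add0r.
have alt0 (i j : 'I_n) : (i < j)%N -> alt_coef i j d = 0.
  by move=> /alt; rewrite alt_coefP mul1r -[RHS]add0r => /addIr.
have [] := coboundary_criterion charK x_basis thP dU dc.
- move=> i j; apply/eqP; case: (ltngtP i j) => [|ji|/val_inj -> //].
    by move=> /alt0 /eqP; rewrite subr_eq0.
  by rewrite eq_sym; move/alt0/eqP: ji; rewrite subr_eq0.
- by move=> k; have := frob k; rewrite frob_coefP mul1r -[RHS]add0r => /addIr.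
by move=> s sU dE; exists s => //; rewrite scale1r addrK.
Qed.

Section OddCharacteristic.
Hypothesis p_gt2 : (2 < p)%N.

Lemma alt_coef_tens i j u v : alt_coef i j (tens (iota u) (iota v)) =
  coord x i u * coord x j v - coord x j u * coord x i v.
Proof. by rewrite /alt_coef /coef2 !tpair_tens !(dual_eps charK x_basis thP). Qed.

(** The terms of omega have total degree p > 2, while the pair (e_i, e_j) has degree 2. *)
Lemma alt_coef_omega i j v : alt_coef i j (omega (iota v)) = 0.
Proof. by rewrite /alt_coef !coef2_omega !mdeg_eps (ltn_eqF p_gt2) !andbF subrr. Qed.

Lemma frob_coef_tens k u v : frob_coef k (tens (iota u) (iota v)) = 0.
Proof.
rewrite /frob_coef /coef2 tpair_tens [th (mscale _ _) _]dual_env_deg ?mulr0 //.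
by rewrite mdeg_mscale -eqSS prednK // (gtn_eqF p_gt2).
Qed.

Lemma dual_mscale_pow v k m : (m < p)%N ->
  th (mscale m k) (iota v ^+ m) = m`!%:R * coord x k v ^+ m.
Proof.
elim: m => [|m IH] mp.
  rewrite !expr0 (dual_one charK thP) fact0 mulr1 -mdeg_eq0 mdeg_mscale //.
have e : (m.+1 = mdeg (meps k) + mdeg (mscale m k))%N by rewrite mdeg_eps mdeg_mscale.
rewrite mscaleS {1}e dual_powD -?e // mdeg_eps expr1 (dual_eps charK x_basis thP).
rewrite mdeg_mscale IH 1?ltnW // bin1 factS natrM exprS -!mulrA; congr (_ * _).
by rewrite mulrCA.
Qed.

(** Only r (x) r^(p-1) contributes, with scalar (p-1)!/(1! (p-1)!) = 1; the factor (p-1)! comes from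
    evaluating a functional dual to a divided power at an ordinary power. *)
Lemma frob_coef_omega k v : frob_coef k (omega (iota v)) = (p.-1)`!%:R * coord x k v ^+ p.
Proof.
rewrite /frob_coef coef2_omega -!mdeg_eq0 mdeg_eps mdeg_mscale add1n prednK // eqxx.
have p1 : (0 < p.-1)%N by rewrite -ltnS prednK.
rewrite -!lt0n p1 /= expr1 (dual_eps charK x_basis thP) dual_mscale_pow ?ltn_predL //.
rewrite /omega_coef factS fact0 mul1r subn1 divff ?mul1r; last first.
  by rewrite (fact_small_neq0 charK) // ltn_predL.
by rewrite mulrCA -exprS prednK.
Qed.

End OddCharacteristic.

End CartierClasses.

(** * The normal forms chi_P and their behaviour under automorphisms *)

Section ChiClasses.
Context {K : closedFieldType} {p : nat} (charK : p \in [pchar K]).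
Context {n : nat} {T : abelian_type K p n} (U : restricted_env (type_h T)).
Local Notation h := (type_h T).
Variable x : n.-tuple h.
Hypothesis x_basis : basis_of fullv x.
Hypothesis p_gt2 : (2 < p)%N.
Local Notation iota := (env_in U).
Local Notation mono := (mono U x).
Local Notation msmall := (@msmall p n).
Local Notation Uplus := (augmentation_ideal U).
Variable th : mindex n -> {linear U -> K^o}.
Hypothesis thP : forall a b, msmall b -> th a (mono b) = (a == b)%:R.
Local Notation alt_coef := (alt_coef th).
Local Notation frob_coef := (@frob_coef K p n T U th).
Local Notation chi_of := (chi_of U x).

Lemma alt_coef_sum i j (I : finType) (F : I -> tensor U U) (c : I -> K) t :
  alt_coef i j (\sum_l c l *: F l + t) = \sum_l c l * alt_coef i j (F l) + alt_coef i j t.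
Proof.
elim/big_ind2: _ t => [t|s1 c1 s2 c2 IH1 IH2 t|l _ t]; first by rewrite !add0r.
  by rewrite -addrA IH1 IH2 addrA.
exact: alt_coefP.
Qed.

Lemma frob_coef_sum k (I : finType) (F : I -> tensor U U) (c : I -> K) t :
  frob_coef k (\sum_l c l *: F l + t) = \sum_l c l * frob_coef k (F l) + frob_coef k t.
Proof.
elim/big_ind2: _ t => [t|s1 c1 s2 c2 IH1 IH2 t|l _ t]; first by rewrite !add0r.
  by rewrite -addrA IH1 IH2 addrA.
exact: frob_coefP.
Qed.

Lemma coord_basis_elt i j : coord x i (tnth x j) = (j == i)%:R.
Proof. by rewrite (tnth_nth 0) coord_free ?(basis_free x_basis). Qed.

(* A common form for [chi_P] and for its images under automorphisms of [h]. *)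
Definition chi_gen (u : 'I_n -> h) (a : ltpair n -> K) (v : h) : tensor U U :=
  \sum_(ij : ltpair n) a ij *: tens (iota (u (val ij).1)) (iota (u (val ij).2))
  + omega (iota v).

Lemma chi_gen_aug u a v : chi_gen u a v \in tens_square Uplus.
Proof.
rewrite rpredD ?omega_aug // rpred_sum // => ij _.
by rewrite rpredZ // tens_aug.
Qed.

Lemma chi_gen_cocycle u a v : coef_cocycle th (chi_gen u a v).
Proof.
rewrite /chi_gen -[X in X + _]scale1r; apply: coef_cocycleP; last exact: (omega_cocycle charK x_basis thP).
apply: big_ind => [|s t cs ct|ij _]; first exact: coef_cocycle0.
  by rewrite -[s]scale1r; apply: coef_cocycleP.
rewrite -[_ *: _]addr0; apply: coef_cocycleP; last exact: coef_cocycle0.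
exact: (tens_cocycle charK x_basis thP).
Qed.

Lemma alt_coef_chi_gen i j u a v : alt_coef i j (chi_gen u a v) =
  \sum_(rs : ltpair n) a rs * (coord x i (u (val rs).1) * coord x j (u (val rs).2)
    - coord x j (u (val rs).1) * coord x i (u (val rs).2)).
Proof.
rewrite /chi_gen alt_coef_sum (alt_coef_omega charK x_basis thP) // addr0.
by apply: eq_bigr => rs _; rewrite (alt_coef_tens charK x_basis thP).
Qed.

Lemma frob_coef_chi_gen k u a v :
  frob_coef k (chi_gen u a v) = (p.-1)`!%:R * coord x k v ^+ p.
Proof.
rewrite /chi_gen frob_coef_sum (frob_coef_omega charK x_basis thP) // big1 ?add0r // => rs _.
by rewrite (frob_coef_tens charK x_basis thP) // mulr0.
Qed.

Lemma chi_ofE P : chi_of P = chi_gen (tnth x) P.1 (\sum_k P.2 k *: tnth x k).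
Proof. by []. Qed.

Lemma alt_coef_chi P (ij : ltpair n) :
  alt_coef (val ij).1 (val ij).2 (chi_of P) = P.1 ij.
Proof.
rewrite chi_ofE alt_coef_chi_gen (bigD1 ij) //= !coord_basis_elt !eqxx.
have /negPf lt : (val ij).1 != (val ij).2 by rewrite -val_eqE ltn_eqF ?(valP ij).
rewrite lt mul0r subr0 !mulr1 big1 ?addr0 // => rs rs_ij.
rewrite !coord_basis_elt.
have -> : ((val rs).1 == (val ij).1)%:R * ((val rs).2 == (val ij).2)%:R = 0 :> K.
  rewrite -natrM mulnb [in X in X%:R](_ : _ && _ = false) //.
  apply: contraNF rs_ij => /andP[/eqP e1 /eqP e2].
  by apply/eqP/val_inj; rewrite [val rs]surjective_pairing e1 e2 -surjective_pairing.
(* Both pairs are increasing, so neither is the swap of the other. *)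
have -> : ((val rs).1 == (val ij).2)%:R * ((val rs).2 == (val ij).1)%:R = 0 :> K.
  rewrite -natrM mulnb [in X in X%:R](_ : _ && _ = false) //.
  apply/negP => /andP[/eqP e1 /eqP e2]; have := valP rs; have := valP ij.
  by rewrite e1 e2 => /ltn_trans H /H; rewrite ltnn.
by rewrite subrr mulr0.
Qed.

Lemma coord_sum_basis k (c : 'I_n -> K) : coord x k (\sum_l c l *: tnth x l) = c k.
Proof.
rewrite linear_sum (bigD1 k) //= linearZ /= coord_basis_elt eqxx.
rewrite big1 ?addr0 => [|l /negPf lk]; first exact: mulr1.
by rewrite linearZ /= coord_basis_elt lk; apply: mulr0.
Qed.

Lemma frob_coef_chi P k : frob_coef k (chi_of P) = (p.-1)`!%:R * P.2 k ^+ p.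
Proof. by rewrite chi_ofE frob_coef_chi_gen coord_sum_basis. Qed.

Lemma fact_p1_neq0 : (p.-1)`!%:R != 0 :> K.
Proof. by apply: (fact_small_neq0 charK); rewrite ltn_predL (ltn_trans _ p_gt2). Qed.

(** The a_ij are the antisymmetric coefficients, and b_k is the p-th root of [frob_coef k chi] /
    (p-1)!. The root exists because k is closed and is unique because Frobenius is injective. *)
Lemma chi_class chi : chi \in tens_square Uplus -> coef_cocycle th chi ->
  exists P, forall P', cohomologous chi (chi_of P') <-> P' = P.
Proof.
move=> chiU cc.
pose P : param K n := ([ffun ij : ltpair n => alt_coef (val ij).1 (val ij).2 chi : K],
  [ffun k => @proot K p (frob_coef k chi / (p.-1)`!%:R)]).
exists P => P'.
rewrite (cohomologousP charK x_basis thP) ?chi_ofE ?chi_gen_aug //; last exact: chi_gen_cocycle.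
rewrite -chi_ofE; split=> [[alt frob]|->].
  case: P' alt frob => P1 P2 alt frob; congr (_, _); apply/ffunP; [move=> ij|move=> k]; rewrite !ffunE.
    by rewrite alt ?(valP ij) // alt_coef_chi.
  apply: (frobenius_inj charK); rewrite (prootK charK) frob frob_coef_chi /=.
  by rewrite mulrC mulKf // fact_p1_neq0.
split=> [i j ij|k]; last first.
  by rewrite frob_coef_chi /= ffunE (prootK charK) mulrC divfK ?fact_p1_neq0.
pose ij' : ltpair n := Sub (i, j) ij.
by rewrite -[i]/((val ij').1) -[j in LHS]/((val ij').2) -[j in RHS]/((val ij').2) alt_coef_chi ffunE.
Qed.

Lemma tmap_omega (F : {lrmorphism U -> U}) r r' :
  F r = r' -> tmap F F (omega r) = omega r'.
Proof.
move=> <-; rewrite linear_sum; apply: eq_bigr => i _.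
by rewrite linearZ /= tmap_tens !rmorphXn.
Qed.

(** Both sides are cocycles, so it suffices to compare invariants. Antisymmetrisation produces the
    minors of G, and the p-th power in [frob_coef_chi] is the reason for the factor gamma^(1/p) on
    the b_k. *)
Lemma chi_act (phi : K * 'End(h)) (F : {lrmorphism U -> U}) P :
  (forall a, F (iota a) = iota (phi.2 a)) ->
  cohomologous (phi.1 *: tmap F F (chi_of P)) (chi_of (Aut_act_param x phi P)).
Proof.
move=> Fphi; set v := \sum_k P.2 k *: tnth x k.
have FP : tmap F F (chi_of P) = chi_gen (fun i => phi.2 (tnth x i)) P.1 (phi.2 v).
  rewrite chi_ofE linearD /= (tmap_omega (Fphi v)) linear_sum; congr (_ + _).
  by apply: eq_bigr => ij _; rewrite linearZ /= tmap_tens; congr (_ *: tens _ _); apply: Fphi.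
have chiU : phi.1 *: tmap F F (chi_of P) \in tens_square Uplus.
  by rewrite FP rpredZ // chi_gen_aug.
have cc : coef_cocycle th (phi.1 *: tmap F F (chi_of P)).
  rewrite -[_ *: _]addr0; apply: coef_cocycleP; last exact: coef_cocycle0.
  by rewrite FP; apply: chi_gen_cocycle.
apply/(cohomologousP charK x_basis thP) => //; rewrite ?chi_ofE ?chi_gen_aug //.
  exact: chi_gen_cocycle.
rewrite -!chi_ofE; split=> [i j ij|k].
  rewrite -[_ *: _]addr0 alt_coefP FP alt_coef_chi_gen.
  pose ij' : ltpair n := Sub (i, j) ij.
  rewrite -[i in RHS]/((val ij').1) -[j in RHS]/((val ij').2) alt_coef_chi ffunE /=.
  have -> : alt_coef i j 0 = 0 by rewrite /alt_coef !linear0 addr0.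
  rewrite addr0 mulr_sumr; apply: eq_bigr => rs _.
  by case: (val rs) => r s /=; rewrite mulrA mulrAC.
rewrite -[_ *: _]addr0 frob_coefP FP frob_coef_chi_gen frob_coef_chi.
have -> : frob_coef k 0 = 0 by rewrite /frob_coef linear0.
rewrite addr0 mulrCA; congr (_ * _); rewrite ffunE.
have -> : \sum_s @proot K p phi.1 * coord x k (phi.2 (tnth x s)) * P.2 s =
    @proot K p phi.1 * coord x k (phi.2 v).
  have -> : coord x k (phi.2 v) = \sum_s P.2 s * coord x k (phi.2 (tnth x s)) :> K.
    by rewrite /v !linear_sum; apply: eq_bigr => s _; rewrite !linearZ.
  by rewrite mulr_sumr; apply: eq_bigr => s _; rewrite -mulrA [_ * P.2 s]mulrC.
by rewrite exprMn (prootK charK).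
Qed.

End ChiClasses.

(** * The derivation rho and the operator Phi *)

Lemma iter_linear (K : fieldType) (V : lmodType K) (d : {linear V -> V}) m : linear (iter m d).
Proof. by elim: m => [|m IH] c u v //=; rewrite IH linearP. Qed.

Lemma iter_scale (K : fieldType) (V : lmodType K) (d : {linear V -> V}) (c : K) m v :
  iter m (fun w => c *: d w) v = c ^+ m *: iter m d v.
Proof.
elim: m => [|m IH]; first by rewrite scale1r.
by rewrite !iterS IH linearZ scalerA exprS.
Qed.

Lemma derivation_iter (R : pzRingType) (d : R -> R) :
  (forall u v, d (u + v) = d u + d v) ->
  (forall u v, d (u * v) = d u * v + u * d v) ->
  forall m u v, iter m d (u * v) =
    \sum_(i < m.+1) (iter (m - i) d u * iter i d v) *+ 'C(m, i).
Proof.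
move=> dD dM; have d0 : d 0 = 0.
  by apply: (addrI (d 0)); rewrite -dD !addr0.
have dMn u i : d (u *+ i) = d u *+ i.
  by elim: i => [|i IH]; rewrite ?mulr0n // !mulrS dD IH.
elim=> [|m IH] u v; first by rewrite big_ord1 bin0 mulr1n.
rewrite iterS IH (big_morph d dD d0).
under eq_bigr => i _ do rewrite dMn dM mulrnDl.
rewrite big_split /= [in RHS]big_ord_recl /= ?subn0 bin0 mulr1n.
under [in RHS]eq_bigr => i _ do rewrite /bump /= add1n subSS binS mulrnDr.
rewrite [in RHS]big_split /= addrA; congr (_ + _).
rewrite [in LHS]big_ord_recl /= ?subn0 bin0 mulr1n; congr (_ + _).
rewrite [in RHS]big_ord_recr /= bin_small // mulr0n addr0.
by apply: eq_bigr => i _; rewrite /bump /= add1n -iterS subnSK.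
Qed.

Section CharPAlgebra.
Context {K : fieldType} {p : nat} (charK : p \in [pchar K]).

Lemma derivation_iter_p (R : nzRingType) (d : R -> R) : p \in [pchar R] ->
  (forall u v, d (u + v) = d u + d v) ->
  (forall u v, d (u * v) = d u * v + u * d v) ->
  forall u v, iter p d (u * v) = iter p d u * v + u * iter p d v.
Proof.
move=> chR dD dM u v; have p_gt0 := prime_gt0 (pcharf_prime chR).
rewrite derivation_iter // big_ord_recr /= subnn binn mulr1n; congr (_ + _).
rewrite -(big_mkord xpredT (fun i => (iter (p - i) d u * iter i d v) *+ 'C(p, i))).
rewrite big_ltn // subn0 bin0 mulr1n big_nat_cond big1 ?addr0 // => i.
rewrite andbT => ip; have /dvdnP[q ->] := prime_dvd_bin (pcharf_prime chR) ip.
by rewrite mulrnA -mulr_natr (pcharf0 chR) mulr0.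
Qed.

Lemma alg_exprDp (S : algType K) (a b : S) : a * b = b * a ->
  (a + b) ^+ p = a ^+ p + b ^+ p.
Proof.
move=> ab; have chS := pchar_alg charK S.
by have := pFrobenius_autD_comm chS ab; rewrite !pFrobenius_autE.
Qed.

(* Jacobson's formula in the situation of the relations [b r - r b = d(r)].   *)
Lemma skew_pow (S B : algType K) (d : S -> S) (g : {lrmorphism S -> B}) b s :
  (forall r r' : S, r * r' = r' * r) ->
  (forall r, b * g r - g r * b = g (d r)) ->
  (b + g s) ^+ p = b ^+ p + g (s ^+ p + iter p.-1 d s).
Proof.
move=> comm bg.
have ad i : iter i (fun w => b * w - w * b) (g s) = g (iter i d s).
  by elim: i => // i IH; rewrite !iterS IH bg.
rewrite (jacobson charK) => [|i]; last by rewrite ad /GRing.comm -!rmorphM comm.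
by rewrite ad rmorphD rmorphXn addrA.
Qed.

End CharPAlgebra.

Section RhoTheory.
Context {K : fieldType} {p n : nat} (charK : p \in [pchar K]).
Context {T : abelian_type K p n} (z : type_g T) (lambda : K).
Hypothesis z_rpow : rpow z = lambda *: z.
Context (U : restricted_env (type_h T)) (rhoU : {linear U -> U}).
Hypothesis rhoU_ext : rho_extension z rhoU.
Local Notation h := (type_h T).
Local Notation iota := (env_in U).
Local Notation Uplus := (augmentation_ideal U).
Local Notation Phi1 := (Phi1 lambda rhoU).
Local Notation Phi2 := (Phi2 lambda rhoU).

Let p_gt0 : (0 < p)%N := prime_gt0 (pcharf_prime charK).

Lemma rhoM r s : rhoU (r * s) = rhoU r * s + r * rhoU s.
Proof. exact: rhoU_ext.1. Qed.

Lemma rho1 : rhoU 1 = 0.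
Proof.
have := rhoM 1 1; rewrite !(mulr1, mul1r) => e.
by apply: (addrI (rhoU 1)); rewrite -e addr0.
Qed.

Lemma counit_rho u : counit (rhoU u) = 0 :> K.
Proof.
elim/(@env_ind _ _ _ U): u => [|c u v cu cv|u v cu cv|a].
- by rewrite rho1 counit0.
- by rewrite linearP /= linearP /= cu cv scaler0 addr0.
- by rewrite rhoM linearD /= !rmorphM /= cu cv mul0r mulr0 addr0.
- by rewrite rhoU_ext.2 counit_env.
Qed.

Lemma rhoU2_linear : linear (rhoU2 rhoU).
Proof.
by move=> c s t; rewrite /rhoU2 !linearP /= addrACA scalerDr.
Qed.

HB.instance Definition _ := GRing.isLinear.Build K (tensor U U) (tensor U U) *:%R
  (rhoU2 rhoU) rhoU2_linear.

Lemma rhoU2_tens a b : rhoU2 rhoU (tens a b) = tens (rhoU a) b + tens a (rhoU b).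
Proof. by rewrite /rhoU2 !tmap_tens. Qed.

Lemma rhoU2M s t : rhoU2 rhoU (s * t) = rhoU2 rhoU s * t + s * rhoU2 rhoU t.
Proof.
have M (D : {linear tensor U U -> tensor U U}) :
    (forall a b, D (tens a b) = tens (rhoU a) b + tens a (rhoU b)) ->
    forall u v, D (u * v) = D u * v + u * D v; last exact: (M (mklin rhoU2_linear) rhoU2_tens).
move=> DE {}s {}t; move: s; apply: tensor_ind => [c s s' e e'||a b].
- rewrite mulrDl -scalerAl !linearP /= e e' !mulrDl -!scalerAl scalerDr.
  by rewrite addrACA.
- by rewrite mul0r linear0 !mul0r addr0.
move: t; apply: tensor_ind => [c t t' e e'||a' b'].
- rewrite mulrDr -scalerAr !linearP /= e e' !mulrDr -!scalerAr scalerDr.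
  by rewrite addrACA.
- by rewrite mulr0 linear0 !mulr0 addr0.
rewrite tens_mul !DE mulrDl mulrDr !tens_mul !rhoM tensDl tensDr.
by rewrite addrACA.
Qed.

Lemma comul_rho u : comul (rhoU u) = rhoU2 rhoU (comul u).
Proof.
elim/(@env_ind _ _ _ U): u => [|c u v cu cv|u v cu cv|a].
- by rewrite rho1 linear0 rmorph1 -tens11 rhoU2_tens rho1 tens0l tens0r addr0.
- have -> : rhoU2 rhoU (comul (c *: u + v)) =
      c *: rhoU2 rhoU (comul u) + rhoU2 rhoU (comul v) by rewrite linearP rhoU2_linear.
  by rewrite -cu -cv !linearP.
- by rewrite rhoM linearD /= !rmorphM /= cu cv rhoU2M.
- rewrite rhoU_ext.2 !env_in_prim.
  have -> s t : rhoU2 rhoU (s + t) = rhoU2 rhoU s + rhoU2 rhoU t.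
    exact: (linearD (mklin rhoU2_linear)).
  rewrite !rhoU2_tens rhoU_ext.2 rho1.
  by rewrite tens0l tens0r addr0 add0r.
Qed.

(** Both sides are derivations by [derivation_iter_p], and on h they agree because rho turns the
    p-map of z into a p-th power and [z_rpow] holds. *)
Lemma rho_iter_p u : iter p rhoU u = lambda *: rhoU u.
Proof.
have itl := iter_linear rhoU p.
elim/(@env_ind _ _ _ U): u => [|c u v cu cv|u v cu cv|a].
- have it1 m : (0 < m)%N -> iter m rhoU 1 = 0.
    case: m => // m _; rewrite iterSr rho1; exact: (linear0 (mklin (iter_linear rhoU m))).
  by rewrite it1 // rho1 scaler0.
- by rewrite itl cu cv linearP scalerDr !scalerA mulrC.
- rewrite (derivation_iter_p (pchar_alg charK U)) ?cu ?cv //.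
  + by rewrite rhoM scalerDr scalerAl scalerAr.
  + exact: raddfD.
  + exact: rhoM.
have it m : iter m rhoU (iota a) = iota (iter m (type_rho T z) a).
  by elim: m => // m IH; rewrite !iterS IH rhoU_ext.2.
rewrite it rhoU_ext.2 -(type_rho_rpow z a) z_rpow linearZ /= scale_lfunE linearZ //.
Qed.

Lemma rho_pow u m : rhoU (u ^+ m) = (u ^+ m.-1 * rhoU u) *+ m.
Proof.
elim: m => [|m IH]; first by rewrite expr0 rho1 mulr0n.
rewrite exprS rhoM IH mulrS (env_mulC (rhoU u)); congr (_ + _).
case: m {IH} => [|m]; first by rewrite !mulr0n mulr0.
by rewrite mulrnAr mulrA -exprS.
Qed.

Lemma rho_powp u : rhoU (u ^+ p) = 0.
Proof. by rewrite rho_pow -mulr_natr (pcharf0 (pchar_alg charK U)) mulr0. Qed.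

(** A derivation kills p-th powers, and the two remaining terms cancel by [rho_iter_p]. *)
Lemma rho_Phi1 s : rhoU (Phi1 s) = 0.
Proof.
rewrite /Defs.Phi1 /Phi_op linearD linearB /= rho_powp linearZ /= sub0r.
by rewrite -iterS prednK // rho_iter_p addNr.
Qed.

Lemma Phi1D s t : Phi1 (s + t) = Phi1 s + Phi1 t.
Proof.
rewrite /Defs.Phi1 /Phi_op (alg_exprDp charK) ?(env_mulC s) //.
have -> : iter p.-1 rhoU (s + t) = iter p.-1 rhoU s + iter p.-1 rhoU t.
  exact: (linearD (mklin (iter_linear rhoU p.-1))).
by rewrite scalerDr opprD [_ + (- _ - _)]addrACA [LHS]addrACA.
Qed.

Lemma Phi2D s t : Phi2 (s + t) = Phi2 s + Phi2 t.
Proof.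
rewrite /Defs.Phi2 /Phi_op (alg_exprDp charK) ?(env2_mulC s) //.
have -> : iter p.-1 (rhoU2 rhoU) (s + t) =
    iter p.-1 (rhoU2 rhoU) s + iter p.-1 (rhoU2 rhoU) t.
  exact: (linearD (mklin (iter_linear (rhoU2 rhoU) p.-1))).
by rewrite scalerDr opprD [_ + (- _ - _)]addrACA [LHS]addrACA.
Qed.

Lemma Phi10 : Phi1 0 = 0.
Proof. by apply: (addrI (Phi1 0)); rewrite -Phi1D !addr0. Qed.

Lemma Phi20 : Phi2 0 = 0.
Proof. by apply: (addrI (Phi2 0)); rewrite -Phi2D !addr0. Qed.

Lemma Phi1N s : Phi1 (- s) = - Phi1 s.
Proof. by apply: (addrI (Phi1 s)); rewrite -Phi1D !subrr Phi10. Qed.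

Lemma Phi2N s : Phi2 (- s) = - Phi2 s.
Proof. by apply: (addrI (Phi2 s)); rewrite -Phi2D !subrr Phi20. Qed.

Lemma Phi1_aug s : s \in Uplus -> Phi1 s \in Uplus.
Proof.
move=> /augmentation_idealP es; apply/augmentation_idealP.
rewrite /Defs.Phi1 /Phi_op linearD linearB linearZ /= rmorphXn /= es.
have -> : counit (iter p.-1 rhoU s) = 0 :> K.
  have it m : counit (iter m rhoU s) = 0 :> K by case: m => // m; rewrite iterS counit_rho.
  exact: it.
by rewrite scaler0 expr0n gtn_eqF // subr0 addr0.
Qed.

Lemma Phi2_comul s : Phi2 (comul s) = comul (Phi1 s).
Proof.
have it m : iter m (rhoU2 rhoU) (comul s) = comul (iter m rhoU s).
  by elim: m => // m IH; rewrite !iterS IH comul_rho.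
by rewrite /Defs.Phi1 /Defs.Phi2 /Phi_op it [RHS]linearD linearB [in RHS]linearZ_LR /= rmorphXn.
Qed.

Lemma Phi2_tensl s : Phi2 (tens s 1) = tens (Phi1 s) 1.
Proof.
have it m : iter m (rhoU2 rhoU) (tens s 1) = tens (iter m rhoU s) 1.
  by elim: m => // m IH; rewrite !iterS IH rhoU2_tens rho1 tens0r addr0.
by rewrite /Defs.Phi1 /Defs.Phi2 /Phi_op it tensX expr1n !tensDl tensNl tensZl.
Qed.

Lemma Phi2_tensr s : Phi2 (tens 1 s) = tens 1 (Phi1 s).
Proof.
have it m : iter m (rhoU2 rhoU) (tens 1 s) = tens 1 (iter m rhoU s).
  by elim: m => // m IH; rewrite !iterS IH rhoU2_tens rho1 tens0l add0r.
by rewrite /Defs.Phi1 /Defs.Phi2 /Phi_op it tensX expr1n !tensDr tensNr tensZr.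
Qed.

Lemma Phi2_cobar1 s : Phi2 (cobar1 s) = cobar1 (Phi1 s).
Proof. by rewrite /cobar1 !Phi2D Phi2N Phi2_tensl Phi2_tensr Phi2_comul. Qed.

Lemma rho_equivariant (phi : K * 'End(h)) (F : {lrmorphism U -> U}) :
  Aut_type z lambda phi -> (forall a, F (iota a) = iota (phi.2 a)) ->
  forall u, rhoU (F u) = phi.1 *: F (rhoU u).
Proof.
case=> _ _ _ rphi Fphi u; elim/(@env_ind _ _ _ U): u => [|c u v cu cv|u v cu cv|a].
- by rewrite rmorph1 rho1 linear0 scaler0.
- have -> : rhoU (F (c *: u + v)) = c *: rhoU (F u) + rhoU (F v) by rewrite !linearP.
  have -> : F (rhoU (c *: u + v)) = c *: F (rhoU u) + F (rhoU v) by rewrite !linearP.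
  by rewrite cu cv scalerDr !scalerA mulrC.
- by rewrite rmorphM rhoM /= cu cv rhoM linearD /= !rmorphM scalerDr scalerAl scalerAr.
- rewrite rhoU_ext.2 Fphi [X in X = _]rhoU_ext.2 rphi linearZ; congr (_ *: _).
  exact/esym/Fphi.
Qed.

(** The p-th power and the term with rho^(p-1) scale by gamma^p, the linear term by gamma; they
    match because gamma^p lambda = gamma lambda. *)
Lemma Phi1_equivariant (phi : K * 'End(h)) (F : {lrmorphism U -> U}) s :
  Aut_type z lambda phi -> (forall a, F (iota a) = iota (phi.2 a)) ->
  Phi1 (phi.1 *: F s) = phi.1 ^+ p *: F (Phi1 s).
Proof.
move=> A Fphi; have [[g0 gl] _ _ _] := A.
have it m u : iter m rhoU (F u) = phi.1 ^+ m *: F (iter m rhoU u).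
  elim: m u => [|m IH] u; first by rewrite scale1r.
  by rewrite iterS IH linearZ /= (rho_equivariant A Fphi) scalerA exprSr.
have gp (c : K) : c ^+ p = c * c ^+ p.-1 by rewrite -exprS prednK.
have itZ : iter p.-1 rhoU (phi.1 *: F s) = phi.1 ^+ p *: F (iter p.-1 rhoU s).
  rewrite gp -scalerA -it.
  exact: (linearZ_LR (mklin (iter_linear rhoU p.-1))).
have FE : F (Phi1 s) = F s ^+ p - lambda *: F s + F (iter p.-1 rhoU s).
  by rewrite raddfD raddfB /= rmorphXn linearZ_LR.
rewrite FE /Defs.Phi1 /Phi_op itZ exprZn.
by rewrite !scalerDr scalerN !scalerA gl mulrC.
Qed.

Lemma ext_hopf (f : h -> h) (F : {lrmorphism U -> U}) :
  (forall a, F (iota a) = iota (f a)) -> hopf_morphism F.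
Proof.
move=> Ff; apply: env_hopf_morphism => a.
by rewrite -[F (iota a)](esym (Ff a)) env_in_prim.
Qed.

Lemma cobar1_hopf (F : {lrmorphism U -> U}) s :
  hopf_morphism F -> cobar1 (F s) = tmap F F (cobar1 s).
Proof.
case=> FD _; rewrite /cobar1 FD linearD linearB /= !tmap_tens.
by rewrite !rmorph1.
Qed.

End RhoTheory.

(** * The prescribed coproduct of z: its p-th power and coassociativity *)

Section GeneratorCoproduct.
Context {K : fieldType} {p n : nat} (charK : p \in [pchar K]).
Context {T : abelian_type K p n} (U : restricted_env (type_h T)) (rhoU : {linear U -> U}).
Context (A : falgType K) (j : {lrmorphism U -> A}) (zeta : A).
Hypothesis zeta_j : forall r, zeta * j r - j r * zeta = j (rhoU r).
Local Notation zz := (tens zeta 1 + tens 1 zeta : tensor A A).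

Lemma zeta_coprod_comm t :
  zz * tmap j j t - tmap j j t * zz = tmap j j (rhoU2 rhoU t).
Proof.
set X := zz; move: t; apply: tensor_ind => [c s t es et||a b].
- have u1 : tmap j j (c *: s + t) = c *: tmap j j s + tmap j j t by rewrite linearP.
  have u2 : tmap j j (rhoU2 rhoU (c *: s + t)) =
      c *: tmap j j (rhoU2 rhoU s) + tmap j j (rhoU2 rhoU t).
    by rewrite (rhoU2_linear rhoU) linearP.
  by rewrite u1 u2 -es -et [X * _]mulrDr [_ * X]mulrDl -scalerAr -scalerAl opprD addrACA -scalerBr.
- by rewrite (linear0 (mklin (rhoU2_linear rhoU))) !linear0 mulr0 mul0r subrr.
rewrite /X tmap_tens /= mulrDl mulrDr !tens_mul !mulr1 !mul1r opprD addrACA.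
by rewrite -tensNl -tensNr -tensDl -tensDr !zeta_j rhoU2_tens linearD /= !tmap_tens.
Qed.

(** Jacobson's formula in A (x) A: adding chi to z (x) 1 + 1 (x) z contributes chi^p and
    rho^(p-1)(chi), which is the origin of Phi(chi). *)
Lemma zeta_coprod_pow chi : (zz + tmap j j chi) ^+ p =
  tens (zeta ^+ p) 1 + tens 1 (zeta ^+ p) + tmap j j (chi ^+ p + iter p.-1 (rhoU2 rhoU) chi).
Proof.
rewrite (skew_pow charK (g := tmap j j) chi (@env2_mulC _ _ _ U) zeta_coprod_comm).
congr (_ + _); rewrite (alg_exprDp charK) ?tensX ?expr1n //.
by rewrite !tens_mul !mulr1 !mul1r.
Qed.

Variable delta : {lrmorphism A -> tensor A A}.
Hypothesis delta_j : forall r, delta (j r) = tmap j j (comul r).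
Local Notation jjj := (tmap j (tmap j j)).

Lemma coprod_l t : tassoc (tmap delta idfun (tmap j j t)) =
  jjj (tassoc (tmap comul idfun t)).
Proof.
move: t; apply: tensor_ext => [c s t|c s t|a b]; rewrite ?linearP //.
rewrite !tmap_tens /= delta_j; move: (comul a).
apply: tensor_ext => [c s t|c s t|a1 a2].
- by rewrite !linearP /= tens_linearl linearP.
- by rewrite tens_linearl !linearP.
by rewrite tmap_tens !tassoc_tens !tmap_tens /= tmap_tens.
Qed.

Lemma coprod_r t : tmap idfun delta (tmap j j t) = jjj (tmap idfun comul t).
Proof.
move: t; apply: tensor_ext => [c s t|c s t|a b]; rewrite ?linearP //.
by rewrite !tmap_tens /= delta_j.
Qed.

Variable chi : tensor U U.
Hypothesis delta_zeta : delta zeta = zz + tmap j j chi.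
Local Notation zzz :=
  (tens zeta 1 + tens 1 (tens zeta 1) + tens 1 (tens 1 zeta) : tensor A (tensor A A)).

(** Together with [zeta_coassoc_r] this shows that coassociativity at z amounts to the cocycle
    equation: the two sides differ only in the terms of d^2(chi). *)
Lemma zeta_coassoc_l : tassoc (tmap delta idfun (delta zeta)) =
  zzz + jjj (tassoc (tmap comul idfun chi) + tassoc (tens chi 1)).
Proof.
have e3 : tassoc (tens (tmap j j chi) 1) = jjj (tassoc (tens chi 1)).
  move: (chi); apply: tensor_ext => [c s t|c s t|a b].
  - by rewrite linearP tens_linearl linearP.
  - by rewrite tens_linearl !linearP.
  by rewrite tmap_tens !tassoc_tens !tmap_tens /= tmap_tens /= rmorph1.
rewrite [in RHS]linearD /= -coprod_l -e3 delta_zeta !linearD /= !tmap_tens /= rmorph1.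
rewrite delta_zeta !tensDl !linearD /= !tassoc_tens -!addrA; congr (_ + (_ + _)).
by rewrite addrCA; congr (_ + _); rewrite addrC.
Qed.

Lemma zeta_coassoc_r : tmap idfun delta (delta zeta) =
  zzz + jjj (tens 1 chi + tmap idfun comul chi).
Proof.
have e4 : tens 1 (tmap j j chi) = jjj (tens 1 chi) by rewrite tmap_tens /= rmorph1.
rewrite [in RHS]linearD /= -coprod_r -e4 delta_zeta !linearD /= !tmap_tens /= rmorph1.
by rewrite delta_zeta !tensDr !addrA.
Qed.

End GeneratorCoproduct.

(** * Presentations and change of datum *)

Section HopfIso.
Context {K : fieldType}.
Implicit Types H : hopfType K.

Lemma lrmorphism_inverse (A B : algType K) (f : {lrmorphism A -> B}) : bijective f ->
  exists2 g : {lrmorphism B -> A}, cancel f g & cancel g f.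
Proof.
case=> g fK gK; have gl : linear g.
  by move=> c u v; apply: (can_inj fK); rewrite linearP /= !gK.
have g1 : g 1 = 1 by apply: (can_inj fK); rewrite gK rmorph1.
have gM u v : g (u * v) = g u * g v by apply: (can_inj fK); rewrite rmorphM /= !gK.
by exists (mkalg gl g1 gM).
Qed.

Lemma hopf_iso_refl H : hopf_iso H H.
Proof.
exists idfun; last by exists id.
by split=> // x /=; rewrite tmap_id.
Qed.

Lemma hopf_iso_sym H H' : hopf_iso H H' -> hopf_iso H' H.
Proof.
case=> f [fD fe] /lrmorphism_inverse[g fK gK].
exists g; last by exists f.
split=> x; last by rewrite -fe gK.
rewrite -{2}[x]gK fD tmap_comp -[LHS]tmap_id.
by apply: eq_tmap => y /=; rewrite fK.
Qed.

Lemma hopf_iso_trans H H' H'' : hopf_iso H H' -> hopf_iso H' H'' -> hopf_iso H H''.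
Proof.
case=> f [fD fe] fb [g [gD ge] gb].
exists (g \o f); last exact: bij_comp gb fb.
split=> x /=; last by rewrite ge fe.
by rewrite gD fD tmap_comp.
Qed.

Lemma iso_classP H H' : iso_class H = iso_class H' <-> hopf_iso H H'.
Proof.
split=> [e|HH'].
  by rewrite -[hopf_iso H H']/(iso_class H H') e; apply: hopf_iso_refl.
apply/funext => G; apply/propext; split; last exact: hopf_iso_trans.
by apply: hopf_iso_trans; apply: hopf_iso_sym.
Qed.

Lemma lrmorphism_lift (A S B : algType K) (v : {lrmorphism S -> B})
    (f : {lrmorphism A -> B}) : injective v -> (forall a, exists s, v s = f a) ->
  exists f' : {lrmorphism A -> S}, forall a, v (f' a) = f a.
Proof.
move=> vi vf; have [f' f'E] : exists f' : A -> S, forall a, v (f' a) = f a.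
  by exists (fun a => projT1 (cid (vf a))) => a; case: cid.
have fl : linear f' by move=> c u w; apply: vi; rewrite f'E !linearP /= !f'E.
have f1 : f' 1 = 1 by apply: vi; rewrite f'E !rmorph1.
have fM u w : f' (u * w) = f' u * f' w by apply: vi; rewrite f'E !rmorphM /= !f'E.
by exists (mkalg fl f1 fM).
Qed.

End HopfIso.

Section Presentation.
Context {K : fieldType} {p n : nat} {T : abelian_type K p n} (lambda : K).
Context (U : restricted_env (type_h T)) (rhoU : {linear U -> U}).
Local Notation Uplus := (augmentation_ideal U).

(** The body of [is_uz] with the embedding of u(h) and the generator kept as data. *)
Definition uz_presented (D : datum U) (H : hopfType K) (j : {lrmorphism U -> H})
    (zeta : H) : Prop :=
  [/\ datum_relations lambda rhoU j zeta D,
      forall (B : algType K) (f : {lrmorphism U -> B}) (b : B),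
        datum_relations lambda rhoU f b D ->
        exists2 g : {lrmorphism H -> B}, (forall r, g (j r) = f r) /\ g zeta = b &
          forall g' : {lrmorphism H -> B},
            (forall r, g' (j r) = f r) /\ g' zeta = b -> g' =1 g,
      hopf_morphism j &
      comul zeta = tens zeta 1 + tens 1 zeta + tmap j j D.2].

Section Theory.
Context (D : datum U) (H : hopfType K) (j : {lrmorphism U -> H}) (zeta : H).
Hypothesis P : uz_presented D j zeta.

Lemma uz_ind (Q : H -> Prop) : Q 1 ->
  (forall c x y, Q x -> Q y -> Q (c *: x + y)) ->
  (forall x y, Q x -> Q y -> Q (x * y)) ->
  (forall r, Q (j r)) -> Q zeta -> forall y, Q y.
Proof.
move=> Q1 QP QM Qj Qz y; have [[r1 r2] univ _ _] := P.
have [S [v [vi vQ vS]]] := subalgebra_of_pred Q1 QP QM.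
have [f fv] := lrmorphism_lift vi (fun r => vS _ (Qj r)).
have [b bv] := vS _ Qz.
have rel : datum_relations lambda rhoU f b D.
  split=> [r|]; apply: vi.
    by rewrite rmorphB !rmorphM /= bv !fv r1.
  by rewrite linear0 !raddfD raddfN /= rmorphXn linearZ_LR /= bv fv.
have [g [gj gz] _] := univ S f b rel.
have [w _ wu] := univ H j zeta (conj r1 r2).
pose vg : {lrmorphism H -> H} := v \o g.
have e1 : v (g y) = w y.
  by apply: (wu vg); split=> [r|] /=; rewrite ?gj ?gz.
have e2 : y = w y by apply: (wu idfun).
by rewrite e2 -e1; apply: vQ.
Qed.

Lemma uz_alg_ext (B : algType K) (f g : {lrmorphism H -> B}) :
  (forall r, f (j r) = g (j r)) -> f zeta = g zeta -> f =1 g.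
Proof.
move=> fj fz; apply: uz_ind => [|c x y fx fy|x y fx fy|//|//].
- by rewrite !rmorph1.
- by rewrite !linearP /= fx fy.
- by rewrite !rmorphM /= fx fy.
Qed.

Lemma uz_counit : D.2 \in tens_square Uplus -> counit zeta = 0 :> K.
Proof.
move=> /tens_square_augP[l _]; have [_ _ [_ je] dz] := P.
have := counitl zeta; rewrite -/(counit_left _) dz !linearD /= !counit_left_tens.
have -> : counit_left (tmap j j D.2) = j (counit_left D.2).
  move: (D.2); apply: tensor_ext => [c s t|c s t|a b]; rewrite ?linearP //.
  by rewrite tmap_tens !counit_left_tens je linearZ.
rewrite l linear0 addr0 counit1 scale1r -[RHS]add0r => /addIr e.
by have := congr1 (fun y => counit y : K) e; rewrite counit_alg counit0.
Qed.

End Theory.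

(** The maps given by the two universal properties are mutually inverse, and compatibility with
    coproduct and counit can be tested on generators. The counit of z is 0 by [uz_counit]. *)
Lemma uz_unique D H H' : D.2 \in tens_square Uplus ->
  is_uz lambda rhoU D H -> is_uz lambda rhoU D H' -> hopf_iso H H'.
Proof.
move=> D2 [j [zeta P]] [j' [zeta' P']].
have [rel univ [jD je] dz] := P; have [rel' univ' [jD' je'] dz'] := P'.
have [g [gj gz] _] := univ _ _ _ rel'; have [g' [gj' gz'] _] := univ' _ _ _ rel.
have gK : cancel g g'.
  apply: (@uz_alg_ext _ _ _ _ P _ (g' \o g) idfun) => [r|] /=; by rewrite ?gj ?gj' ?gz ?gz'.
have gK' : cancel g' g.
  apply: (@uz_alg_ext _ _ _ _ P' _ (g \o g') idfun) => [r|] /=; by rewrite ?gj ?gj' ?gz ?gz'.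
exists g; last by exists g'.
split.
  apply: (@uz_alg_ext _ _ _ _ P _ (comul \o g) (tmap g g \o comul)) => [r|] /=.
    by rewrite gj jD jD' tmap_comp; apply: eq_tmap => y; rewrite /= gj.
  rewrite gz dz dz' !linearD /= !tmap_tens /= rmorph1 gz tmap_comp.
  by congr (_ + _); apply: eq_tmap => y; rewrite /= gj.
apply: (@uz_alg_ext _ _ _ _ P _ (counit \o g) counit) => [r|] /=.
  by rewrite gj je je'.
rewrite gz; have e := uz_counit P D2; have e' := uz_counit P' D2.
exact: etrans e' (esym e).
Qed.

End Presentation.

Section Transport.
Context {K : fieldType} {p n : nat} (charK : p \in [pchar K]).
Context {T : abelian_type K p n} (z : type_g T) (lambda : K).
Hypothesis z_rpow : rpow z = lambda *: z.
Context (U : restricted_env (type_h T)) (rhoU : {linear U -> U}).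
Hypothesis rhoU_ext : rho_extension z rhoU.
Local Notation h := (type_h T).
Local Notation iota := (env_in U).
Local Notation Uplus := (augmentation_ideal U).
Local Notation Phi1 := (Phi1 lambda rhoU).

Lemma env_functor (f : {linear h -> h}) : (forall a, f (rpow a) = rpow (f a)) ->
  exists F : {lrmorphism U -> U}, forall a, F (iota a) = iota (f a).
Proof.
move=> fr; have [ip ic] := env_inP U.
have fl : linear (fun a => iota (f a)) by move=> c a b; rewrite !linearP.
have rm : restricted_morphism (mklin fl).
  by split=> [a|a b] /=; rewrite ?fr ?ip // ic.
by have [F FE _] := env_univ U rm; exists F.
Qed.

Definition aut_mul (psi phi : K * 'End(h)) : K * 'End(h) :=
  (psi.1 * phi.1, (psi.2 \o phi.2)%VF).

Lemma Aut_mul psi phi : Aut_type z lambda psi -> Aut_type z lambda phi ->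
  Aut_type z lambda (aut_mul psi phi).
Proof.
case=> [[g0 gl] gb gr grho] [[g0' gl'] gb' gr' grho']; split=> /=.
- split; first by rewrite mulf_neq0.
  by rewrite exprMn -[LHS]mulrA gl' mulrCA gl mulrCA mulrA.
- apply: (@eq_bij _ _ (psi.2 \o phi.2)); first exact: bij_comp.
  by move=> a; rewrite lfunE.
- by move=> a; rewrite !lfunE /= gr' gr.
- by move=> a; rewrite !lfunE /= grho grho' linearZ scalerA.
Qed.

Lemma Aut_one : Aut_type z lambda (1, \1%VF).
Proof.
split=> /=.
- by rewrite expr1n oner_neq0.
- by exists id => a; rewrite lfunE.
- by move=> a; rewrite !lfunE.
- by move=> a; rewrite !lfunE scale1r.
Qed.

Lemma Aut_inv phi : Aut_type z lambda phi -> exists2 psi, Aut_type z lambda psi &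
  [/\ psi.1 * phi.1 = 1, cancel phi.2 psi.2 & cancel psi.2 phi.2].
Proof.
case=> [[g0 gl] [f fK fK'] gr grho].
have fl : linear f by move=> c a b; apply: (can_inj fK); rewrite fK' linearP /= !fK'.
pose psi2 : 'End(h) := linfun (mklin fl).
have psiE a : psi2 a = f a by rewrite lfunE.
exists (phi.1^-1, psi2); last first.
  by split=> [|a|a] /=; rewrite ?psiE ?fK ?fK' ?mulVf.
split=> /=.
- split; first by rewrite invr_neq0.
  apply: (mulfI (expf_neq0 p g0)); rewrite mulrA exprVn mulfV ?expf_neq0 // mul1r.
  by rewrite [_^-1 * _]mulrC mulrA gl mulrC mulKf.
- by exists phi.2 => a; rewrite psiE ?fK ?fK'.
- by move=> a; apply: (can_inj fK); rewrite gr !psiE !fK'.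
- move=> a; apply: (can_inj fK); rewrite linearZ /= !psiE fK'.
  apply: (scalerI g0); rewrite scalerA mulfV // scale1r.
  by rewrite -[in RHS](fK' a) grho.
Qed.

(** An automorphism followed by a change of representative, as one operation on data. *)
Definition transport (phi : K * 'End(h)) (F : {lrmorphism U -> U}) (s : U)
    (D : datum U) : datum U :=
  (phi.1 ^+ p *: F D.1 + Phi1 s, phi.1 *: tmap F F D.2 + cobar1 s).

Definition transported (D D' : datum U) : Prop :=
  exists phi (F : {lrmorphism U -> U}) s,
    [/\ Aut_type z lambda phi, forall a, F (iota a) = iota (phi.2 a), s \in Uplus &
        D' = transport phi F s D].

(** Transports are invertible: (phi, s) is undone by the inverse automorphism psi together with -
    psi.1 G(s). *)
Lemma transport_inv phi (F : {lrmorphism U -> U}) s : Aut_type z lambda phi ->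
  (forall a, F (iota a) = iota (phi.2 a)) ->
  exists psi (G : {lrmorphism U -> U}),
   [/\ Aut_type z lambda psi, forall a, G (iota a) = iota (psi.2 a),
       psi.1 * phi.1 = 1, cancel F G /\ cancel G F &
       forall D, transport psi G (- (psi.1 *: G s)) (transport phi F s D) = D].
Proof.
move=> A FE; have [psi B [e1 cK cK']] := Aut_inv A.
have [_ _ psir _] := B; have [G G_ext] := @env_functor psi.2 psir.
have GE a : G (iota a) = iota (psi.2 a) by apply: G_ext.
have FK : cancel F G.
  apply: (@env_alg_ext _ _ _ U _ (G \o F) idfun) => a /=.
  by rewrite FE GE cK.
have GK : cancel G F.
  apply: (@env_alg_ext _ _ _ U _ (F \o G) idfun) => a /=.
  by rewrite GE FE cK'.
exists psi, G; split=> // -[D1 D2]; rewrite /transport /=; congr (_, _).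
  rewrite (Phi1N charK) (Phi1_equivariant charK rhoU_ext s B GE).
  rewrite linearD scalerDr linearZ_LR /= FK scalerA -exprMn e1 expr1n scale1r.
  by rewrite addrK.
rewrite linearN linearZ_LR /= (cobar1_hopf _ (ext_hopf GE)).
rewrite linearD scalerDr linearZ_LR /= scalerA e1 scale1r tmap_comp addrK.
by rewrite -[RHS]tmap_id; apply: eq_tmap => y /=; rewrite FK.
Qed.

Lemma aug_ext (f : h -> h) (F : {lrmorphism U -> U}) s :
  (forall a, F (iota a) = iota (f a)) -> s \in Uplus -> F s \in Uplus.
Proof.
move=> FE /augmentation_idealP es; apply/augmentation_idealP.
by have [_ ->] := ext_hopf FE.
Qed.

Lemma transport_comp phi psi (F G : {lrmorphism U -> U}) s t D :
  Aut_type z lambda psi -> (forall a, G (iota a) = iota (psi.2 a)) ->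
  transport psi G t (transport phi F s D) =
  transport (aut_mul psi phi) (G \o F) (psi.1 *: G s + t) D.
Proof.
move=> B GE; rewrite /transport /=; congr (_, _).
  rewrite (Phi1D charK) (Phi1_equivariant charK rhoU_ext s B GE).
  have -> : G (phi.1 ^+ p *: F D.1 + Phi1 s) = phi.1 ^+ p *: G (F D.1) + G (Phi1 s).
    exact: linearP.
  by rewrite scalerDr scalerA -exprMn -addrA.
have -> : cobar1 (psi.1 *: G s + t) = psi.1 *: cobar1 (G s) + cobar1 t by exact: linearP.
rewrite (cobar1_hopf _ (ext_hopf GE)).
have -> : tmap G G (phi.1 *: tmap F F D.2 + cobar1 s) =
    phi.1 *: tmap G G (tmap F F D.2) + tmap G G (cobar1 s) by exact: linearP.
by rewrite scalerDr scalerA tmap_comp -addrA.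
Qed.

Lemma transported_trans D D' D'' :
  transported D D' -> transported D' D'' -> transported D D''.
Proof.
case=> phi [F [s [A FE sU ->]]] [psi [G [t [B GE tU ->]]]].
exists (aut_mul psi phi), (G \o F), (psi.1 *: G s + t); split.
- exact: Aut_mul.
- by move=> a /=; rewrite FE GE !lfunE.
- by rewrite rpredD ?rpredZ // (aug_ext GE).
- exact: transport_comp.
Qed.

(* The new generator is [gamma z - s], the new copy of [u(h)] is [j F^-1].    *)
Lemma relations_transport (B : algType K) (f : {lrmorphism U -> B}) b D phi
    (F G : {lrmorphism U -> U}) s :
  Aut_type z lambda phi -> (forall a, F (iota a) = iota (phi.2 a)) ->
  cancel F G -> cancel G F -> datum_relations lambda rhoU f b D ->
  datum_relations lambda rhoU (f \o G) (phi.1 *: b - f (G s)) (transport phi F s D).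
Proof.
move=> A FE FK GK [r1 r2]; have [[g0 gl] _ _ _] := A.
have Grho r : phi.1 *: rhoU (G r) = G (rhoU r).
  apply: (can_inj FK); rewrite GK linearZ_LR /= -(rho_equivariant rhoU_ext A FE).
  by rewrite GK.
have rel r : phi.1 *: b * f (G r) - f (G r) * (phi.1 *: b) = f (G (rhoU r)).
  by rewrite -scalerAl -scalerAr -scalerBr r1 -linearZ_LR Grho.
split=> [r /=|].
  have cm : f (G s) * f (G r) = f (G r) * f (G s) by rewrite -!rmorphM env_mulC.
  by rewrite mulrBl mulrBr cm opprB addrA subrK rel.
rewrite -(rmorphN f) -(rmorphN G).
rewrite (skew_pow charK (g := f \o G) (b := phi.1 *: b) (d := rhoU) (- s) (@env_mulC _ _ _ U) rel) /=.
have bp : b ^+ p = lambda *: b - f D.1.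
  by apply/eqP; rewrite -subr_eq0 opprB addrA addrAC; apply/eqP.
have Xs : (- s) ^+ p + iter p.-1 rhoU (- s) = - Phi1 s - lambda *: s.
  rewrite -(Phi1N charK) /Defs.Phi1 /Phi_op scalerN opprK.
  by rewrite [RHS]addrAC addrK.
have fGD u v : f (G (u + v)) = f (G u) + f (G v) by apply: (raddfD (f \o G)).
have fGN u : f (G (- u)) = - f (G u) by apply: (raddfN (f \o G)).
have fGZ c u : f (G (c *: u)) = c *: f (G u) by apply: (linearZ_LR (f \o G)).
rewrite /transport /=; move: (Phi1 s) Xs => w Xs.
rewrite exprZn bp Xs !fGD !fGN !fGZ FK.
rewrite scalerBr scalerDr scalerN !scalerA gl [phi.1 * lambda]mulrC.
set e := (lambda * phi.1) *: b; set d := lambda *: f (G s).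
set c := f (G w); set a := phi.1 ^+ p *: f D.1.
rewrite -[- c - d]opprD [X in X + _ = _]addrAC [e - a]addrC [c + d]addrC.
by rewrite addrKA opprK addrKA -opprD addNr.
Qed.

(** The Hopf algebra stays the same and only its presentation changes; the universal property for
    the new generators follows from the old one through the inverse transport. *)
Lemma is_uz_transport D D' H : transported D D' ->
  is_uz lambda rhoU D H -> is_uz lambda rhoU D' H.
Proof.
case=> phi [F [s [A FE sU ->]]] [j [zeta [rel univ jh dz]]].
have [psi [G [B GE e1 [FK GK] inv]]] := transport_inv s A FE.
have rel' := relations_transport s A FE FK GK rel.
exists (j \o G), (phi.1 *: zeta - j (G s)); split=> //.
- move=> S f b rb.
  have := relations_transport (- (psi.1 *: G s)) B GE GK FK rb; rewrite inv => rb'.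
  have [g [gj gz] gu] := univ _ _ _ rb'.
  have fFN u : f (F (- u)) = - f (F u) by apply: (raddfN (f \o F)).
  have fFZ c u : f (F (c *: u)) = c *: f (F u) by apply: (linearZ_LR (f \o F)).
  have fF : psi.1 *: b - f (F (- (psi.1 *: G s))) = psi.1 *: (b + f s).
    by rewrite scalerDr fFN fFZ GK opprK.
  have g0 : phi.1 * psi.1 = 1 by rewrite mulrC.
  exists g.
    split=> [r|]; first by rewrite /= gj /= GK.
    rewrite raddfB /= linearZ_LR /= gz gj /= GK fF scalerA g0 scale1r addrK //.
  move=> g' [gj' gz']; apply: gu; split=> [r|].
    by rewrite /= -gj' /= FK.
  have g'E : g' (phi.1 *: zeta - j (G s)) = phi.1 *: g' zeta - g' (j (G s)).
    by rewrite raddfB /= linearZ_LR.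
  rewrite /= fFN fFZ GK opprK -gz' g'E -(gj' s) /=.
  by rewrite scalerBr scalerA e1 scale1r subrK.
- have [jD je] := jh; have [GD Ge] := ext_hopf GE.
  split=> r /=; last by rewrite je Ge.
  by rewrite jD GD tmap_comp.
have [jD je] := jh; have [GD Ge] := ext_hopf GE.
have DjG u : comul (j (G u)) = tmap (j \o G) (j \o G) (comul u).
  by rewrite jD GD tmap_comp.
rewrite linearB linearZ_LR /= dz DjG.
have -> : tmap (j \o G) (j \o G) (phi.1 *: tmap F F D.2 + cobar1 s) =
    phi.1 *: tmap j j D.2 + (tens 1 (j (G s)) - tmap (j \o G) (j \o G) (comul s)
      + tens (j (G s)) 1).
  rewrite linearP /= tmap_comp /cobar1 !raddfD raddfN /= !tmap_tens /= !rmorph1.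
  congr (_ *: _ + _); apply: eq_tmap => y /=; by rewrite FK.
rewrite !scalerDr tensDl tensDr tensNl tensNr tensZl tensZr.
set t1 := phi.1 *: tens zeta 1; set t2 := phi.1 *: tens 1 zeta.
set t3 := phi.1 *: _; set u1 := tens _ 1; set u2 := tens 1 _; set u3 := tmap _ _ _.
rewrite [X in _ = X + _]addrACA -[X in _ = _ + X + _]opprD.
rewrite -!addrA; congr (_ + (_ + _)); rewrite [RHS]addrCA; congr (_ + _).
by rewrite [- u3 + u1]addrC [u2 + _]addrA [u2 + u1]addrC addKr.
Qed.

End Transport.

(** * The Poincare-Birkhoff-Witt basis *)

Section QuotientCoaction.
Context {K : fieldType} {p n : nat} (charK : p \in [pchar K]).
Context {T : abelian_type K p n} (z : type_g T) (lambda : K).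
Context (U : restricted_env (type_h T)) (rhoU : {linear U -> U}).
Hypothesis rhoU_ext : rho_extension z rhoU.
Local Notation Uplus := (augmentation_ideal U).

Let p_gt1 : (1 < p)%N := prime_gt1 (pcharf_prime charK).
Let p_gt0 : (0 < p)%N := prime_gt0 (pcharf_prime charK).

(** The quotient of k[X] by this polynomial models u(g), onto which u_z(D) maps when u(h) is
    collapsed by its counit. *)
Definition uT_poly : {poly K} := 'X^p - lambda *: 'X.

Lemma size_uT_poly : size uT_poly = p.+1.
Proof.
rewrite size_polyDl size_polyXn // size_polyN (leq_ltn_trans (size_scale_leq _ _)) //.
by rewrite size_polyX.
Qed.

Lemma mk_monic_uT : mk_monic uT_poly = uT_poly.
Proof.
rewrite /mk_monic size_uT_poly ltnS p_gt0 /=.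
suff -> : uT_poly \is monic by [].
rewrite monicE lead_coefDl ?lead_coefXn // size_polyN size_polyXn.
by rewrite (leq_ltn_trans (size_scale_leq _ _)) // size_polyX.
Qed.

Lemma coef_rmod_mulX (q : {poly K}) l : (size q <= p)%N -> (l < p)%N ->
  (Pdiv.CommonRing.rmodp (Pdiv.CommonRing.rmodp 'X (mk_monic uT_poly) * q)
     (mk_monic uT_poly))`_l =
  (if l is l'.+1 then q`_l' else 0) + lambda * q`_p.-1 *+ (l == 1%N).
Proof.
move=> sr lp.
rewrite mk_monic_uT [Pdiv.CommonRing.rmodp 'X _]Pdiv.CommonRing.rmodp_small; last first.
  by rewrite size_polyX size_uT_poly ltnS.
set c := q`_p.-1.
have E : 'X * q = c%:P * uT_poly + ('X * q - c%:P * uT_poly).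
  by rewrite addrC subrK.
have sm : (size ('X * q - c%:P * uT_poly)%R < size uT_poly)%N.
  rewrite size_uT_poly ltnS; apply/leq_sizeP => i pi.
  rewrite coefB coefCM mulrC coefMX coefB coefXn coefZ coefX.
  have i0 : (i == 0)%N = false by rewrite gtn_eqF // (leq_trans p_gt0).
  rewrite i0; have i1 : (i == 1)%N = false by rewrite gtn_eqF // (leq_trans p_gt1).
  rewrite i1 mulr0 subr0; case: eqVneq => [->|ip]; first by rewrite mulr1 subrr.
  rewrite mulr0 subr0 nth_default // (leq_trans sr) // -ltnS prednK ?(leq_trans p_gt0) //.
  by rewrite ltn_neqAle eq_sym ip.
have mQ : uT_poly \is monic.
  by rewrite -mk_monic_uT monic_mk_monic.
rewrite [X in Pdiv.CommonRing.rmodp X _]E Pdiv.RingMonic.rmodpD // Pdiv.RingMonic.rmodp_mull // add0r.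
rewrite Pdiv.CommonRing.rmodp_small // coefB coefCM mulrC coefMX coefB coefXn coefZ coefX.
rewrite (ltn_eqF lp) sub0r mulrN opprK; congr (_ + _); first by case: l lp.
by rewrite mulrCA mulr_natr mulrnAr.
Qed.

Lemma coef_mulX_uT (r : {poly %/ uT_poly}) l : (l < p)%N ->
  (val (in_qpoly uT_poly 'X * r))`_l =
  (if l is l'.+1 then (val r)`_l' else 0) + lambda * (val r)`_p.-1 *+ (l == 1%N).
Proof.
apply: coef_rmod_mulX; rewrite -ltnS; apply: leq_trans (size_mk_monic r) _.
by rewrite mk_monic_uT size_uT_poly.
Qed.

Section Coaction.
Context (D : datum U) (H : hopfType K) (j : {lrmorphism U -> H}) (zeta : H).
Hypothesis P : uz_presented lambda rhoU D j zeta.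
Hypothesis D1 : D.1 \in Uplus.
Hypothesis D2 : D.2 \in tens_square Uplus.

(** The assignment u -> counit(u), z -> X respects the relations because the counit kills both the
    image of rho and Theta. *)
Lemma quotient_exists : exists pi : {lrmorphism H -> {poly %/ uT_poly}},
  (forall u, pi (j u) = (counit u : K)%:A) /\ pi zeta = in_qpoly uT_poly 'X.
Proof.
have [_ univ _ _] := P.
have fl : linear (fun u : U => (counit u : K)%:A : {poly %/ uT_poly}).
  by move=> c u v; rewrite linearP /= scalerDl -scalerA.
have f1 : (counit (1 : U) : K)%:A = 1 :> {poly %/ uT_poly} by rewrite counit1 scale1r.
have fM (u v : U) : (counit (u * v) : K)%:A =
    (counit u : K)%:A * (counit v : K)%:A :> {poly %/ uT_poly}.
  by rewrite rmorphM /= -scalerAl mul1r scalerA.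
have [|pi [pij piz] _] := univ _ (mkalg fl f1 fM) (in_qpoly uT_poly 'X); last by exists pi.
split=> [r|] /=.
  by rewrite mulrC subrr (counit_rho rhoU_ext) scale0r.
move/augmentation_idealP: D1 => ->; rewrite scale0r addr0.
rewrite -rmorphXn -linearZ_LR -rmorphB; apply: val_inj => /=.
by rewrite mk_monic_uT Pdiv.Ring.rmodpp //; apply: mulrC.
Qed.

Variable pi : {lrmorphism H -> {poly %/ uT_poly}}.
Hypothesis pij : forall u, pi (j u) = (counit u : K)%:A.
Hypothesis piz : pi zeta = in_qpoly uT_poly 'X.

Definition qcoef l (y : H) : K^o := (val (pi y))`_l.

Lemma qcoef_linear l : linear (qcoef l).
Proof.
move=> c u v; rewrite /qcoef linearP.
have -> : val (c *: pi u + pi v) = c *: val (pi u) + val (pi v) :> {poly K} by [].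
by rewrite coefD coefZ.
Qed.

HB.instance Definition _ l := GRing.isLinear.Build K H K^o *:%R (qcoef l) (qcoef_linear l).

Lemma qcoef_j l u y : qcoef l (j u * y) = counit u * qcoef l y.
Proof.
rewrite /qcoef; have -> : pi (j u * y) = (counit u : K)%:A * pi y by rewrite rmorphM /= pij.
rewrite -scalerAl mul1r.
have -> : val ((counit u : K) *: pi y) = (counit u : K) *: val (pi y) :> {poly K} by [].
by rewrite coefZ.
Qed.

Lemma qcoef_zeta l y : (l < p)%N -> qcoef l (zeta * y) =
  (if l is l'.+1 then qcoef l' y else 0) + (lambda * qcoef p.-1 y) *+ (l == 1%N).
Proof.
move=> lp; rewrite /qcoef.
have -> : pi (zeta * y) = in_qpoly uT_poly 'X * pi y by rewrite rmorphM /= piz.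
by rewrite coef_mulX_uT.
Qed.

Lemma qcoef1 l : qcoef l 1 = (l == 0)%:R.
Proof. by rewrite /qcoef rmorph1 /= coefC; case: l. Qed.

Definition rpair (q : H -> K^o) : tensor H H -> H := tlift (fun a b => (q b : K) *: a).

HB.instance Definition _ q := GRing.isLinear.Build K (tensor H H) H *:%R (rpair q)
  (tlift_linear _).

Lemma rpair_tens (q : {linear H -> K^o}) a b : rpair q (tens a b) = (q b : K) *: a.
Proof.
apply: tlift_tens => [b'|a'] c u v; first by rewrite scalerDr !scalerA mulrC.
by rewrite linearP scalerDl scalerA.
Qed.

Lemma rpair_j l t w : rpair (qcoef l) (tmap j j t * w) =
  j (counit_right t) * rpair (qcoef l) w.
Proof.
move: t; apply: tensor_ind => [c t t' e e'||a b].
- by rewrite !linearP /= mulrDl -scalerAl !linearP /= e e' mulrDl -scalerAl.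
- by rewrite !linear0 !mul0r linear0.
rewrite tmap_tens counit_right_tens linearZ_LR /= -scalerAl.
move: w; apply: tensor_ind => [c t t' e e'||a' b'].
- by rewrite mulrDr -scalerAr !linearP /= e e' mulrDr -scalerAr !scalerDr !scalerA [_ * c]mulrC.
- by rewrite mulr0 !linear0 mulr0 scaler0.
by rewrite tens_mul !rpair_tens /= qcoef_j -scalerAr scalerA.
Qed.

Lemma rpair_left a q w : rpair (qcoef q) (tens a 1 * w) = a * rpair (qcoef q) w.
Proof.
move: w; apply: tensor_ind => [c t t' e e'||a' b'].
- by rewrite mulrDr -scalerAr !linearP /= e e' mulrDr -scalerAr.
- by rewrite mulr0 !linear0 mulr0.
by rewrite tens_mul mul1r !rpair_tens scalerAr.
Qed.

Lemma rpair_zeta l w : (l < p)%N -> rpair (qcoef l) (tens 1 zeta * w) =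
  (if l is l'.+1 then rpair (qcoef l') w else 0) +
  (lambda *: rpair (qcoef p.-1) w) *+ (l == 1%N).
Proof.
move=> lp; move: w; apply: tensor_ind => [c t t' e e'||a' b'].
- rewrite mulrDr -scalerAr !linearP /= e e'.
  case: l lp {e e'} => [|l] lp; first by rewrite !mulr0n !addr0 scaler0.
  rewrite !linearP /= scalerDr addrACA; congr (_ + _).
  by rewrite mulrnDl !scalerMnr.
- by case: l lp => [|l] lp; rewrite mulr0 !linear0 ?scaler0 mul0rn addr0.
rewrite tens_mul mul1r !rpair_tens /= qcoef_zeta // scalerDl scalerA; congr (_ + _).
  by case: l lp => [|l] lp; rewrite ?rpair_tens ?scale0r.
by rewrite scalerMnl.
Qed.

(** On powers of z, pairing the right factor with the coefficient of z^l acts as the divided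
    derivative of order l. The induction is Pascal's rule: chi contributes nothing since its partial
    counit is 0, and the term coming from X^p = lambda X carries binomial(i, p-1), which is 0 for i
    < p - 1. *)
Lemma rpair_comulX l i : (l < p)%N -> (i < p)%N ->
  rpair (qcoef l) (comul (zeta ^+ i)) = zeta ^+ (i - l) *+ 'C(i, l).
Proof.
elim: i l => [|i IH] l lp ip.
  rewrite expr0 rmorph1 -tens11 rpair_tens /= qcoef1 bin0n.
  by case: l lp => [|l] _ /=; rewrite ?scale1r ?scale0r.
have [_ _ _ dz] := P; rewrite exprS rmorphM /= dz !mulrDl !linearD /=.
rewrite rpair_left rpair_zeta // rpair_j.
move/tens_square_augP: D2 => [_ ->]; rewrite linear0 mul0r addr0.
have ip' := ltnW ip; rewrite !IH // ?ltn_predL //.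
have -> : 'C(i, p.-1) = 0%N by rewrite bin_small // -ltnS prednK.
rewrite mulr0n scaler0 mul0rn addr0.
case: l lp => [|l] lp; first by rewrite !subn0 !bin0 addr0 mulrnAr exprS.
rewrite IH ?(ltnW lp) // binS subSS mulrnDr; congr (_ + _).
have [il|li] := ltnP i l.+1; first by rewrite bin_small // !mulr0n mulr0.
by rewrite mulrnAr -exprS subnSK.
Qed.

Definition pbw (f : {ffun 'I_p -> U}) : H := \sum_i j (f i) * zeta ^+ i.

Lemma pbw_linear : linear pbw.
Proof.
move=> c f g; rewrite /pbw scaler_sumr -big_split; apply: eq_bigr => i _ /=.
by rewrite !ffunE linearP /= mulrDl -scalerAl.
Qed.

HB.instance Definition _ := GRing.isLinear.Build K {ffun 'I_p -> U} H *:%R pbw pbw_linear.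

Let i0 : 'I_p := Ordinal p_gt0.
Let i1 : 'I_p := Ordinal p_gt1.

Lemma pbw_delta (i : 'I_p) u : pbw [ffun l => u *+ (l == i)] = j u * zeta ^+ i.
Proof.
rewrite /pbw (bigD1 i) //= ffunE eqxx mulr1n big1 ?addr0 // => l /negPf li.
by rewrite ffunE li mulr0n linear0 mul0r.
Qed.

(** The combinations of the u z^i contain 1 and are stable under left multiplication by u(h) and by
    z, thanks to [z, u] = rho(u) and z^p = lambda z - Theta. *)
Lemma pbw_surj : forall y, exists f, pbw f = y.
Proof.
pose Q y := exists f, pbw f = y.
have Qlin c y w : Q y -> Q w -> Q (c *: y + w).
  by move=> [f <-] [g <-]; exists (c *: f + g); rewrite linearP.
have Q0 : Q 0 by exists 0; rewrite linear0.
have QD y w : Q y -> Q w -> Q (y + w) by rewrite -{2}[y]scale1r; apply: Qlin.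
have QZ c y : Q y -> Q (c *: y) by move=> Qy; have := Qlin c y 0 Qy Q0; rewrite addr0.
have Qsum (F : 'I_p -> H) : (forall i, Q (F i)) -> Q (\sum_i F i).
  by move=> QF; apply: big_ind => // y w; apply: QD.
have Qj u f : Q (j u * pbw f).
  exists [ffun i => u * f i]; rewrite /pbw mulr_sumr; apply: eq_bigr => i _.
  by rewrite ffunE rmorphM mulrA.
have [[r1 r2] _ _ _] := P.
have Qz f : Q (zeta * pbw f).
  rewrite mulr_sumr; apply: (Qsum) => i.
  have -> : zeta * (j (f i) * zeta ^+ i) = j (rhoU (f i)) * zeta ^+ i + j (f i) * zeta ^+ i.+1.
    by rewrite -r1 mulrBl exprS !mulrA subrK.
  apply: QD; first by exists [ffun l => rhoU (f i) *+ (l == i)]; rewrite pbw_delta.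
  have [ip|pi'] := ltnP i.+1 p.
    exists [ffun l => f i *+ (l == Ordinal ip)]; exact: (pbw_delta (Ordinal ip)).
  have -> : i.+1 = p by apply/eqP; rewrite eqn_leq pi' andbT.
  have -> : zeta ^+ p = lambda *: zeta - j D.1.
    by apply/eqP; rewrite -subr_eq0 opprB addrA addrAC; apply/eqP.
  rewrite mulrBr -scalerAr -rmorphM -scaleN1r addrC; apply: Qlin.
    exists [ffun l => (f i * D.1) *+ (l == i0)]; by rewrite (pbw_delta i0) mulr1.
  apply: (QZ); exists [ffun l => f i *+ (l == i1)]; exact: (pbw_delta i1).
have QM y : forall w, Q w -> Q (y * w).
  elim/(uz_ind P): y => [w|c y y' Hy Hy' w Qw|y y' Hy Hy' w Qw|r w [f <-]|w [f <-]] //.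
  - by rewrite mul1r.
  - by rewrite mulrDl -scalerAl; apply: (Qlin); [apply: Hy|apply: Hy'].
  - by rewrite -mulrA; apply/Hy/Hy'.
move=> y; rewrite -[y]mulr1; apply: QM.
by exists [ffun l => 1 *+ (l == i0)]; rewrite (pbw_delta i0) rmorph1 mulr1.
Qed.

Hypothesis pbw_inj : injective pbw.

Lemma pbw_j_inj : injective j.
Proof.
move=> u v uv; have := pbw_inj (x1 := [ffun l => u *+ (l == i0)])
  (x2 := [ffun l => v *+ (l == i0)]).
rewrite !(pbw_delta i0) uv => /(_ erefl)/ffunP/(_ i0).
by rewrite !ffunE eqxx !mulr1n.
Qed.

Lemma pbw_indep u v c d : j u + c *: zeta = j v + d *: zeta -> u = v /\ c = d.
Proof.
have E w e : j w + e *: zeta = pbw ([ffun l => w *+ (l == i0)] + [ffun l => e%:A *+ (l == i1)]).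
  rewrite linearD /= (pbw_delta i0) (pbw_delta i1) expr0 expr1 mulr1.
  by rewrite linearZ_LR /= rmorph1 -scalerAl mul1r.
rewrite !E => /pbw_inj/ffunP e; have := e i0; have := e i1; rewrite !ffunE /=.
rewrite !mulr1n !mulr0n !add0r !addr0 => cd ->; split=> //.
by have := congr1 (fun y => counit y : K) cd; rewrite !counit_alg.
Qed.

(** For y = sum f_i z^i the operator [rpair (qcoef 1)] sends the coproduct of y to sum i f_i
    z^(i-1), by [rpair_comulX], and by hypothesis to a constant c. As the integers 1 < i < p are
    invertible, f_i = 0 for i > 1 and f_1 = c. *)
Lemma almost_primitive y chi : comul y = tens y 1 + tens 1 y + tmap j j chi ->
  exists u c, y = j u + c *: zeta.
Proof.
move=> dy; have [f fy] := pbw_surj y.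
have [_ _ [jD _] _] := P; pose c : K := qcoef 1 y.
have T1 : rpair (qcoef 1) (comul y) = c *: 1.
  rewrite dy !linearD /= !rpair_tens /= qcoef1 scale0r add0r.
  by rewrite -[tmap j j chi]mulr1 rpair_j -tens11 rpair_tens /= qcoef1 scale0r mulr0 addr0.
(* [fn] extends [f] by 0 to the index p, so that the shift from i to i + 1 is always defined. *)
pose fn i : U := \sum_(l < p | l == i :> nat) f l.
have fnE (l : 'I_p) : fn l = f l.
  rewrite /fn (bigD1 l) //= big1 ?addr0 // => i /andP[/eqP e /eqP ne].
  by case: ne; apply: val_inj.
have fnp : fn p = 0 by rewrite /fn big1 // => i /eqP ip; have := ltn_ord i; rewrite ip ltnn.
pose G i : H := (j (fn i) * zeta ^+ i.-1) *+ i.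
pose g : {ffun 'I_p -> U} := [ffun i : 'I_p => fn i.+1 *+ i.+1].
have T2 : rpair (qcoef 1) (comul y) = pbw g.
  have -> : pbw g = \sum_(i < p) G i.+1.
    by apply: eq_bigr => i _; rewrite ffunE raddfMn mulrnAl.
  transitivity (\sum_(i < p.+1) G i); last by rewrite big_ord_recl /= add0r.
  rewrite big_ord_recr /= {2}/G fnp linear0 mul0r mul0rn addr0 -fy /pbw 2!linear_sum.
  apply: eq_bigr => i _; rewrite /= rmorphM /= jD rpair_j [counit_right _]counitr.
  by rewrite rpair_comulX // bin1 subn1 /G fnE mulrnAr.
have gE : pbw g = pbw [ffun l => c%:A *+ (l == i0)].
  by rewrite -T2 T1 (pbw_delta i0) expr0 mulr1 linearZ_LR /= rmorph1.
have f_big (l : 'I_p) : (1 < l)%N -> f l = 0.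
  move=> l1; have lp : (l.-1 < p)%N by apply: leq_ltn_trans (leq_pred _) (ltn_ord l).
  have := pbw_inj gE => /ffunP/(_ (Ordinal lp)); rewrite !ffunE /=.
  rewrite prednK ?(ltnW l1) // fnE.
  have -> : (Ordinal lp == i0) = false by apply/negbTE; rewrite -val_eqE /= -lt0n -ltnS prednK ?(ltnW l1).
  rewrite mulr0n -scaler_nat => /eqP; rewrite scaler_eq0 => /orP[|/eqP //].
  by rewrite (negPf (natr_small_neq0 charK _)) // (ltnW l1) ltn_ord.
have f1 : f i1 = c%:A.
  have := pbw_inj gE => /ffunP/(_ i0); rewrite !ffunE /= !mulr1n.
  by rewrite (fnE i1).
exists (f i0), c; rewrite -fy /pbw (bigD1 i0) //= (bigD1 i1) //=.
rewrite big1 ?addr0 => [|l /andP[l0 l1]]; last first.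
  rewrite f_big ?linear0 ?mul0r //.
  by case: l l0 l1 => [[|[|l]]] //= lp; rewrite -val_eqE //.
by rewrite expr0 mulr1 expr1 f1 linearZ_LR /= rmorph1 -scalerAl mul1r.
Qed.

End Coaction.
End QuotientCoaction.

Lemma linear_left_inverse (K : fieldType) (V W : vectType K) (f : {linear V -> W}) :
  injective f -> exists r : {linear W -> V}, cancel f r.
Proof.
move=> fi; have k0 : lker (linfun f) == 0%VS by apply: linfun_lker0.
by exists (linfun f)^-1%VF => u; have := lker0_lfunK k0 u; rewrite lfunE.
Qed.

Lemma tmap_inj (K : fieldType) (V W : vectType K) (f : {linear V -> W}) :
  injective f -> injective (tmap f f).
Proof.
move=> /linear_left_inverse[r rf] s t /(congr1 (tmap r r)); rewrite !tmap_comp => st.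
have E u : u = tmap (r \o f) (r \o f) u.
  by rewrite -[LHS]tmap_id; apply: eq_tmap => y; rewrite /= rf.
by rewrite (E s) (E t).
Qed.

(** * Consequences of being a PD datum; isomorphisms are transports *)

Section PDFacts.
Context {K : closedFieldType} {p n : nat} (charK : p \in [pchar K]).
Context {T : abelian_type K p n} (z : type_g T) (lambda : K).
Hypothesis z_rpow : rpow z = lambda *: z.
Context (U : restricted_env (type_h T)) (rhoU : {linear U -> U}).
Hypothesis rhoU_ext : rho_extension z rhoU.
Local Notation h := (type_h T).
Local Notation iota := (env_in U).

Let p_gt0 : (0 < p)%N := prime_gt0 (pcharf_prime charK).

Lemma basis_exists : exists x : n.-tuple h, basis_of fullv x.
Proof.
have := vbasisP {: h}; move: (vbasis _); rewrite dim_type_h => x xb.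
by exists x.
Qed.

Lemma dim_U : dim U = (p ^ n)%N.
Proof.
have [x xb] := basis_exists; have [th thP] := dual_basis charK U xb.
exact: (dim_env charK xb thP).
Qed.

Definition prims_of_h (H : hopfType K) (j : {lrmorphism U -> H}) :=
  forall y, comul y = tens y 1 + tens 1 y -> exists a, y = j (iota a).

(** [pbw] is surjective between spaces of dimension p^(n+1), hence injective, and so is j. The
    primitives are given only as abstractly isomorphic to h; they contain j(h), and both have
    dimension n. *)
Lemma PD_presentation D : PD_datum lambda rhoU D ->
  exists (H : hopfType K) (j : {lrmorphism U -> H}) (zeta : H),
  [/\ uz_presented lambda rhoU D j zeta, injective (@pbw K p n T U H j zeta),
      prims_of_h j, class_X p n H & is_uz lambda rhoU D H].
Proof.
case=> D1 D2 [H [[j [zeta P]] conn dH [f [[fr fc] fi fP]]]].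
have Hj := @pbw_j_inj K p n charK T U H j zeta.
exists H, j, zeta.
have pi_ : injective (@pbw K p n T U H j zeta).
  apply: (linear_surj_inj (f := @pbw K p n T U H j zeta)) => [y|].
    exact: (pbw_surj charK P).
  have -> : dim {ffun 'I_p -> U} = (p * dim U)%N by rewrite /dim /= card_ord.
  by rewrite dim_U -expnS -dH dimvf.
have ji := Hj pi_.
have dim_prims : \dim (primitives H) = n.
  have -> : primitives H = limg (linfun f).
    apply/vspaceP => y; apply/idP/memv_imgP => [/fP[a ->]|[a _ ->]].
      by exists a; rewrite ?memvf ?lfunE.
    by rewrite lfunE; apply/fP; exists a.
  by rewrite limg_dim_eq ?(eqP (linfun_lker0 fi)) ?capv0 // (dim_type_h T).
have [_ _ [jD je] _] := P.
split=> //; last by exists j, zeta.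
  move=> y /primitivesP yP.
  have jil : linear (fun a => j (iota a)) by move=> c a b; rewrite !linearP.
  pose g := linfun (mklin jil).
  have gE a : g a = j (iota a) by rewrite lfunE.
  have gi : lker g == 0%VS.
    by apply: linfun_lker0 => a b /= /ji; apply: (env_in_inj charK).
  have sub : (limg g <= primitives H)%VS.
    apply/subvP => w /memv_imgP[a _ ->]; apply/primitivesP.
    by rewrite gE jD env_in_prim linearD /= !tmap_tens /= !rmorph1.
  have : (limg g == primitives H)%VS.
    by rewrite eqEdim sub dim_prims limg_dim_eq ?(eqP gi) ?capv0 // (dim_type_h T) leqnn.
  move/eqP => eqg; move: yP; rewrite -eqg => /memv_imgP[a _ ->].
  by exists a; rewrite gE.
split=> // x y /fP[a ->] /fP[b ->]; exact: fc.
Qed.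

(** Each condition is read off in u_z(D) and pulled back along the injective j: Theta = lambda z -
    z^p commutes with z, coassociativity at z is the cocycle equation, and computing the coproduct
    of z^p in two ways gives Phi(chi) = d^1(Theta). *)
Lemma PD_theta D : PD_datum lambda rhoU D ->
  [/\ rhoU D.1 = 0, cocycle2 D.2 & Phi2 lambda rhoU D.2 = cobar1 D.1].
Proof.
move=> PD; have [D1 D2 _] := PD.
have [H [j [zeta [P inj prims cX uz]]]] := PD_presentation PD.
have ji : injective j := pbw_j_inj charK inj.
have [[r1 r2] _ [jD je] dz] := P.
have zp : zeta ^+ p = lambda *: zeta - j D.1.
  by apply/eqP; rewrite -subr_eq0 opprB addrA addrAC; apply/eqP.
have [r rj] := linear_left_inverse ji.
split.
- apply: ji; rewrite linear0 -r1.
  have -> : j D.1 = lambda *: zeta - zeta ^+ p by rewrite zp opprB addrC subrK.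
  by rewrite mulrBr mulrBl -exprS -exprSr -scalerAr -scalerAl subrr.
- have rjt t : tmap r (tmap r r) (tmap j (tmap j j) t) = t.
    rewrite tmap_comp -[RHS]tmap_id; apply: eq_tmap => y /=; first exact: rj.
    by rewrite tmap_comp -[RHS]tmap_id; apply: eq_tmap => w /=; apply: rj.
  have := comulA zeta; rewrite (zeta_coassoc_l jD dz) (zeta_coassoc_r jD dz).
  by move=> /addrI/(congr1 (tmap r (tmap r r))); rewrite !rjt.
have dzp : comul (zeta ^+ p) = comul (lambda *: zeta - j D.1) by rewrite zp.
move: dzp; rewrite rmorphXn /= dz (zeta_coprod_pow charK r1) linearB linearZ_LR /= dz jD zp.
rewrite tensDl tensDr tensNl tensNr tensZl tensZr !scalerDr => E.
apply: (tmap_inj ji).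
have -> : tmap j j (Phi2 lambda rhoU D.2) =
    tmap j j (D.2 ^+ p + iter p.-1 (rhoU2 rhoU) D.2) - lambda *: tmap j j D.2.
  by rewrite /Phi2 /Phi_op addrAC linearB linearZ_LR.
have -> : tmap j j (cobar1 D.1) = tens 1 (j D.1) - tmap j j (comul D.1) + tens (j D.1) 1.
  by rewrite /cobar1 linearD linearB /= !tmap_tens /= !rmorph1.
move: E; set a := lambda *: tens zeta 1; set b := lambda *: tens 1 zeta.
set t1 := tens (j D.1) 1; set t2 := tens 1 (j D.1); set c := lambda *: _.
set X := tmap j j (_ + _); set w := tmap j j _ => E.
apply: (addrI (a - t1 + (b - t2))); rewrite addrA E.
rewrite [LHS]addrAC addrK [X in _ = X + _]addrACA -opprD.
by rewrite [t2 - w + t1]addrAC [t2 + t1]addrC addrA subrK.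
Qed.

(** An isomorphism f maps primitives to primitives, which defines phi_2, and f(z) is primitive up to
    a term in u(h) (x) u(h), so f(z) = s_0 + c z' by [almost_primitive]. The commutators, the p-th
    power and the coproduct of f(z) give the conditions on (c^(-1), phi_2) and the two components of
    the transport. *)
Lemma iso_transported D D' H H' : PD_datum lambda rhoU D -> PD_datum lambda rhoU D' ->
  is_uz lambda rhoU D H -> is_uz lambda rhoU D' H' -> hopf_iso H H' ->
  transported z lambda rhoU D D'.
Proof.
move=> PD PD' uzH uzH' HH'; have [D1 D2 _] := PD; have [D1' D2' _] := PD'.
have [H0 [j [zeta [P inj prims _ uz0]]]] := PD_presentation PD.
have [H0' [j' [zeta' [P' inj' prims' _ uz0']]]] := PD_presentation PD'.
have {uzH uzH' HH'} [f [fD fe] /lrmorphism_inverse[g fK gK]] : hopf_iso H0 H0'.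
  apply: hopf_iso_trans (uz_unique D2 uz0 uzH) _.
  exact: hopf_iso_trans HH' (uz_unique D2' uzH' uz0').
have ji : injective j := pbw_j_inj charK inj.
have ji' : injective j' := pbw_j_inj charK inj'.
have ii := env_in_inj charK (U := U).
have [[r1 r2] _ [jD je] dz] := P; have [[r1' r2'] _ [jD' je'] dz'] := P'.
have [pi [pij piz]] := quotient_exists charK rhoU_ext P D1.
have [pi' [pij' piz']] := quotient_exists charK rhoU_ext P' D1'.
have gD y : comul (g y) = tmap g g (comul y).
  rewrite -{2}[y]gK fD tmap_comp -[LHS]tmap_id.
  by apply: eq_tmap => w /=; rewrite fK.
have dprim a : comul (j (iota a)) = tens (j (iota a)) 1 + tens 1 (j (iota a)).
  by rewrite jD env_in_prim linearD /= !tmap_tens /= !rmorph1.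
have dprim' a : comul (j' (iota a)) = tens (j' (iota a)) 1 + tens 1 (j' (iota a)).
  by rewrite jD' env_in_prim linearD /= !tmap_tens /= !rmorph1.
have [phi2 phi2E] : exists phi2 : h -> h, forall a, j' (iota (phi2 a)) = f (j (iota a)).
  have ex a : exists b, f (j (iota a)) = j' (iota b).
    by apply: prims'; rewrite fD dprim linearD /= !tmap_tens /= !rmorph1.
  by exists (fun a => projT1 (cid (ex a))) => a; case: cid.
have [psi2 psi2E] : exists psi2 : h -> h, forall a, j (iota (psi2 a)) = g (j' (iota a)).
  have ex a : exists b, g (j' (iota a)) = j (iota b).
    by apply: prims; rewrite gD dprim' linearD /= !tmap_tens /= !rmorph1.
  by exists (fun a => projT1 (cid (ex a))) => a; case: cid.
have phi2K : cancel phi2 psi2.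
  by move=> a; apply/ii/ji; rewrite psi2E phi2E fK.
have psi2K : cancel psi2 phi2.
  by move=> a; apply/ii/ji'; rewrite phi2E psi2E gK.
have phi2l : linear phi2.
  by move=> c a b; apply/ii/ji'; rewrite phi2E !linearP /= !phi2E.
have phi2r a : phi2 (rpow a) = rpow (phi2 a).
  have [ip _] := env_inP U.
  by apply/ii/ji'; rewrite phi2E !ip !rmorphXn /= phi2E.
have [F F_ext] := env_functor U (f := mklin phi2l) phi2r.
have FE a : F (iota a) = iota (phi2 a) by apply: F_ext.
have fj u : f (j u) = j' (F u).
  apply: (@env_alg_ext _ _ _ U _ (f \o j) (j' \o F)) => a /=.
  by rewrite FE phi2E.
have [_ Fe] := ext_hopf FE.
have [s0 [c fz]] : exists s0 c, f zeta = j' s0 + c *: zeta'.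
  apply: (almost_primitive charK P' D2' pij' piz' inj' (chi := tmap F F D.2)).
  rewrite fD dz !linearD /= !tmap_tens /= !rmorph1 !tmap_comp; congr (_ + _).
  by apply: eq_tmap => y /=; rewrite fj.
have es0 : counit s0 = 0 :> K.
  have e1 : counit (f zeta) = 0 :> K by rewrite fe; apply: (uz_counit P D2).
  have e2 : counit zeta' = 0 :> K := uz_counit P' D2'.
  by move: e1; rewrite fz linearD /= counitZ e2 mulr0 addr0 je'.
have psi2l : linear psi2.
  by move=> e a b; apply: (can_inj phi2K); rewrite psi2K phi2l !psi2K.
have psi2r a : psi2 (rpow a) = rpow (psi2 a).
  by apply: (can_inj phi2K); rewrite psi2K phi2r psi2K.
have [G G_ext] := env_functor U (f := mklin psi2l) psi2r.
have GK u : F (G u) = u.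
  apply: (@env_alg_ext _ _ _ U _ (F \o G) idfun) => a /=.
  by rewrite -[RHS](congr1 iota (psi2K a)) -FE; congr (F _); apply: G_ext.
(* With c = 0 the generator z would lie in j(u(h)), against [pbw_indep]. *)
have c0 : c != 0.
  apply/eqP => c0; have zE : zeta = j (G s0).
    by apply: (can_inj fK); rewrite fz c0 scale0r addr0 fj GK.
  have /(pbw_indep charK inj)[_ /eqP] : j 0 + 1 *: zeta = j (G s0) + 0 *: zeta.
    by rewrite linear0 add0r scale1r scale0r addr0.
  by rewrite oner_eq0.
have relF r : c *: rhoU (F r) = F (rhoU r).
  apply: ji'; rewrite -fj -r1 rmorphB !rmorphM /= fz fj linearZ_LR /= -r1'.
  rewrite mulrDl mulrDr -!rmorphM (env_mulC s0) opprD addrACA subrr add0r.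
  by rewrite -scalerAl -scalerAr -scalerBr.
have rel' r : (c *: zeta') * j' r - j' r * (c *: zeta') = j' (c *: rhoU r).
  by rewrite -scalerAl -scalerAr -scalerBr r1' linearZ_LR.
have zp (L : algType K) (b e : L) : b ^+ p - lambda *: b + e = 0 -> b ^+ p = lambda *: b - e.
  by move=> be; apply/eqP; rewrite -subr_eq0 opprB addrA addrAC; apply/eqP.
have pE := skew_pow charK s0 (@env_mulC _ _ _ U) rel'.
have : f zeta ^+ p = lambda *: f zeta - j' (F D.1).
  by rewrite -rmorphXn /= (zp _ _ _ r2) raddfB /= linearZ_LR /= fj.
rewrite fz addrC pE exprZn (zp _ _ _ r2') iter_scale => E.
(* The two expressions for f(z)^p are compared in u(h) and at the coefficient of z'. *)
have [E1 E2] : s0 ^+ p + c ^+ p.-1 *: iter p.-1 rhoU s0 - c ^+ p *: D'.1 = lambda *: s0 - F D.1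
    /\ c ^+ p * lambda = lambda * c.
  apply: (pbw_indep charK inj').
  have jB u v : j' (u - v) = j' u - j' v by apply: raddfB.
  have jZ e u : j' (e *: u) = e *: j' u by apply: linearZ_LR.
  rewrite !jB !jZ; move: E; rewrite scalerBr scalerDr !scalerA => E.
  rewrite addrAC [X in X - _ = _]addrC addrAC E addrAC.
  by rewrite [LHS]addrC addrA addrAC.
(* The scalar is inverted because D' is expressed through D: the coproducts give c chi' = phi_2(chi)
   + d^1(s_0). *)
pose phi : K * 'End(h) := (c^-1, linfun (mklin phi2l)).
have phiE a : phi.2 a = phi2 a by rewrite lfunE.
have A : Aut_type z lambda phi.
  split=> [|||a] /=.
  - split; first by rewrite invr_neq0.
    apply: (mulfI (expf_neq0 p c0)); rewrite /= exprVn mulVKf ?expf_neq0 //.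
    by rewrite [_^-1 * _]mulrC mulrA E2 mulfK.
  - by exists psi2 => a; rewrite phiE.
  - by move=> a; rewrite !phiE phi2r.
  - rewrite !phiE; apply: ii; rewrite linearZ_LR /= -!rhoU_ext.2 -!FE.
    by rewrite -rhoU_ext.2 -relF scalerA mulVf // scale1r.
exists phi, F, (c^-1 *: s0); split=> //.
- by move=> a; rewrite FE phiE.
- by apply: rpredZ; apply/augmentation_idealP.
have cp0 := expf_neq0 p c0.
rewrite [D']surjective_pairing /transport /=; congr (_, _).
  apply: (scalerI cp0); rewrite scalerDr scalerA exprVn mulfV // scale1r.
  have -> : c ^+ p *: Phi1 lambda rhoU (c^-1 *: s0) =
      s0 ^+ p - lambda *: s0 + c ^+ p.-1 *: iter p.-1 rhoU s0.
    rewrite /Phi1 /Phi_op exprZn.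
    have -> : iter p.-1 rhoU (c^-1 *: s0) = c^-1 *: iter p.-1 rhoU s0.
      exact: (linearZ_LR (mklin (iter_linear rhoU p.-1))).
    have cc (e : K) : e != 0 -> e ^+ p / e = e ^+ p.-1.
      by move=> e0; rewrite -{1}(prednK p_gt0) exprSr mulfK.
    rewrite !scalerDr scalerN !scalerA exprVn mulfV // scale1r E2 mulfK //.
    by rewrite cc.
  have e : c ^+ p *: D'.1 = s0 ^+ p + c ^+ p.-1 *: iter p.-1 rhoU s0 - (lambda *: s0 - F D.1).
    by rewrite -E1 opprB addrC subrK.
  by rewrite e opprB [LHS]addrC -addrA; congr (_ + _); rewrite addrA [- _ + _]addrC.
have dL : comul (f zeta) =
    tmap j' j' (comul s0) + c *: (tens zeta' 1 + tens 1 zeta' + tmap j' j' D'.2).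
  by rewrite fz linearD linearZ_LR /= dz' jD'.
have dR : comul (f zeta) = tens (f zeta) 1 + tens 1 (f zeta) + tmap j' j' (tmap F F D.2).
  rewrite fD dz !linearD /= !tmap_tens /= !rmorph1 !tmap_comp; congr (_ + _).
  by apply: eq_tmap => y /=; rewrite fj.
have e : c *: D'.2 = tmap F F D.2 + cobar1 s0.
  apply: (tmap_inj ji').
  have -> : tmap j' j' (c *: D'.2) = c *: tmap j' j' D'.2 by apply: linearZ_LR.
  have -> : tmap j' j' (tmap F F D.2 + cobar1 s0) = tmap j' j' (tmap F F D.2) +
      (tens 1 (j' s0) - tmap j' j' (comul s0) + tens (j' s0) 1).
    by rewrite linearD /cobar1 linearD linearB /= !tmap_tens /= !rmorph1.
  have := etrans (esym dL) dR; rewrite fz !tensDl !tensDr !tensZl !tensZr !scalerDr.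
  set a := c *: tens zeta' 1; set b := c *: tens 1 zeta'; set w := tmap j' j' (comul s0).
  set x := c *: _; set y := tmap j' j' _; set t1 := tens (j' s0) 1; set t2 := tens 1 (j' s0).
  rewrite addrA => E3; apply: (addrI (w + (a + b))); rewrite E3.
  rewrite [t1 + a + _]addrACA -!addrA [RHS]addrCA.
  rewrite [w + (b + _)]addrCA [w + (y + _)]addrCA [w + (t2 + _)]addrCA addNKr.
  by rewrite addrA addrC -!addrA [t1 + t2]addrC.
have -> : cobar1 (c^-1 *: s0) = c^-1 *: cobar1 s0 by apply: linearZ_LR.
by rewrite -scalerDr -e scalerA mulVf // scale1r.
Qed.

End PDFacts.

(** * Conilpotent coalgebras *)

Section Conilpotent.
Context {K : fieldType} {H : falgType K}.
Variables (delta : {lrmorphism H -> tensor H H}) (eps : {lrmorphism H -> K^o}).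
Hypothesis deltaA : forall x,
  tassoc (tmap delta idfun (delta x)) = tmap idfun delta (delta x).
Hypothesis epsl : forall x, tlift (fun a b : H => (eps a : K) *: b) (delta x) = x.
Hypothesis epsr : forall x, tlift (fun a b : H => (eps b : K) *: a) (delta x) = x.

Inductive right_in (Q : H -> Prop) : tensor H H -> Prop :=
| RightIn0 : right_in Q 0
| RightInP c s t : right_in Q s -> right_in Q t -> right_in Q (c *: s + t)
| RightInT a b : Q b -> right_in Q (tens a b).

(* The coradical filtration of the coalgebra relative to the unit line.       *)
Fixpoint cofilt d (x : H) : Prop :=
  if d is d'.+1 then right_in (cofilt d') (delta x - tens 1 x) else exists c, x = c%:A.

Lemma right_in_mono (Q Q' : H -> Prop) t :
  (forall x, Q x -> Q' x) -> right_in Q t -> right_in Q' t.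
Proof.
move=> QQ; elim=> [|c s u _ Hs _ Hu|a b Qb]; first exact: RightIn0.
  exact: RightInP.
exact/RightInT/QQ.
Qed.

Lemma right_inD Q s t : right_in Q s -> right_in Q t -> right_in Q (s + t).
Proof. by rewrite -[s in s + t]scale1r; apply: RightInP. Qed.

Lemma cofiltP d c x y : cofilt d x -> cofilt d y -> cofilt d (c *: x + y).
Proof.
case: d => [[a ->] [b ->]|d /= Hx Hy].
  by exists (c * a + b); rewrite scalerA scalerDl.
rewrite linearP /= tens_linearr opprD addrACA -scalerBr; exact: RightInP.
Qed.

Lemma cofilt_alg d c : cofilt d c%:A.
Proof.
case: d => [|d]; first by exists c.
rewrite /= linearZ_LR /= rmorph1 tensZr tens11 subrr; exact: RightIn0.
Qed.

Lemma cofilt0 d : cofilt d 0.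
Proof. by have := cofilt_alg d 0; rewrite scale0r. Qed.

Lemma cofiltS d x : cofilt d x -> cofilt d.+1 x.
Proof.
elim: d x => [x [c ->]|d IH x Hx]; first exact: cofilt_alg.
exact: right_in_mono IH Hx.
Qed.

Lemma cofilt_le d e x : (d <= e)%N -> cofilt d x -> cofilt e x.
Proof. by move=> /subnK <-; elim: (e - d)%N => // m IH Hx; apply/cofiltS/IH. Qed.

(* [delta (x y) - 1 (x) x y] is the sum of [(1 (x) x) s], [t (1 (x) y)] and   *)
(* [t s], where [t] and [s] are the corresponding differences for [x], [y].   *)
Lemma cofiltM d e x y : cofilt d x -> cofilt e y -> cofilt (d + e) (x * y).
Proof.
have [m] := ubnP (d + e); elim: m d e x y => // m IH [|d] e x y lm.
  by move=> [c ->] Hy; rewrite -scalerAl mul1r -[_ *: _]addr0; apply/cofiltP/cofilt0.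
case: e lm => [|e] lm.
  by move=> Hx [c ->]; rewrite addn0 -scalerAr mulr1 -[_ *: _]addr0; apply/cofiltP/cofilt0.
move=> Hx Hy; rewrite addSn /=.
pose t := delta x - tens 1 x; pose s := delta y - tens 1 y.
have -> : delta (x * y) - tens 1 (x * y) = tens 1 x * s + (t * tens 1 y + t * s).
  rewrite rmorphM /= -mulrDr [tens 1 y + s]addrC subrK mulrBr tens_mul mulr1 mulrBl.
  by rewrite [RHS]addrC addrA subrK.
have ri (f : tensor H H -> tensor H H) (Q Q' : H -> Prop) u : linear f ->
    right_in Q u -> (forall a b, Q b -> right_in Q' (f (tens a b))) -> right_in Q' (f u).
  move=> fl Hu fQ; elim: Hu => [|c v w _ Hv _ Hw|a b Qb]; last exact: fQ.
    have -> : f 0 = 0 by exact: (linear0 (mklin fl)).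
    exact: RightIn0.
  by rewrite fl; apply: RightInP.
have [[[_ Ml] _] _] := @linear_mulP K (tensor H H) (tensor H H) idfun (fun _ _ _ => erefl).
have [[[Mr _] _] _] := @linear_mulP K (tensor H H) (tensor H H) idfun (fun _ _ _ => erefl).
have dle : (d + e.+1 < m)%N by move: lm; rewrite addSn ltnS.
have edle : (d + e < m)%N by apply: ltn_trans dle; rewrite addnS.
apply: right_inD; last apply: right_inD.
- apply: (ri _ _ _ s (Ml (tens 1 x)) Hy) => a b Hb; rewrite /= tens_mul; apply: RightInT.
  by rewrite addnS -addSn; apply: IH => //; rewrite addSn -addnS.
- apply: (ri _ _ _ t (Mr (tens 1 y)) Hx) => a b Hb; rewrite /= tens_mul; apply: RightInT.
  exact: IH.
- apply: (ri _ _ _ s (Ml t) Hy) => a b Hb /=.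
  apply: (ri _ _ _ t (Mr (tens a b)) Hx) => a' b' Hb' /=; rewrite tens_mul; apply: RightInT.
  by apply: (@cofilt_le (d + e)); [rewrite addnS|apply: IH].
Qed.

Lemma cofilt_primitive x : delta x = tens x 1 + tens 1 x -> cofilt 1 x.
Proof. by move=> dx; rewrite /= dx addrK; apply/RightInT; exists 1; rewrite scale1r. Qed.

Lemma cofilt_uniform (V : vectType K) (f : {linear V -> H}) :
  (forall v, exists d, cofilt d (f v)) -> exists d, forall v, cofilt d (f v).
Proof.
move=> ex; have [d dP] : exists d : 'I_(dim V) -> nat, forall i, cofilt (d i) (f (tbase i)).
  by exists (fun i => projT1 (cid (ex (tbase i)))) => i; case: cid.
exists (\max_i d i)%N => x; rewrite (tbase_sum x) linear_sum.
have cD y w : cofilt (\max_i d i) y -> cofilt (\max_i d i) w -> cofilt (\max_i d i) (y + w).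
  by rewrite -[y in y + w]scale1r; apply: cofiltP.
apply: big_ind => [||i _]; [exact: cofilt0|exact: cD|].
rewrite linearZ_LR -[_ *: _]addr0; apply: cofiltP; last exact: cofilt0.
exact: cofilt_le (leq_bigmax i) (dP i).
Qed.

Definition conv (f g : H -> H) (x : H) : H := tlift (fun a b => f a * g b) (delta x).

Lemma conv_linear f g : linear (conv f g).
Proof. by move=> c x y; rewrite /conv linearP [LHS]tlift_linear. Qed.

HB.instance Definition _ f g := GRing.isLinear.Build K H H *:%R (conv f g) (conv_linear f g).

Lemma convA (f g k : {linear H -> H}) : conv (conv f g) k =1 conv f (conv g k).
Proof.
move=> x; pose M : tensor H (tensor H H) -> H :=
  tlift (fun a t => f a * tlift (fun b c => g b * k c) t).
have gkl : linear (tlift (fun b c : H => g b * k c)) by apply: tlift_linear.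
have MT a t : M (tens a t) = f a * tlift (fun b c => g b * k c) t.
  exact: (tliftM f (mklin gkl)).
have Ml : linear M by apply: tlift_linear.
have -> : conv (conv f g) k x = M (tassoc (tmap delta idfun (delta x))).
  rewrite /conv; move: (delta x); apply: tensor_ext => [c u v|c u v|a b].
  - exact: tlift_linear.
  - by rewrite !linearP Ml.
  rewrite (tliftM (conv f g) k) tmap_tens /= /conv; move: (delta a).
  apply: tensor_ext => [c u v|c u v|a1 a2].
  - by rewrite [tlift _ _]tlift_linear mulrDl -scalerAl.
  - by rewrite tens_linearl linearP Ml.
  by rewrite tassoc_tens MT !tliftM mulrA.
rewrite deltaA /conv; move: (delta x); apply: tensor_ext => [c u v|c u v|a b].
- by rewrite linearP Ml.
- exact: tlift_linear.
by rewrite tmap_tens MT (tliftM f (conv g k)).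
Qed.

Definition conv_one (x : H) : H := (eps x : K)%:A.

Lemma conv_one_linear : linear conv_one.
Proof. by move=> c x y; rewrite /conv_one linearP /= scalerDl -scalerA. Qed.

HB.instance Definition _ := GRing.isLinear.Build K H H *:%R conv_one conv_one_linear.

Lemma conv1l (f : {linear H -> H}) : conv conv_one f =1 f.
Proof.
move=> x; rewrite -[in RHS](epsl x) tlift_comp; apply: tlift_ext => a b.
by rewrite linearZ_LR /conv_one -scalerAl mul1r.
Qed.

Lemma conv1r (f : {linear H -> H}) : conv f conv_one =1 f.
Proof.
move=> x; rewrite -[in RHS](epsr x) tlift_comp; apply: tlift_ext => a b.
by rewrite linearZ_LR /conv_one -scalerAr mulr1.
Qed.

Lemma eq_conv (f f' g g' : H -> H) : f =1 f' -> g =1 g' -> conv f g =1 conv f' g'.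
Proof. by move=> ff gg x; apply: tlift_ext => a b; rewrite ff gg. Qed.

Definition conv_nil (x : H) : H := conv_one x - x.

Lemma conv_nil_linear : linear conv_nil.
Proof.
by move=> c x y; rewrite /conv_nil linearP opprD addrACA -scalerBr.
Qed.

HB.instance Definition _ := GRing.isLinear.Build K H H *:%R conv_nil conv_nil_linear.

Fixpoint conv_pow m : {linear H -> H} :=
  if m is m'.+1 then conv conv_nil (conv_pow m') else conv_one.

Lemma conv_powSr m : conv_pow m.+1 =1 conv (conv_pow m) conv_nil.
Proof.
elim: m => [x|m IH x]; first by rewrite /= conv1r conv1l.
rewrite -[LHS]/(conv conv_nil (conv_pow m.+1) x).
by rewrite (eq_conv (frefl _) IH) -convA.
Qed.

(** [conv_nil] kills 1, so the term 1 (x) x of the coproduct drops out, and the remaining right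
    factors lie one step lower in the filtration. *)
Lemma conv_pow_cofilt d x : cofilt d x -> conv_pow d.+1 x = 0.
Proof.
have nil1 : conv_nil 1 = 0 by rewrite /conv_nil /conv_one rmorph1 scale1r subrr.
elim: d x => [x [c ->]|d IH x Hx].
  have -> : conv_pow 1 c%:A = conv_nil c%:A by apply: conv1r.
  by have -> : conv_nil c%:A = c *: conv_nil 1 by [exact: linearZ_LR]; rewrite nil1 scaler0.
rewrite -[LHS]/(conv conv_nil (conv_pow d.+1) x) /conv.
have -> : delta x = (delta x - tens 1 x) + tens 1 x by rewrite subrK.
pose M : {linear tensor H H -> H} := tlift (fun a b => conv_nil a * conv_pow d.+1 b).
rewrite -[LHS]/(M _) linearD.
have -> : M (tens 1 x) = 0.
  by rewrite [LHS](tliftM conv_nil (conv_pow d.+1)) [X in X * _]nil1 mul0r.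
rewrite addr0; elim: Hx => [|c s t _ Hs _ Ht|a b Hb]; first exact: linear0.
  by rewrite linearP Hs Ht scaler0 addr0.
by rewrite [LHS](tliftM conv_nil (conv_pow d.+1)) IH ?mulr0.
Qed.

(* Takeuchi's antipode: [id = one - nil] for the convolution product, and its *)
(* inverse is the geometric series of the locally nilpotent [nil].            *)
Lemma antipode_exists : (forall x, exists d, cofilt d x) ->
  exists S : {linear H -> H},
    (forall x, tlift (fun a b => S a * b) (delta x) = (eps x : K)%:A) /\
    (forall x, tlift (fun a b => a * S b) (delta x) = (eps x : K)%:A).
Proof.
move=> /(@cofilt_uniform _ idfun)[d dP].
have Sl : linear (fun x => \sum_(m < d.+1) conv_pow m x).
  move=> c x y; rewrite scaler_sumr -big_split; apply: eq_bigr => m _.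
  by rewrite linearP.
pose S := mklin Sl; exists S.
have idE x : x = conv_one x - conv_nil x by rewrite /conv_nil subKr.
have tel (F : nat -> H -> H) : (forall x, F d.+1 x = 0) -> forall x,
    \sum_(m < d.+1) F m x - \sum_(m < d.+1) F m.+1 x = F 0 x.
  move=> Fd x; rewrite big_ord_recl [X in _ - X]big_ord_recr /= Fd addr0.
  by rewrite -addrA subrr addr0.
have pd x : conv_pow d.+1 x = 0 by apply/conv_pow_cofilt/dP.
split=> x.
  rewrite -[RHS](tel (fun m => conv_pow m) pd).
  have -> : \sum_(m < d.+1) conv_pow m x = conv S conv_one x by rewrite conv1r.
  have -> : \sum_(m < d.+1) conv_pow m.+1 x = conv S conv_nil x.
    rewrite /conv; transitivity (\sum_(m < d.+1) conv (conv_pow m) conv_nil x).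
      by apply: eq_bigr => m _; rewrite conv_powSr.
    rewrite /conv /=; move: (delta x); apply: tensor_ext => [c u v|c u v|a b].
    - rewrite scaler_sumr -big_split; apply: eq_bigr => m _.
      by rewrite [LHS]tlift_linear.
    - exact: tlift_linear.
    rewrite (tliftM S conv_nil) /= mulr_suml.
    by apply: eq_bigr => m _; rewrite (tliftM (conv_pow m) conv_nil).
  rewrite /conv; move: (delta x); apply: tensor_ext => [c u v|c u v|a b].
  - exact: tlift_linear.
  - by rewrite !tlift_linear opprD addrACA -scalerBr.
  by rewrite (tliftM S idfun) (tliftM S conv_one) (tliftM S conv_nil) -mulrBr -idE.
rewrite -[RHS](tel (fun m => conv_pow m) pd).
have -> : \sum_(m < d.+1) conv_pow m x = conv conv_one S x by rewrite conv1l.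
have -> : \sum_(m < d.+1) conv_pow m.+1 x = conv conv_nil S x.
  rewrite /conv /= /conv; move: (delta x); apply: tensor_ext => [c u v|c u v|a b].
  - rewrite scaler_sumr -big_split; apply: eq_bigr => m _.
    by rewrite [LHS]tlift_linear.
  - exact: tlift_linear.
  rewrite (tliftM conv_nil S) /= mulr_sumr.
  by apply: eq_bigr => m _; rewrite (tliftM conv_nil (conv_pow m)).
rewrite /conv; move: (delta x); apply: tensor_ext => [c u v|c u v|a b].
- exact: tlift_linear.
- by rewrite !tlift_linear opprD addrACA -scalerBr.
by rewrite (tliftM idfun S) (tliftM conv_one S) (tliftM conv_nil S) -mulrBl -idE.
Qed.

End Conilpotent.

Section Connected.
Context {K : fieldType} (H : hopfType K).
Local Notation cofilt := (cofilt (@comul K H)).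

(** Pairing the left factor of delta(x) - 1 (x) x with a functional stays in [C] and lowers the
    filtration degree. If all these pairings vanish, then the coproduct of x is 1 (x) x, and the
    counit makes x a multiple of 1. *)
Lemma one_in_subcoalgebra (C : {vspace H}) d x :
  subcoalgebra C -> x \in C -> x != 0 -> cofilt d x -> 1 \in C.
Proof.
move=> sC; elim: d x => [|d IH] x xC x0.
  case=> c xE; move: x0 xC; rewrite xE scaler_eq0 oner_eq0 orbF => c0 /(memvZ c^-1).
  by rewrite scalerA mulVf // scale1r.
move=> /= Hx.
pose pr (q : {linear H -> K^o}) (t : tensor H H) : H := tlift (fun a b => (q a : K) *: b) t.
have prl q : linear (pr q) by apply: tlift_linear.
have prT q a b : pr q (tens a b) = (q a : K) *: b by apply: (tliftZ q idfun).
have prC q : pr q (comul x) \in C.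
  move: (comul x) (sC _ xC); apply: tens_square_ind => [c s t Hs Ht||a b aC bC].
  - by rewrite prl rpredD ?rpredZ.
  - by have -> : pr q 0 = 0 by [exact: (linear0 (mklin (prl q)))]; rewrite mem0v.
  - by rewrite prT rpredZ.
case: (pselect (exists q : {linear H -> K^o}, pr q (comul x - tens 1 x) != 0)) => [[q qx]|nq].
  apply: (IH (pr q (comul x - tens 1 x))) => //.
    rewrite -scaleN1r addrC prl prT scaleN1r rpredD // ?rpredN ?rpredZ //.
  elim: Hx => [|c s t _ Hs _ Ht|a b Hb].
  - by have -> : pr q 0 = 0 by [exact: (linear0 (mklin (prl q)))]; apply: cofilt0.
  - by rewrite prl; apply: cofiltP.
  - by rewrite prT -[_ *: _]addr0; apply: cofiltP => //; apply: cofilt0.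
have dx : comul x = tens 1 x.
  apply/eqP; rewrite -subr_eq0; apply/eqP; set t := comul x - _ in nq *.
  have v2rl i : linear (fun a : H => v2r a 0 i : K^o) by move=> c u v; rewrite linearP !mxE.
  rewrite [t](_ : _ = \sum_i tens (tbase i) (pr (mklin (v2rl i)) t)).
    rewrite big1 // => i _; rewrite [pr _ _](_ : _ = 0) ?tens0r //.
    by apply/eqP/negPn/negP => q0; apply: nq; exists (mklin (v2rl i)).
  move: t {nq}; apply: tensor_ext => [c u v //|c u v|a b].
    rewrite scaler_sumr -big_split; apply: eq_bigr => i _.
    by rewrite prl tens_linearr.
  rewrite [in LHS](tbase_sum a) tens_suml; apply: eq_bigr => i _.
  by rewrite prT tensZl tensZr.
have := counitr x; rewrite -/(counit_right _) dx counit_right_tens => xE.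
move: x0 xC; rewrite -xE scaler_eq0 oner_eq0 orbF => c0 /(memvZ (counit x : K)^-1).
by rewrite scalerA mulVf // scale1r.
Qed.

(** Every nonzero subcoalgebra contains 1, so the line through 1 is the only simple one. *)
Lemma conilpotent_connected : (forall x, exists d, cofilt d x) -> connected_hopf H.
Proof.
move=> ex; exists <[1 : H]>%VS; last by rewrite dim_vline oner_eq0.
have sub1 : subcoalgebra <[1 : H]>%VS.
  move=> x /vlineP[c ->]; rewrite linearZ_LR rmorph1 /= -tens11 rpredZ //.
  by apply: tens_squareS; apply: memv_line.
have n0 : <[1 : H]>%VS != 0%VS.
  by rewrite -dimv_eq0 dim_vline oner_eq0.
split=> [C [sC C0 Cmin]|W]; last apply.
  have [x xC x0] : exists2 x, x \in C & x != 0.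
    by exists (vpick C); rewrite ?memv_pick ?vpick0.
  have [d dx] := ex x; have C1 := one_in_subcoalgebra sC xC x0 dx.
  case: (Cmin _ sub1); first by rewrite -memvE.
    by move=> e; move: n0; rewrite e eqxx.
  by move=> <-.
split=> // D sD D1; case: (eqVneq D 0%VS) => [->|D0]; [by left|right].
apply/eqP; rewrite eqEdim D1 dim_vline oner_eq0 /=.
by rewrite lt0n dimv_eq0.
Qed.

End Connected.

(** * The construction of u_z(D) *)

Section Construction.
Context {K : fieldType} {p n : nat} (charK : p \in [pchar K]).
Context {T : abelian_type K p n} (z : type_g T) (lambda : K).
Hypothesis z_rpow : rpow z = lambda *: z.
Context (U : restricted_env (type_h T)) (rhoU : {linear U -> U}).
Hypothesis rhoU_ext : rho_extension z rhoU.
Variable theta : U.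
Hypothesis rho_theta : rhoU theta = 0.
Local Notation M := {ffun 'I_p -> U}.

Let p_gt1 : (1 < p)%N := prime_gt1 (pcharf_prime charK).
Let p_gt0 : (0 < p)%N := prime_gt0 (pcharf_prime charK).

(* [M] is the free [U]-module on the powers of [z] below [p]; [zact] is the   *)
(* left multiplication by [z] on it.                                          *)
Definition zpow (m : nat) : M := [ffun l : 'I_p => ((l : nat) == m)%:R].
Definition lact (u : U) (w : M) : M := [ffun i => u * w i].
Definition zpow_succ (i : nat) : M :=
  if (i.+1 < p)%N then zpow i.+1 else lambda *: zpow 1 - lact theta (zpow 0).
Definition zact (w : M) : M :=
  [ffun i => rhoU (w i)] + \sum_(i < p) lact (w i) (zpow_succ i).
Definition zmul (v w : M) : M := \sum_(i < p) lact (v i) (iter i zact w).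

Lemma lact_linear u : linear (lact u).
Proof. by move=> c v w; apply/ffunP => i; rewrite !ffunE mulrDr -scalerAr. Qed.

HB.instance Definition _ u := GRing.isLinear.Build K M M *:%R (lact u) (lact_linear u).

Lemma lact_linearl w : linear (lact^~ w).
Proof. by move=> c u v; apply/ffunP => i; rewrite !ffunE mulrDl -scalerAl. Qed.

Lemma lactM u v w : lact (u * v) w = lact u (lact v w).
Proof. by apply/ffunP => i; rewrite !ffunE mulrA. Qed.

Lemma lact1 w : lact 1 w = w.
Proof. by apply/ffunP => i; rewrite !ffunE mul1r. Qed.

Lemma lact0 w : lact 0 w = 0.
Proof. by apply/ffunP => i; rewrite !ffunE mul0r. Qed.

Lemma zpow_sum (V : zmodType) m (F : U -> 'I_p -> V) (im : (m < p)%N) :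
  (forall i, F 0 i = 0) -> \sum_(i < p) F (zpow m i) i = F 1 (Ordinal im).
Proof.
move=> F0; rewrite (bigD1 (Ordinal im)) //= ffunE eqxx big1 ?addr0 // => i im'.
by rewrite ffunE -[_ == m]/(i == Ordinal im) (negPf im') F0.
Qed.

Lemma zpow_decomp (w : M) : w = \sum_(i < p) lact (w i) (zpow i).
Proof.
apply/ffunP => l; rewrite sum_ffunE (bigD1 l) //= !ffunE eqxx mulr1 big1 ?addr0 // => i il.
by rewrite !ffunE -[_ == _]/(l == i) eq_sym (negPf il) mulr0.
Qed.

Lemma zact_linear : linear zact.
Proof.
move=> c v w; rewrite /zact scalerDr addrACA scaler_sumr -big_split; congr (_ + _).
  by apply/ffunP => i; rewrite !ffunE linearP.
by apply: eq_bigr => i _; rewrite !ffunE lact_linearl.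
Qed.

HB.instance Definition _ := GRing.isLinear.Build K M M *:%R zact zact_linear.

Lemma zact_lact u w : zact (lact u w) = lact (rhoU u) w + lact u (zact w).
Proof.
rewrite /zact linearD linear_sum /= addrA; congr (_ + _).
  by apply/ffunP => i; rewrite !ffunE (rhoM rhoU_ext).
by apply: eq_bigr => i _; rewrite ffunE lactM.
Qed.

Lemma zact_zpow m : (m < p)%N -> zact (zpow m) = zpow_succ m.
Proof.
move=> mp; rewrite /zact (zpow_sum mp (F := fun u i => lact u (zpow_succ i))) => [|i]; last exact: lact0.
rewrite lact1 [X in X + _](_ : _ = 0) ?add0r //; apply/ffunP => i; rewrite !ffunE.
by case: (_ == _); rewrite ?linear0 ?(rho1 rhoU_ext).
Qed.

Lemma iter_zact_zpow m : (m < p)%N -> iter m zact (zpow 0) = zpow m.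
Proof.
elim: m => // m IH mp; rewrite iterS IH ?(ltnW mp) // zact_zpow ?(ltnW mp) //.
by rewrite /zpow_succ mp.
Qed.

Lemma iter_zact_lact m u w : iter m zact (lact u w) =
  \sum_(i < m.+1) lact (iter (m - i) rhoU u) (iter i zact w) *+ 'C(m, i).
Proof.
elim: m => [|m IH]; first by rewrite big_ord1 bin0 mulr1n.
rewrite iterS IH linear_sum.
under eq_bigr => i _ do rewrite linearMn /= zact_lact mulrnDl.
rewrite big_split /= [in RHS]big_ord_recl /= ?subn0 bin0 mulr1n.
under [in RHS]eq_bigr => i _ do rewrite /bump /= add1n subSS binS mulrnDr.
rewrite [in RHS]big_split /= addrA; congr (_ + _).
rewrite [in LHS]big_ord_recl /= ?subn0 bin0 mulr1n; congr (_ + _).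
rewrite [in RHS]big_ord_recr /= bin_small // mulr0n addr0.
by apply: eq_bigr => i _; rewrite /bump /= add1n -iterS subnSK.
Qed.

Lemma iter_zact_lact_p u w :
  iter p zact (lact u w) = lact (lambda *: rhoU u) w + lact u (iter p zact w).
Proof.
rewrite iter_zact_lact big_ord_recr /= subnn binn mulr1n; congr (_ + _).
rewrite -(big_mkord xpredT (fun i => lact (iter (p - i) rhoU u) (iter i zact w) *+ 'C(p, i))).
rewrite big_ltn // subn0 bin0 mulr1n big_nat_cond big1 ?addr0 => [|i].
  by rewrite (rho_iter_p charK z_rpow rhoU_ext).
rewrite andbT => ip; have /dvdnP[q ->] := prime_dvd_bin (pcharf_prime charK) ip.
by rewrite mulrnA -scaler_nat (pcharf0 charK) scale0r.
Qed.

(* The two sides agree on [zpow 0] and their difference commutes with [zact]  *)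
(* and with the action of [U].                                                *)
Lemma zact_p w : iter p zact w = lambda *: zact w - lact theta w.
Proof.
have nl : linear (fun w => iter p zact w - (lambda *: zact w - lact theta w)).
  move=> c u v; rewrite (iter_linear zact p).
  have -> : zact (c *: u + v) = c *: zact u + zact v by exact: linearP.
  have -> : lact theta (c *: u + v) = c *: lact theta u + lact theta v by exact: linearP.
  rewrite scalerDr scalerA [lambda * c]mulrC -scalerA !scalerBr.
  have subACA (a b a' b' : M) : (a + b) - (a' + b') = (a - a') + (b - b').
    by rewrite opprD addrACA.
  by rewrite [X in _ - X = _]subACA subACA.
pose N := mklin nl; have NE u : N u = iter p zact u - (lambda *: zact u - lact theta u) by [].
have lin3 (f : {linear M -> M}) (a b e : M) :
    f (a - (lambda *: b - e)) = f a - (lambda *: f b - f e).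
  by rewrite !linearB linearZ_LR.
have Nl u v : N (lact u v) = lact u (N v).
  rewrite !NE (lin3 (lact u)) /= iter_zact_lact_p zact_lact -!lactM (env_mulC theta).
  have -> : lact (lambda *: rhoU u) v = lambda *: lact (rhoU u) v.
    exact: (linearZ_LR (mklin (lact_linearl v))).
  rewrite scalerDr; set A := lambda *: lact (rhoU u) v.
  by rewrite -[X in _ - X = _]addrA opprD addrACA subrr add0r.
have Nz v : N (zact v) = zact (N v).
  by rewrite !NE (lin3 zact) /= zact_lact rho_theta lact0 add0r -iterSr iterS.
have N1 : N (zpow 0) = 0.
  have [e e1] : (p.-1 < p)%N /\ p.-1.+1 = p by rewrite prednK.
  have -> : N (zpow 0) = zact (iter p.-1 zact (zpow 0)) - (lambda *: zact (zpow 0) - lact theta (zpow 0)).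
    by rewrite -iterS e1.
  by rewrite iter_zact_zpow // !zact_zpow // /zpow_succ p_gt1 e1 ltnn subrr.
apply/eqP; rewrite -subr_eq0 -NE; apply/eqP.
rewrite (zpow_decomp w) linear_sum big1 // => i _.
rewrite Nl -iter_zact_zpow //; move: (i : nat) => m.
have -> : N (iter m zact (zpow 0)) = 0.
  by elim: m => // m IH; rewrite iterS Nz IH linear0.
by rewrite linear0.
Qed.

Lemma zmul_linearl w : linear (zmul^~ w).
Proof.
move=> c u v; rewrite /zmul scaler_sumr -big_split; apply: eq_bigr => i _.
by rewrite !ffunE lact_linearl.
Qed.

Lemma zmul_suml (I : finType) (F : I -> M) w :
  zmul (\sum_i F i) w = \sum_i zmul (F i) w.
Proof. exact: (linear_sum (mklin (zmul_linearl w))). Qed.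

Lemma zmul_linearr v : linear (zmul v).
Proof.
move=> c u w; rewrite /zmul scaler_sumr -big_split; apply: eq_bigr => i _ /=.
by rewrite (iter_linear zact i) linearP.
Qed.

Lemma zmul_lact u v w : zmul (lact u v) w = lact u (zmul v w).
Proof. by rewrite /zmul linear_sum; apply: eq_bigr => i _; rewrite ffunE lactM. Qed.

Lemma zmul_zpow m w : (m < p)%N -> zmul (zpow m) w = iter m zact w.
Proof.
move=> mp; rewrite /zmul (zpow_sum mp (F := fun u (i : 'I_p) => lact u (iter i zact w))).
  by rewrite lact1.
by move=> i; rewrite lact0.
Qed.

Lemma zmul_zpow_succ i w : (i < p)%N -> zmul (zpow_succ i) w = iter i.+1 zact w.
Proof.
rewrite /zpow_succ; case: (ltnP i.+1 p) => [ip _|pi ip]; first exact: zmul_zpow.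
have -> : i.+1 = p by apply/eqP; rewrite eqn_leq ip.
rewrite zact_p -scaleN1r -[lambda *: _ + _]addrC zmul_linearl.
have -> : zmul (lambda *: zpow 1) w = lambda *: zact w.
  have -> : zact w = zmul (zpow 1) w by rewrite zmul_zpow.
  exact: (linearZ_LR (mklin (zmul_linearl w))).
by rewrite zmul_lact zmul_zpow // scaleN1r addrC.
Qed.

(** The operator identity z^p = lambda z - Theta of [zact_p] enters here, through [zmul_zpow_succ];
    associativity of the product then follows by iterating. *)
Lemma zmul_zact v w : zmul (zact v) w = zact (zmul v w).
Proof.
rewrite {1}/zact -[X in zmul (X + _) _]scale1r zmul_linearl scale1r.
rewrite [zmul v w]/zmul linear_sum /=.
under [RHS]eq_bigr => i _ do rewrite zact_lact.
rewrite big_split /=; congr (_ + _).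
  by apply: eq_bigr => i _; rewrite ffunE.
rewrite zmul_suml; apply: eq_bigr => i _ /=.
by rewrite zmul_lact zmul_zpow_succ.
Qed.

Lemma zmulA : associative zmul.
Proof.
move=> u v w; rewrite [zmul u v]/zmul zmul_suml /=.
apply: eq_bigr => i _; rewrite zmul_lact; congr (lact _ _).
by elim: (i : nat) => // m IH; rewrite !iterS zmul_zact IH.
Qed.

Lemma zmul1l : left_id (zpow 0) zmul.
Proof. by move=> w; rewrite zmul_zpow. Qed.

Lemma zmul1r : right_id (zpow 0) zmul.
Proof.
move=> w; rewrite [RHS]zpow_decomp; apply: eq_bigr => i _.
by rewrite iter_zact_zpow.
Qed.

Lemma zmulDl : left_distributive zmul +%R.
Proof. by move=> u v w; apply: (linearD (mklin (zmul_linearl w))). Qed.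

Lemma zmulDr : right_distributive zmul +%R.
Proof. by move=> u v w; apply: (linearD (mklin (zmul_linearr u))). Qed.

Lemma zpow0_neq0 : zpow 0 != 0.
Proof.
apply/eqP => /ffunP/(_ (Ordinal p_gt0)); rewrite !ffunE eqxx => /eqP.
by rewrite oner_eq0.
Qed.

Lemma zscaleAl c v w : c *: zmul v w = zmul (c *: v) w.
Proof. exact/esym/(linearZ_LR (mklin (zmul_linearl w))). Qed.

Lemma zscaleAr c v w : c *: zmul v w = zmul v (c *: w).
Proof. exact/esym/(linearZ_LR (mklin (zmul_linearr v))). Qed.

Definition skew_ext : Type := M.

HB.instance Definition _ := Vector.on skew_ext.
HB.instance Definition _ := GRing.Zmodule_isNzRing.Build skew_ext
  zmulA zmul1l zmul1r zmulDl zmulDr zpow0_neq0.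
HB.instance Definition _ := GRing.Lmodule_isLalgebra.Build K skew_ext zscaleAl.
HB.instance Definition _ := GRing.Lalgebra_isAlgebra.Build K skew_ext zscaleAr.
HB.instance Definition _ := Algebra_isFalgebra.Build K skew_ext.

Lemma skew_mulE (v w : skew_ext) : v * w = zmul v w.
Proof. by []. Qed.

Definition skew_in (u : U) : skew_ext := lact u (zpow 0).

Lemma skew_in_linear : linear skew_in.
Proof. exact: lact_linearl. Qed.

Lemma skew_inM u v : skew_in (u * v) = skew_in u * skew_in v.
Proof. by rewrite skew_mulE zmul_lact zmul_zpow // [LHS]lactM. Qed.

Definition skew_inj : {lrmorphism U -> skew_ext} :=
  mkalg skew_in_linear (lact1 _) skew_inM.

Definition skew_gen : skew_ext := zpow 1.

Lemma skew_genM (w : skew_ext) : skew_gen * w = zact w.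
Proof. by rewrite skew_mulE zmul_zpow. Qed.

Lemma skew_injM u (w : skew_ext) : skew_inj u * w = lact u w.
Proof. by rewrite skew_mulE zmul_lact zmul_zpow. Qed.

Lemma skew_genX m : skew_gen ^+ m = iter m zact (zpow 0).
Proof. by elim: m => // m IH; rewrite exprS IH skew_genM. Qed.

Lemma skew_pbw (w : M) : \sum_(i < p) skew_inj (w i) * skew_gen ^+ i = w.
Proof.
rewrite [RHS]zpow_decomp; apply: eq_bigr => i _.
by rewrite skew_injM skew_genX iter_zact_zpow.
Qed.

Lemma skew_relations (D2 : tensor U U) :
  datum_relations lambda rhoU skew_inj skew_gen (theta, D2).
Proof.
split=> [r|].
  rewrite skew_genM skew_injM -[skew_inj r]/(lact r _) zact_lact zact_zpow // /zpow_succ p_gt1.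
  exact: addrK.
rewrite skew_genX zact_p zact_zpow // /zpow_succ p_gt1 -[skew_inj _]/(lact theta _) /=.
by rewrite addrAC subrK subrr.
Qed.

(** By the two relations, the map sum u_i z^i -> sum f(u_i) b^i carries [zact] to left
    multiplication by b, and multiplicativity follows. *)
Lemma skew_univ (D2 : tensor U U) (B : algType K) (f : {lrmorphism U -> B}) (b : B) :
  datum_relations lambda rhoU f b (theta, D2) ->
  exists2 g : {lrmorphism skew_ext -> B},
    (forall r, g (skew_inj r) = f r) /\ g skew_gen = b &
    forall g' : {lrmorphism skew_ext -> B},
      (forall r, g' (skew_inj r) = f r) /\ g' skew_gen = b -> g' =1 g.
Proof.
move=> [r1 r2]; pose g (w : M) : B := \sum_i f (w i) * b ^+ i.
have gl : linear g.
  move=> c u v; rewrite /g scaler_sumr -big_split; apply: eq_bigr => i _ /=.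
  by rewrite !ffunE linearP /= mulrDl -scalerAl.
pose gL := mklin gl.
have g_lact u w : g (lact u w) = f u * g w.
  by rewrite /g mulr_sumr; apply: eq_bigr => i _; rewrite ffunE rmorphM mulrA.
have g_zpow m : (m < p)%N -> g (zpow m) = b ^+ m.
  move=> mp; rewrite /g (zpow_sum mp (F := fun u (i : 'I_p) => f u * b ^+ i)).
    by rewrite rmorph1 mul1r.
  by move=> i; rewrite linear0 mul0r.
have g_succ i : (i < p)%N -> g (zpow_succ i) = b ^+ i.+1.
  rewrite /zpow_succ; case: (ltnP i.+1 p) => [ip _|pi ip]; first exact: g_zpow.
  have -> : i.+1 = p by apply/eqP; rewrite eqn_leq ip.
  rewrite -[g _]/(gL _) linearB linearZ_LR /= g_lact !g_zpow // mulr1 expr1.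
  by apply/eqP; rewrite eq_sym -subr_eq0 opprB addrA addrAC r2.
have g_zact w : g (zact w) = b * g w.
  rewrite -[g _]/(gL _) linearD linear_sum /= [g w]/g mulr_sumr -big_split.
  apply: eq_bigr => i _ /=; rewrite ffunE g_lact g_succ //.
  by rewrite mulrA exprS mulrA -mulrDl -r1 subrK.
have gM (u w : skew_ext) : g (u * w) = g u * g w.
  rewrite skew_mulE -[g _]/(gL _) linear_sum /= [g u]/g mulr_suml.
  apply: eq_bigr => i _; rewrite g_lact -mulrA; congr (_ * _).
  by elim: (i : nat) => [|m IH]; rewrite ?mul1r // iterS g_zact IH exprS mulrA.
pose G : {lrmorphism skew_ext -> B} := @mkalg K skew_ext B g gl (g_zpow 0 p_gt0) gM.
exists G => [|g' [gj gz] w].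
  split=> [r|]; last by rewrite -[LHS]/(g _) g_zpow.
  by rewrite -[LHS]/(g (lact r _)) g_lact g_zpow // mulr1.
rewrite -{1}(skew_pbw w) linear_sum; apply: eq_bigr => i _.
by rewrite rmorphM rmorphXn /= gj gz.
Qed.

End Construction.

(* The class of [A] is destructed because the Hopf structure repacks its      *)
(* fields, and records have no eta-conversion; [f] and [g] are identities.    *)
Lemma hopf_of_falg (K : fieldType) (A : falgType K) (delta : {lrmorphism A -> tensor A A})
    (eps : {lrmorphism A -> K^o}) (S : {linear A -> A}) :
  (forall x, tassoc (tmap delta idfun (delta x)) = tmap idfun delta (delta x)) ->
  (forall x, tlift (fun a b : A => (eps a : K) *: b) (delta x) = x) ->
  (forall x, tlift (fun a b : A => (eps b : K) *: a) (delta x) = x) ->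
  (forall x, tlift (fun a b => S a * b) (delta x) = (eps x : K)%:A) ->
  (forall x, tlift (fun a b => a * S b) (delta x) = (eps x : K)%:A) ->
  exists (H : hopfType K) (f : {lrmorphism A -> H}) (g : {lrmorphism H -> A}),
    [/\ cancel f g, cancel g f, forall x, comul (f x) = tmap f f (delta x) &
        forall x, counit (f x) = eps x].
Proof.
case: A delta eps S => s [m1 m2 m3 m4 m5 m6 m7 m8 m9 m10 m11 m12 m13 m14 m15 m16] delta eps S dA el er Sl Sr.
pose ax := @isHopf.Axioms_ K s m1 m2 m3 m4 m5 m6 m7 m8 m9 m10 m11 m12 m13 m14 m15 m16
  delta eps S dA el er Sl Sr.
pose H : hopfType K := Hopf.Pack (Hopf.Class ax).
exists H, (idfun : {lrmorphism H -> H}), (idfun : {lrmorphism H -> H}).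
by split=> // x; rewrite [RHS](tmap_id (delta x)).
Qed.

(** * The Hopf structure on the extension *)

Section HopfExtension.
Context {K : fieldType} {p n : nat} (charK : p \in [pchar K]).
Context {T : abelian_type K p n} (z : type_g T) (lambda : K).
Hypothesis z_rpow : rpow z = lambda *: z.
Context (U : restricted_env (type_h T)) (rhoU : {linear U -> U}).
Hypothesis rhoU_ext : rho_extension z rhoU.
Local Notation Uplus := (augmentation_ideal U).
Variable D : datum U.
Hypothesis D1 : D.1 \in Uplus.
Hypothesis D2 : D.2 \in tens_square Uplus.
Hypothesis rhoD : rhoU D.1 = 0.
Hypothesis cocD : cocycle2 D.2.
Hypothesis PhiD : Phi2 lambda rhoU D.2 = cobar1 D.1.

Let p_gt0 : (0 < p)%N := prime_gt0 (pcharf_prime charK).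

Section Abstract.
Context (A : falgType K) (j : {lrmorphism U -> A}) (zeta : A).
Hypothesis rel : datum_relations lambda rhoU j zeta D.
Hypothesis univ : forall (B : algType K) (f : {lrmorphism U -> B}) (b : B),
  datum_relations lambda rhoU f b D ->
  exists2 g : {lrmorphism A -> B}, (forall r, g (j r) = f r) /\ g zeta = b &
    forall g' : {lrmorphism A -> B}, (forall r, g' (j r) = f r) /\ g' zeta = b -> g' =1 g.
Hypothesis gen : forall y, exists w : {ffun 'I_p -> U}, y = \sum_i j (w i) * zeta ^+ i.

Lemma gen_ext (B : algType K) (g g' : {lrmorphism A -> B}) :
  (forall r, g (j r) = g' (j r)) -> g zeta = g' zeta -> g =1 g'.
Proof.
move=> gj gz y; have [w ->] := gen y; rewrite !linear_sum; apply: eq_bigr => i _.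
by rewrite !rmorphM !rmorphXn /= gj gz.
Qed.

(** By the universal property only the relations for z (x) 1 + 1 (x) z + chi have to hold. For
    commutators, chi commutes with the image of u(h) (x) u(h); for the p-th power, [zeta_coprod_pow]
    combines with Phi(chi) = d^1(Theta). *)
Lemma comul_exists : exists2 delta : {lrmorphism A -> tensor A A},
  (forall r, delta (j r) = tmap j j (comul r)) &
  delta zeta = tens zeta 1 + tens 1 zeta + tmap j j D.2.
Proof.
have [r1 r2] := rel; pose f : {lrmorphism U -> tensor A A} := tmap j j \o @comul K U.
have fE r : f r = tmap j j (comul r) by [].
have [|g [gj gz] _] := @univ (tensor A A) f (tens zeta 1 + tens 1 zeta + tmap j j D.2).
  split=> [r|].
    rewrite !fE (comul_rho rhoU_ext) -(zeta_coprod_comm r1) mulrDl mulrDr.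
    have -> : tmap j j D.2 * tmap j j (comul r) = tmap j j (comul r) * tmap j j D.2.
      by rewrite -!tmapM env2_mulC.
    by rewrite opprD addrACA subrr addr0.
  have zp : zeta ^+ p = lambda *: zeta - j D.1.
    by apply/eqP; rewrite -subr_eq0 opprB addrA addrAC; apply/eqP.
  rewrite (zeta_coprod_pow charK r1) zp tensDl tensDr tensNl tensNr tensZl tensZr.
  have -> : tmap j j (D.2 ^+ p + iter p.-1 (rhoU2 rhoU) D.2) =
      tmap j j (cobar1 D.1) + lambda *: tmap j j D.2.
    have <- : tmap j j (lambda *: D.2) = lambda *: tmap j j D.2 by apply: linearZ_LR.
    have <- : tmap j j (cobar1 D.1 + lambda *: D.2) =
      tmap j j (cobar1 D.1) + tmap j j (lambda *: D.2) by apply: linearD.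
    by rewrite -PhiD /Phi2 /Phi_op addrAC subrK.
  have -> : tmap j j (cobar1 D.1) = tens 1 (j D.1) - f D.1 + tens (j D.1) 1.
    by rewrite /cobar1 linearD linearB /= !tmap_tens /= !rmorph1.
  rewrite !scalerDr; set a := lambda *: tens zeta 1; set b := lambda *: tens 1 zeta.
  set c := lambda *: _; set t1 := tens _ 1; set t2 := tens 1 _; set w := f D.1.
  have -> : a - t1 + (b - t2) + (t2 - w + t1 + c) = a + b + c - w.
    rewrite [a - t1 + _]addrACA -[- t1 - t2]opprD [t2 - w + t1]addrAC [t2 + t1]addrC.
    by rewrite -[_ - w + c]addrA subrKA [- w + c]addrC addrA.
  by rewrite addrAC subrK subrr.
by exists g.
Qed.

Lemma counit_exists : exists2 eps : {lrmorphism A -> K^o},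
  (forall r, eps (j r) = counit r) & eps zeta = 0.
Proof.
have [|g [gj gz] _] := @univ K^o counit 0; last by exists g.
split=> [r|]; first by rewrite mulr0 mul0r subrr (counit_rho rhoU_ext).
by rewrite expr0n eqn0Ngt p_gt0 scaler0 subrr add0r; apply/augmentation_idealP.
Qed.

Section Structure.
Context (delta : {lrmorphism A -> tensor A A}) (eps : {lrmorphism A -> K^o}).
Hypothesis delta_j : forall r, delta (j r) = tmap j j (comul r).
Hypothesis delta_zeta : delta zeta = tens zeta 1 + tens 1 zeta + tmap j j D.2.
Hypothesis eps_j : forall r, eps (j r) = counit r.
Hypothesis eps_zeta : eps zeta = 0.

Lemma ext_coassoc y : tassoc (tmap delta idfun (delta y)) = tmap idfun delta (delta y).
Proof.
pose g1 : {lrmorphism A -> tensor A (tensor A A)} := @tassoc K A A A \o (tmap delta idfun \o delta).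
pose g2 : {lrmorphism A -> tensor A (tensor A A)} := tmap idfun delta \o delta.
apply: (gen_ext (g := g1) (g' := g2)) => [r|] /=.
  by rewrite delta_j (coprod_l delta_j) (coprod_r delta_j) comulA.
by rewrite (zeta_coassoc_l delta_j delta_zeta) (zeta_coassoc_r delta_j delta_zeta) cocD.
Qed.

Lemma ext_counitl y : tlift (fun a b : A => (eps a : K) *: b) (delta y) = y.
Proof.
pose E (t : tensor A A) : A := tlift (fun a b : A => (eps a : K) *: b) t.
have ET a b : E (tens a b) = (eps a : K) *: b by apply: (tliftZ eps idfun).
have El : linear E by apply: tlift_linear.
have E1 : E 1 = 1 by rewrite -tens11 ET rmorph1 scale1r.
have EM s t : E (s * t) = E s * E t.
  apply: tensor_multiplicative => // a b a' b'.
  by rewrite !ET rmorphM -scalerAl -scalerAr scalerA.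
have Ej t : E (tmap j j t) = j (counit_left t).
  move: t; apply: tensor_ext => [c s t|c s t|a b].
  - by rewrite linearP El.
  - by rewrite !linearP.
  by rewrite tmap_tens ET /= counit_left_tens linearZ_LR eps_j.
apply: (@gen_ext _ (mkalg El E1 EM \o delta) idfun) => [r|] /=.
  by rewrite delta_j Ej [counit_left _]counitl.
have [Dl _] := (tens_square_augP D.2).1 D2.
rewrite delta_zeta -[tens zeta 1]scale1r -addrA El -[tens 1 zeta]scale1r El scale1r.
by rewrite scale1r !ET Ej Dl eps_zeta rmorph1 linear0 scale0r add0r scale1r addr0.
Qed.

Lemma ext_counitr y : tlift (fun a b : A => (eps b : K) *: a) (delta y) = y.
Proof.
pose E (t : tensor A A) : A := tlift (fun a b : A => (eps b : K) *: a) t.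
have ET a b : E (tens a b) = (eps b : K) *: a.
  apply: tlift_tens => [b'|a'] c u v; first by rewrite scalerDr !scalerA mulrC.
  by rewrite linearP scalerDl scalerA.
have El : linear E by apply: tlift_linear.
have E1 : E 1 = 1 by rewrite -tens11 ET rmorph1 scale1r.
have EM s t : E (s * t) = E s * E t.
  apply: tensor_multiplicative => // a b a' b'.
  by rewrite !ET rmorphM -scalerAl -scalerAr scalerA.
have Ej t : E (tmap j j t) = j (counit_right t).
  move: t; apply: tensor_ext => [c s t|c s t|a b].
  - by rewrite linearP El.
  - by rewrite !linearP.
  by rewrite tmap_tens ET /= counit_right_tens linearZ_LR eps_j.
apply: (@gen_ext _ (mkalg El E1 EM \o delta) idfun) => [r|] /=.
  by rewrite delta_j Ej [counit_right _]counitr.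
have [_ Dr] := (tens_square_augP D.2).1 D2.
rewrite delta_zeta -[tens zeta 1]scale1r -addrA El -[tens 1 zeta]scale1r El scale1r.
by rewrite scale1r !ET Ej Dr eps_zeta rmorph1 linear0 scale0r scale1r !addr0.
Qed.

(** The elements of finite filtration degree form a subalgebra containing h. One degree d serves for
    all of u(h), which is finite-dimensional, and z then has degree at most d + 1, because the right
    factors of chi lie in u(h). *)
Lemma ext_conilpotent y : exists d, cofilt delta d y.
Proof.
have cP c u v : (exists d, cofilt delta d u) -> (exists d, cofilt delta d v) ->
    exists d, cofilt delta d (c *: u + v).
  move=> [d Hu] [e Hv]; exists (maxn d e); apply: cofiltP.
    exact: cofilt_le (leq_maxl d e) Hu.
  exact: cofilt_le (leq_maxr d e) Hv.
have cM u v : (exists d, cofilt delta d u) -> (exists d, cofilt delta d v) ->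
    exists d, cofilt delta d (u * v).
  by move=> [d Hu] [e Hv]; exists (d + e)%N; apply: cofiltM.
have c1 : exists d, cofilt delta d 1.
  by exists 0%N; exists 1; rewrite scale1r.
have cj u : exists d, cofilt delta d (j u).
  elim/(@env_ind _ _ _ U): u => [|c u v cu cv|u v cu cv|a].
  - by rewrite rmorph1.
  - by rewrite linearP; apply: cP.
  - by rewrite rmorphM; apply: cM.
  exists 1%N; apply: cofilt_primitive.
  by rewrite delta_j env_in_prim linearD /= !tmap_tens /= !rmorph1.
have [d dP] := cofilt_uniform cj.
have cz : exists d, cofilt delta d zeta.
  have rj t : right_in (cofilt delta d) (tmap j j t).
    move: t; apply: tensor_ind => [c s t Hs Ht||a b].
    - by rewrite linearP; apply: RightInP.
    - by rewrite linear0; apply: RightIn0.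
    by rewrite tmap_tens; apply/RightInT/dP.
  exists d.+1; rewrite /= delta_zeta addrAC addrK; apply: right_inD => //.
  by apply: RightInT; rewrite -[1]scale1r; apply: cofilt_alg.
have [w ->] := gen y.
have cX m : exists d, cofilt delta d (zeta ^+ m).
  by elim: m => // m IH; rewrite exprS; apply: cM.
apply: (big_ind (fun y => exists d, cofilt delta d y)) => [|u v Hu Hv|i _].
- by exists 0%N; exists 0; rewrite scale0r.
- by rewrite -[u]scale1r; apply: cP.
by apply: cM.
Qed.

End Structure.

Lemma hopf_extension : injective (fun w : {ffun 'I_p -> U} => \sum_i j (w i) * zeta ^+ i) ->
  exists (H : hopfType K) (jH : {lrmorphism U -> H}) (zH : H),
  [/\ uz_presented lambda rhoU D jH zH, injective (pbw jH zH),
      connected_hopf H & \dim {: H} = (p * dim U)%N].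
Proof.
move=> inj; have [delta dj dz] := comul_exists; have [eps ej ez] := counit_exists.
have dA := ext_coassoc dj dz; have el := ext_counitl dj dz ej ez.
have er := ext_counitr dj dz ej ez; have cn := ext_conilpotent dj dz.
have [S [Sl Sr]] := antipode_exists dA el er cn.
have [H [f [g [fK gK fD fe]]]] := hopf_of_falg dA el er Sl Sr.
have [r1 r2] := rel; exists H, (f \o j), (f zeta).
have pbwE w : pbw (f \o j) (f zeta) w = f (\sum_i j (w i) * zeta ^+ i).
  by rewrite linear_sum; apply: eq_bigr => i _; rewrite rmorphM rmorphXn.
split.
- split.
  + split=> [r|] /=; first by rewrite -!rmorphM -raddfB r1.
    have <- : f (zeta ^+ p - lambda *: zeta + j D.1) =
      f zeta ^+ p - lambda *: f zeta + f (j D.1).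
      by rewrite linearD linearB linearZ_LR /= rmorphXn.
    by rewrite r2 linear0.
  + move=> B h b /univ[G [Gj Gz] Gu]; exists (G \o g) => [|G' [Gj' Gz'] y].
      by split=> [r|] /=; rewrite fK.
    by rewrite -[y in LHS]gK; apply: (Gu (G' \o f)).
  + split=> r /=; last by rewrite fe ej.
    by rewrite fD dj tmap_comp.
  by rewrite fD dz !linearD /= !tmap_tens /= !rmorph1 tmap_comp.
- by move=> u v; rewrite !pbwE => /(can_inj fK)/inj.
- apply: conilpotent_connected => y; have [d Hd] := cn (g y); exists d.
  rewrite -[y]gK; move: (g y) Hd => {y}; elim: d => [|d IH] y.
    by case=> c ->; exists c; rewrite linearZ_LR rmorph1.
  move=> Hy; rewrite /= fD.
  have -> : tmap f f (delta y) - tens 1 (f y) = tmap f f (delta y - tens 1 y).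
    by rewrite linearB /= tmap_tens /= rmorph1.
  elim: Hy => [|c s t _ Hs _ Ht|a b Hb].
  + by rewrite linear0; apply: RightIn0.
  + by rewrite linearP; apply: RightInP.
  + by rewrite tmap_tens; apply/RightInT/IH.
- have -> : (p * dim U)%N = dim {ffun 'I_p -> U} by rewrite -[RHS]/(#|'I_p| * dim U)%N card_ord.
  rewrite dimvf -(@dim_linear_bij _ _ _ (mklin (pbw_linear (f \o j) (f zeta)))) // => y.
    by move=> u /=; rewrite !pbwE => /(can_inj fK)/inj.
  by have [w wy] := gen (g y); exists w; rewrite /= pbwE -wy gK.
Qed.

End Abstract.

Lemma uz_exists : exists (H : hopfType K) (j : {lrmorphism U -> H}) (zeta : H),
  [/\ uz_presented lambda rhoU D j zeta, injective (pbw j zeta),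
      connected_hopf H & \dim {: H} = (p * dim U)%N].
Proof.
have pbwE := skew_pbw charK z_rpow rhoU_ext rhoD.
apply: (@hopf_extension _ (skew_inj charK z_rpow rhoU_ext rhoD) (skew_gen U)).
- exact: (skew_relations charK z_rpow rhoU_ext rhoD D.2).
- by move=> B f b; apply: (@skew_univ _ _ _ charK _ _ _ z_rpow _ _ rhoU_ext _ rhoD D.2).
- by move=> y; exists y; rewrite [RHS]pbwE.
- by move=> v w e; rewrite -[v]pbwE -[w]pbwE.
Qed.

End HopfExtension.

(** * PD data *)

Section PDData.
Context {K : closedFieldType} {p n : nat} (charK : p \in [pchar K]).
Context {T : abelian_type K p n} (z : type_g T) (lambda : K).
Hypothesis z_rpow : rpow z = lambda *: z.
Context (U : restricted_env (type_h T)) (rhoU : {linear U -> U}).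
Hypothesis rhoU_ext : rho_extension z rhoU.
Local Notation iota := (env_in U).
Local Notation Uplus := (augmentation_ideal U).
Local Notation PD := (PD_datum lambda rhoU).
Local Notation Phi2 := (Phi2 lambda rhoU).
Local Notation transported := (transported z lambda rhoU).
Local Notation transport := (transport lambda rhoU).

(** By [dual_comul] every functional [th (madd a b)] with a and b nonzero kills a primitive element,
    so only its coordinates in degree one remain. *)
Lemma env_primitive (u : U) : comul u = tens u 1 + tens 1 u -> exists a, u = iota a.
Proof.
move=> up; have [x xb] := basis_exists (T := T).
have [th thP] := dual_basis charK U xb.
have prim0 k b w : comul w = tens w 1 + tens 1 w -> b != mzero -> th (madd (meps k) b) w = 0.
  move=> wp b0; rewrite -(dual_comul charK xb thP) wp linearD /= !tpair_tens !(dual_one charK thP).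
  by rewrite (negPf b0) mulr0 add0r -mdeg_eq0 mdeg_eps mul0r.
exists (\sum_k (th (meps k) u : K) *: tnth x k); apply: (dual_inj charK xb thP) => a.
case: (eqVneq a mzero) => [->|/meps_split[k [b ->]]].
  by rewrite !(dual_counit charK xb thP) counit_env counit_primitive.
case: (eqVneq b mzero) => [->|b0]; last by rewrite !prim0 // env_in_prim.
by rewrite madd0 (dual_eps charK xb thP) (coord_sum_basis xb).
Qed.

Lemma cobar1_eq0 (u : U) : cobar1 u = 0 -> exists a, u = iota a.
Proof.
move=> u0; apply: env_primitive; apply/eqP.
by rewrite eq_sym -subr_eq0 [tens u 1 + _]addrC addrAC -[X in X == 0]/(cobar1 u) u0.
Qed.

(** A primitive element of the algebra of [uz_exists] has the form u + c z by [almost_primitive],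
    and then d^1(u) = c chi. If c is nonzero, chi would be a coboundary; if c = 0, then u is
    primitive in u(h), hence lies in h. *)
Lemma PD_of_relations D : D.1 \in Uplus -> D.2 \in tens_square Uplus -> rhoU D.1 = 0 ->
  cocycle2 D.2 -> Phi2 D.2 = cobar1 D.1 -> ~ (exists2 s, s \in Uplus & D.2 = cobar1 s) ->
  PD D.
Proof.
move=> D1 D2 rD cD pD ncb.
have [H [j [zeta [P inj conn dH]]]] := uz_exists charK z_rpow rhoU_ext D1 D2 rD cD pD.
split=> //; exists H; split=> //; first by exists j, zeta.
  by rewrite dH (dim_U charK U) expnS.
have ji := pbw_j_inj charK inj; have [_ _ [jD je] dz] := P.
have fl : linear (fun a => j (iota a)) by move=> c a b; rewrite !linearP.
exists (mklin fl); split=> [|a b /= /ji /(env_in_inj charK) //|y].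
  have [ip ic] := env_inP U.
  by split=> [a|a b] /=; rewrite ?ip ?rmorphXn // -!rmorphM ic.
split=> [/primitivesP yP|[a ->]]; last first.
  by apply/primitivesP; rewrite /= jD env_in_prim linearD /= !tmap_tens /= !rmorph1.
have [pi [pij piz]] := quotient_exists charK rhoU_ext P D1.
have [|u [c yE]] := @almost_primitive _ _ _ charK _ _ _ _ _ _ _ _ P D2 _ pij piz inj y 0.
  by rewrite linear0 addr0.
have ey : counit y = 0 :> K by apply: counit_primitive.
have eu : u \in Uplus.
  apply/augmentation_idealP; move: ey; rewrite yE linearD /= counitZ.
  by rewrite (uz_counit P D2) mulr0 addr0 je.
have cu : cobar1 u = c *: D.2.
  apply: (tmap_inj ji).
  have -> : tmap j j (cobar1 u) = tens 1 (j u) - tmap j j (comul u) + tens (j u) 1.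
    by rewrite /cobar1 linearD linearB /= !tmap_tens /= !rmorph1.
  have -> : tmap j j (c *: D.2) = c *: tmap j j D.2 by apply: linearZ_LR.
  have : comul y = tmap j j (comul u) + c *: (tens zeta 1 + tens 1 zeta + tmap j j D.2).
    by rewrite yE linearD linearZ_LR /= dz jD.
  rewrite yP yE tensDl tensDr tensZl tensZr !scalerDr addrACA.
  set s := c *: tens zeta 1 + _; rewrite [LHS]addrC [RHS]addrCA => /addrI E.
  by rewrite addrAC [tens 1 _ + _]addrC E addrAC subrr add0r.
case: (eqVneq c 0) => [c0|c0].
  have [a ua] : exists a, u = iota a by apply: cobar1_eq0; rewrite cu c0 scale0r.
  by exists a; rewrite yE c0 scale0r addr0 /= ua.
case: ncb; exists (c^-1 *: u); first exact: rpredZ.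
by rewrite (linearZ_LR (mklin (@cobar1_linear K U))) /= cu scalerA mulVf // scale1r.
Qed.

(** If chi = d^1(s), then z + s is primitive, although all primitives lie in j(h). *)
Lemma PD_not_coboundary D : PD D -> ~ (exists2 s, s \in Uplus & D.2 = cobar1 s).
Proof.
move=> /(PD_presentation charK)[H [j [zeta [P inj prims _ _]]]] [s _ Ds].
have [_ _ [jD _] dz] := P.
have [a za] : exists a, zeta + j s = j (iota a).
  apply: prims; rewrite linearD /= dz jD Ds tensDl tensDr [RHS]addrACA -[LHS]addrA; congr (_ + _).
  have <- : tmap j j (cobar1 s + comul s) = tmap j j (cobar1 s) + tmap j j (comul s).
    exact: linearD.
  by rewrite /cobar1 addrAC subrK addrC linearD /= !tmap_tens /= !rmorph1.
have /(pbw_indep charK inj)[_ /eqP] : j s + 1 *: zeta = j (iota a) + 0 *: zeta.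
  by rewrite scale1r scale0r addr0 addrC.
by rewrite oner_eq0.
Qed.

Lemma PD_transported D D' : transported D D' -> PD D -> PD D'.
Proof.
move=> tr [D1 D2 [H [uz conn dH prims]]]; split.
- case: tr => phi [F [s [A FE sU ->]]]; apply: rpredD; last exact: (Phi1_aug charK lambda rhoU_ext).
  by apply: rpredZ; apply: aug_ext FE D1.
- case: tr => phi [F [s [A FE sU ->]]]; apply: rpredD; last exact: cobar1_aug.
  apply: rpredZ; move: (D.2) D2; apply: tens_square_ind => [c t t' Ht Ht'||a b aU bU].
  + by rewrite linearP rpredD // rpredZ.
  + by rewrite linear0 rpred0.
  by rewrite tmap_tens tens_squareS //; apply: aug_ext FE _.
exists H; split=> //; exact: is_uz_transport tr uz.
Qed.

Lemma datum_equiv_transported D D' : datum_equiv lambda rhoU D D' -> transported D D'.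
Proof.
case=> s sU [e1 e2]; exists (1, \1%VF), idfun, s; split=> //.
- exact: Aut_one.
- by move=> a; rewrite lfunE.
rewrite /transport /= expr1n !scale1r tmap_id -e1 -e2.
by rewrite [_ + (_ - _)]addrC subrK [D.2 + _]addrC subrK -surjective_pairing.
Qed.

End PDData.

(** * Orbits *)

Section Orbits.
Context {K : closedFieldType} {p n : nat} (charK : p \in [pchar K]).
Context {T : abelian_type K p n} (z : type_g T) (lambda : K).
Hypothesis z_rpow : rpow z = lambda *: z.
Context (U : restricted_env (type_h T)) (rhoU : {linear U -> U}).
Hypothesis rhoU_ext : rho_extension z rhoU.
Local Notation h := (type_h T).
Local Notation iota := (env_in U).
Local Notation Uplus := (augmentation_ideal U).
Local Notation PD := (PD_datum lambda rhoU).
Local Notation Phi1 := (Phi1 lambda rhoU).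
Local Notation transported := (transported z lambda rhoU).
Local Notation transport := (transport lambda rhoU).
Local Notation H2_class := (H2_class lambda rhoU).
Local Notation H2_orbit := (H2_orbit z lambda).
Local Notation Aut := (Aut_type z lambda).
Implicit Types (phi psi : K * 'End(h)) (D : datum U).

(** [transported] with the automorphism fixed and the change of representative free. *)
Definition transported_by (phi : K * 'End(h)) (D D' : datum U) : Prop :=
  exists (F : {lrmorphism U -> U}) s,
    [/\ forall a, F (iota a) = iota (phi.2 a), s \in Uplus & D' = transport phi F s D].

Lemma transported_by_comp phi psi D D' D'' : Aut psi ->
  transported_by phi D D' -> transported_by psi D' D'' ->
  transported_by (aut_mul psi phi) D D''.
Proof.
move=> Apsi [F [s [FE sU ->]]] [G [t [GE tU ->]]].
exists (G \o F), (psi.1 *: G s + t); split.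
- by move=> a; rewrite /= FE GE lfunE.
- by apply: rpredD => //; apply: rpredZ; apply: aug_ext GE sU.
exact: (transport_comp charK rhoU_ext).
Qed.

Lemma transported_by_eq phi psi D D' : phi.1 = psi.1 -> phi.2 =1 psi.2 ->
  transported_by phi D D' -> transported_by psi D D'.
Proof.
move=> e1 e2 [F [s [FE sU ->]]]; exists F, s; split=> //; first by move=> a; rewrite FE e2.
by rewrite /transport e1.
Qed.

Lemma transported_by_one D s : s \in Uplus ->
  transported_by (1, \1%VF) D (D.1 + Phi1 s, D.2 + cobar1 s).
Proof.
move=> sU; exists idfun, s; split=> // [a|]; first by rewrite lfunE.
by rewrite /transport /= expr1n !scale1r tmap_id.
Qed.

Lemma Aut_functor phi : Aut phi ->
  exists F : {lrmorphism U -> U}, forall a, F (iota a) = iota (phi.2 a).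
Proof. by case=> _ _ gr _; apply: env_functor. Qed.

(** The pointwise image of a class is again closed under equivalence: a change by s after phi is the
    image of a change by psi.1 G(s) before it, with psi the inverse of phi. *)
Lemma Aut_act_class_transported phi D : PD D -> Aut phi ->
  Aut_act_class phi (H2_class D) = [set D' | transported_by phi D D'].
Proof.
move=> PD_D A; have [F FE] := Aut_functor A.
have mul1 D' : transported_by (aut_mul phi (1, \1%VF)) D D' -> transported_by phi D D'.
  apply: transported_by_eq; first by rewrite /= mulr1.
  by move=> a; rewrite /= !lfunE /= lfunE.
apply/seteqP; split=> [X [E [PE [s sU [e1 e2]]] [F' FE' ->]]|X [F' [s [FE' sU ->]]]] /=.
  apply: mul1; apply: (transported_by_comp A (transported_by_one D sU)).
  exists F', 0; split=> //; first exact: rpred0.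
  rewrite /transport -e1 -e2 !(addrC D.1) !(addrC D.2) !subrK.
  rewrite (Phi10 charK lambda rhoU) (linear0 (mklin (@cobar1_linear K U))).
  by rewrite !addr0.
have [psi [G [B GE e1 [FK GK] _]]] := transport_inv charK rhoU_ext s A FE'.
have tU : psi.1 *: G s \in Uplus by apply: rpredZ; apply: aug_ext GE sU.
exists (D.1 + Phi1 (psi.1 *: G s), D.2 + cobar1 (psi.1 *: G s)).
  split.
    apply: (PD_transported charK rhoU_ext _ PD_D).
    have [F1 [s1 [FE1 sU1 ->]]] := transported_by_one D tU.
    by exists (1, \1%VF), F1, s1; split=> //; apply: Aut_one.
  by exists (psi.1 *: G s) => //; split; rewrite addrAC subrr add0r.
exists F' => //; rewrite /transport /=; congr (_, _).
  rewrite linearD scalerDr /=; congr (_ + _).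
  rewrite -(Phi1_equivariant charK rhoU_ext _ A FE') linearZ_LR /= GK scalerA.
  by rewrite [_ * psi.1]mulrC e1 scale1r.
rewrite linearD scalerDr /=; congr (_ + _).
rewrite -(cobar1_hopf _ (ext_hopf FE')) linearZ_LR /= GK.
rewrite -[RHS](linearZ_LR (mklin (@cobar1_linear K U))) /= scalerA.
by rewrite [_ * psi.1]mulrC e1 scale1r.
Qed.

(** If the orbits agree, D' lies in the image of the class of D under some automorphism, which is a
    transport. Conversely, composition with phi or its inverse matches the two sets of classes. *)
Lemma H2_orbitP D D' : PD D -> PD D' ->
  H2_orbit (H2_class D) = H2_orbit (H2_class D') <-> transported D D'.
Proof.
move=> PD_D PD_D'; split=> [eq_orb|tr].
  have : H2_orbit (H2_class D') (Aut_act_class (1, \1%VF) (H2_class D')).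
    by exists (1, \1%VF) => //; apply: Aut_one.
  rewrite -eq_orb => -[phi A]; rewrite !Aut_act_class_transported //; last exact: Aut_one.
  move=> /seteqP[_ /(_ D')]; case.
    exists idfun, 0; split=> //; [by move=> a; rewrite lfunE|exact: rpred0|].
    rewrite /transport (Phi10 charK lambda rhoU) (linear0 (mklin (@cobar1_linear K U))).
    by rewrite /= expr1n !scale1r tmap_id !addr0 -surjective_pairing.
  by move=> F [s [FE sU ->]]; exists phi, F, s.
case: tr => phi [F [s [A FE sU DE]]].
have [psi [G [B GE e1 [FK GK] inv]]] := transport_inv charK rhoU_ext s A FE.
have bE : transported_by phi D D' by exists F, s.
have bE' : transported_by psi D' D.
  exists G, (- (psi.1 *: G s)); split=> //; last by rewrite DE inv.
  by rewrite rpredN rpredZ //; apply: aug_ext GE sU.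
have psiK a : psi.2 (phi.2 a) = a.
  by apply: (env_in_inj charK (U := U)); rewrite -GE -FE FK.
have phiK a : phi.2 (psi.2 a) = a.
  by apply: (env_in_inj charK (U := U)); rewrite -FE -GE GK.
apply/seteqP; split=> X [phi' A' <-]; rewrite Aut_act_class_transported //.
  exists (aut_mul phi' psi); first exact: Aut_mul.
  rewrite Aut_act_class_transported //; last exact: Aut_mul.
  apply/seteqP; split=> Y; last exact: transported_by_comp.
  move=> /(transported_by_comp (Aut_mul A' B) bE); apply: transported_by_eq => [|a] /=.
    by rewrite -mulrA e1 mulr1.
  by rewrite !lfunE /= !lfunE /= psiK.
exists (aut_mul phi' phi); first exact: Aut_mul.
rewrite Aut_act_class_transported //; last exact: Aut_mul.
apply/seteqP; split=> Y; last exact: transported_by_comp.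
move=> /(transported_by_comp (Aut_mul A' A) bE'); apply: transported_by_eq => [|a] /=.
  by rewrite -mulrA [phi.1 * _]mulrC e1 mulr1.
by rewrite !lfunE /= !lfunE /= phiK.
Qed.

End Orbits.

(** * Parameters of classes of PD data for p > 2 *)

Section ParamClasses.
Context {K : closedFieldType} {p n : nat} (charK : p \in [pchar K]) (p_gt2 : (2 < p)%N).
Context {T : abelian_type K p n} (z : type_g T) (lambda : K).
Hypothesis z_rpow : rpow z = lambda *: z.
Context (U : restricted_env (type_h T)) (rhoU : {linear U -> U}).
Hypothesis rhoU_ext : rho_extension z rhoU.
Context (x : n.-tuple (type_h T)) (x_basis : basis_of fullv x).
Local Notation h := (type_h T).
Local Notation iota := (env_in U).
Local Notation Uplus := (augmentation_ideal U).
Local Notation PD := (PD_datum lambda rhoU).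
Local Notation Phi1 := (Phi1 lambda rhoU).
Local Notation transported := (transported z lambda rhoU).
Local Notation transport := (transport lambda rhoU).
Local Notation H2_class := (H2_class lambda rhoU).
Local Notation Aut := (Aut_type z lambda).
Local Notation chi_of := (chi_of U x).
Local Notation Aplus := (Aplus lambda rhoU x).
Implicit Types (phi psi : K * 'End(h)) (D : datum U) (P : param K n).

Lemma cohomologous_refl (s : tensor U U) : cohomologous s s.
Proof.
exists 0; first exact: rpred0.
by rewrite subrr (linear0 (mklin (@cobar1_linear K U))).
Qed.

Lemma cohomologous_sym (s t : tensor U U) : cohomologous s t -> cohomologous t s.
Proof.
case=> u uU e; exists (- u); first by rewrite rpredN.
by rewrite -opprB e (linearN (mklin (@cobar1_linear K U))).
Qed.

Lemma cohomologous_trans (s t w : tensor U U) :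
  cohomologous s t -> cohomologous t w -> cohomologous s w.
Proof.
case=> u uU e [v vU f]; exists (u + v); first exact: rpredD.
by rewrite (linearD (mklin (@cobar1_linear K U))) /= -e -f addrA subrK.
Qed.

Lemma cohomologous_scale phi (F : {lrmorphism U -> U}) (s t : tensor U U) :
  (forall a, F (iota a) = iota (phi.2 a)) -> cohomologous s t ->
  cohomologous (phi.1 *: tmap F F s) (phi.1 *: tmap F F t).
Proof.
move=> FE [u uU e]; exists (phi.1 *: F u).
  by apply: rpredZ; apply: aug_ext FE uU.
rewrite (linearZ_LR (mklin (@cobar1_linear K U))) /= (cobar1_hopf _ (ext_hopf FE)) -e.
by rewrite -scalerBr [tmap F F (s - t)]linearB.
Qed.

Lemma chi_of_aug P : chi_of P \in tens_square Uplus.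
Proof. exact: chi_gen_aug. Qed.

Lemma chi_of_cocycle P : cocycle2 (chi_of P).
Proof.
have [th thP] := dual_basis charK U x_basis.
apply/(cocycle2P charK x_basis thP (chi_of_aug P)).
exact: (chi_gen_cocycle charK x_basis thP).
Qed.

Lemma cocycle_param chi : chi \in tens_square Uplus -> cocycle2 chi ->
  exists P, forall P', cohomologous chi (chi_of P') <-> P' = P.
Proof.
have [th thP] := dual_basis charK U x_basis.
move=> cU /(cocycle2P charK x_basis thP cU).
exact: (chi_class charK x_basis p_gt2 thP).
Qed.

Lemma chi_of_inj P P' : cohomologous (chi_of P) (chi_of P') -> P = P'.
Proof.
have [Q QP] := cocycle_param (chi_of_aug P) (chi_of_cocycle P).
by move=> /QP ->; apply/QP; apply: cohomologous_refl.
Qed.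

Lemma chi_of0 : chi_of 0 = 0.
Proof.
rewrite /Defs.chi_of big1 => [|ij _]; last by rewrite ffunE scale0r.
rewrite big1 => [|k _]; last by rewrite ffunE scale0r.
rewrite add0r linear0 /omega big_nat_cond big1 // => i /andP[/andP[i0 _] _].
by rewrite expr0n eqn0Ngt i0 tens0l scaler0.
Qed.

Lemma act_chi phi (F : {lrmorphism U -> U}) P : (forall a, F (iota a) = iota (phi.2 a)) ->
  cohomologous (phi.1 *: tmap F F (chi_of P)) (chi_of (Aut_act_param x phi P)).
Proof.
have [th thP] := dual_basis charK U x_basis.
exact: (chi_act charK x_basis p_gt2 thP).
Qed.

(** No matrices are multiplied: both sides are recognised as the parameter of one and the same
    cohomology class. *)
Lemma Aut_act_param_mul phi psi P : Aut phi -> Aut psi ->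
  Aut_act_param x psi (Aut_act_param x phi P) = Aut_act_param x (aut_mul psi phi) P.
Proof.
move=> /(Aut_functor U)[F FE] /(Aut_functor U)[G GE]; apply: chi_of_inj.
have GFE a : (G \o F) (iota a) = iota ((aut_mul psi phi).2 a) by rewrite /= FE GE lfunE.
apply: cohomologous_trans (cohomologous_sym (act_chi _ GE)) _.
apply: cohomologous_trans (cohomologous_sym (cohomologous_scale GE (act_chi P FE))) _.
have := act_chi P GFE; rewrite -tmap_comp /= -scalerA.
by have -> : tmap G G (phi.1 *: tmap F F (chi_of P)) = phi.1 *: tmap G G (tmap F F (chi_of P))
  by [exact: linearZ_LR].
Qed.

Lemma Aut_act_param_one phi P : phi.1 = 1 -> phi.2 =1 id -> Aut_act_param x phi P = P.
Proof.
move=> e1 e2; apply: chi_of_inj.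
have := @act_chi phi idfun P; rewrite e1 scale1r tmap_id => c.
by apply: cohomologous_sym; apply: c => a; rewrite e2.
Qed.

Lemma param_orbit_act phi P : Aut phi ->
  param_orbit z lambda x (Aut_act_param x phi P) = param_orbit z lambda x P.
Proof.
move=> A; have [psi B [e1 pK _]] := Aut_inv A.
apply/seteqP; split=> Q [phi' A' <-].
  by exists (aut_mul phi' phi); [exact: Aut_mul|rewrite Aut_act_param_mul].
exists (aut_mul phi' psi); first exact: Aut_mul.
rewrite Aut_act_param_mul //; last exact: Aut_mul.
have -> : Aut_act_param x (aut_mul (aut_mul phi' psi) phi) P =
    Aut_act_param x phi' (Aut_act_param x (aut_mul psi phi) P).
  rewrite Aut_act_param_mul //; last exact: Aut_mul.
  by rewrite /aut_mul /= mulrA comp_lfunA.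
rewrite (@Aut_act_param_one (aut_mul psi phi)) // => a; by rewrite /= lfunE /= pK.
Qed.

(** A choice of P for some member of the class; [class_paramP] shows that it is the only possible
    one for every representative. *)
Definition class_param (c : set (datum U)) : param K n :=
  xget 0 [set P | exists2 D, c D & cohomologous D.2 (chi_of P)].

Lemma class_paramP D P : PD D -> cohomologous D.2 (chi_of P) <-> P = class_param (H2_class D).
Proof.
move=> PD_D; have [_ D2 _] := PD_D; have [_ cD _] := PD_theta charK PD_D.
have [Q QP] := cocycle_param D2 cD.
suff -> : class_param (H2_class D) = Q by [].
have DD : H2_class D D.
  split=> //; exists 0; first exact: rpred0.
  by rewrite !subrr (Phi10 charK) (linear0 (mklin (@cobar1_linear K U))).
apply/QP; rewrite /class_param; case: xgetP => [P0 _ [E [_ [s sU [_ e2]]] EP]|nex].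
  by apply: cohomologous_trans EP; apply: cohomologous_sym; exists s.
by case: (nex Q); exists D => //; apply/QP.
Qed.

(** With chi_P = chi - d^1(t) the witness is Theta - Phi(t), because Phi commutes with d^1 and rho
    kills Phi(t). P is nonzero because chi is no coboundary. *)
Lemma class_param_Aplus D : PD D -> Aplus (class_param (H2_class D)).
Proof.
move=> PD_D; set P := class_param _.
have [t tU et] := (class_paramP P PD_D).2 erefl.
have [D1 _ _] := PD_D; have [rD _ pD] := PD_theta charK PD_D.
split.
  apply/eqP => P0; apply: (PD_not_coboundary charK PD_D); exists t => //.
  by rewrite -et P0 chi_of0 subr0.
exists (D.1 - Phi1 t).
  by apply: rpredB => //; apply: (Phi1_aug charK lambda rhoU_ext).
have -> : chi_of P = D.2 + - cobar1 t by rewrite -et subKr.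
rewrite (Phi2D charK) (Phi2N charK) pD (Phi2_cobar1 charK lambda rhoU_ext).
split; first by rewrite (linearB (mklin (@cobar1_linear K U))).
by rewrite linearB /= rD (rho_Phi1 charK z_rpow rhoU_ext) subrr.
Qed.

Lemma PD_of_Aplus P : Aplus P -> exists D, PD D /\ class_param (H2_class D) = P.
Proof.
case=> P0 [s sU [es rs]].
have PD_D : PD (s, chi_of P).
  apply: (PD_of_relations charK z_rpow rhoU_ext) => //=.
  - exact: chi_of_aug.
  - exact: chi_of_cocycle.
  case=> t tU et; move/eqP: P0; apply; apply: chi_of_inj.
  by exists t => //; rewrite chi_of0 subr0.
exists (s, chi_of P); split=> //; apply/esym/(class_paramP _ PD_D).
exact: cohomologous_refl.
Qed.

Lemma class_param_transport phi (F : {lrmorphism U -> U}) s D :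
  Aut phi -> (forall a, F (iota a) = iota (phi.2 a)) -> s \in Uplus -> PD D ->
  class_param (H2_class (transport phi F s D)) = Aut_act_param x phi (class_param (H2_class D)).
Proof.
move=> A FE sU PD_D; have PD_D' : PD (transport phi F s D).
  by apply: (PD_transported charK rhoU_ext _ PD_D); exists phi, F, s.
apply/esym/(class_paramP _ PD_D'); apply: cohomologous_trans (act_chi _ FE).
apply: (@cohomologous_trans _ (phi.1 *: tmap F F D.2)).
  by exists s => //; rewrite /= addrAC subrr add0r.
by apply: (cohomologous_scale FE); apply/class_paramP.
Qed.

(** For the converse, an automorphism and then a coboundary bring the second components of D and D'
    together. The Theta's then differ by a primitive element killed by rho, that is, by an element
    of h in the kernel of rho. Permissibility writes it as Phi(b) with b in h, and the change of
    representative by b leaves chi alone since b is primitive. *)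
Lemma transportedP D D' : permissible z lambda rhoU -> PD D -> PD D' ->
  transported D D' <-> param_orbit z lambda x (class_param (H2_class D)) =
                      param_orbit z lambda x (class_param (H2_class D')).
Proof.
move=> perm PD_D PD_D'; split=> [[phi [F [s [A FE sU ->]]]]|eq_orb].
  by rewrite class_param_transport // param_orbit_act.
have : param_orbit z lambda x (class_param (H2_class D')) (class_param (H2_class D')).
  exists (1, \1%VF); first exact: Aut_one.
  by rewrite Aut_act_param_one // => a; rewrite lfunE.
rewrite -eq_orb => -[phi A e]; have [F FE] := Aut_functor U A.
pose D1 := transport phi F 0 D.
have tr1 : transported D D1 by exists phi, F, 0; split=> //; apply: rpred0.
have PD1 : PD D1 := PD_transported charK rhoU_ext tr1 PD_D.
have [t tU et] : cohomologous D'.2 D1.2.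
  apply: cohomologous_trans ((class_paramP _ PD_D').2 erefl) (cohomologous_sym _).
  by apply/(class_paramP _ PD1); rewrite class_param_transport ?rpred0.
pose D2 : datum U := (D1.1 + Phi1 t, D1.2 + cobar1 t).
have tr2 : transported D1 D2.
  by apply: datum_equiv_transported; exists t => //; split; rewrite /= addrAC subrr add0r.
have PD2 : PD D2 := PD_transported charK rhoU_ext tr2 PD1.
have D2E : D2.2 = D'.2 by rewrite /= -et addrC subrK.
have [r2 _ p2] := PD_theta charK PD2; have [r' _ p'] := PD_theta charK PD_D'.
have [a aE] : exists a, D'.1 - D2.1 = iota a.
  apply: (cobar1_eq0 charK); rewrite (linearB (mklin (@cobar1_linear K U))) /=.
  by rewrite -p2 -p' D2E subrr.
have ra : type_rho T z a = 0.
  apply: (env_in_inj charK (U := U)).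
  by rewrite -rhoU_ext.2 -aE linearB /= r' r2 subrr linear0.
have [_ [b _ <-] eb] : [set Phi1 u | u in range iota] (iota a).
  by rewrite -perm; exists a.
apply: (transported_trans charK rhoU_ext tr1); apply: (transported_trans charK rhoU_ext tr2).
apply: datum_equiv_transported; exists (iota b).
  by apply/augmentation_idealP; apply: counit_env.
split; first by rewrite eb aE.
rewrite -D2E subrr /cobar1 env_in_prim; set u := tens 1 _; set v := tens _ 1.
by rewrite [v + u]addrC opprD addNKr addNr.
Qed.

End ParamClasses.

(** By [PD_presentation] a primitive deformation is isomorphic to a member of X(n), and isomorphic
    algebras have the same class. *)
Lemma quantum_group_classesE (K : closedFieldType) (p n : nat) (charK : p \in [pchar K])
    (T : abelian_type K p n) (lambda : K) (U : restricted_env (type_h T))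
    (rhoU : {linear U -> U}) :
  quantum_group_classes lambda rhoU = primitive_deformation_classes lambda rhoU.
Proof.
apply/funext => c; apply/propext; split=> [[H [_ [H' H'p HH']] ->]|[H [D PD uzH] ->]].
  by exists H' => //; apply/iso_classP.
have [H0 [j [zeta [_ _ _ cX uz0]]]] := PD_presentation charK PD; have [_ D2 _] := PD.
exists H0; last by apply/iso_classP; apply: (uz_unique D2 uzH uz0).
by split=> //; exists H0; [exists D|apply: hopf_iso_refl].
Qed.

Theorem theorem3p10 (k : closedFieldType) (p : nat) (char_k : p \in [pchar k])
    (n : nat) (T : abelian_type k p n) (z : type_g T) (z_neq0 : z != 0)
    (lambda : k) (z_rpow : rpow z = lambda *: z)
    (U : restricted_env (type_h T)) (rhoU : {linear U -> U})
    (rhoU_ext : rho_extension z rhoU)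
    (x : n.-tuple (type_h T)) (x_basis : basis_of fullv x) :
  [/\ quantum_group_classes lambda rhoU = primitive_deformation_classes lambda rhoU,
      exists f : set (set (datum U)) -> (hopfType k -> Prop),
        bij_between (H2_mod_Aut z lambda rhoU)
                (primitive_deformation_classes lambda rhoU) f /\
        forall (D : datum U) (H : hopfType k),
          PD_datum lambda rhoU D -> is_uz lambda rhoU D H ->
          f (H2_orbit z lambda (H2_class lambda rhoU D)) = iso_class H
    & permissible z lambda rhoU -> (2 < p)%N ->
      exists (g : set (set (datum U)) -> set (param k n))
             (pi : set (datum U) -> param k n),
        bij_between (H2_mod_Aut z lambda rhoU) (Aplus_mod_Aut z lambda rhoU x) g /\
        forall D : datum U, PD_datum lambda rhoU D ->
          (forall P : param k n,
             (exists2 s, s \in augmentation_ideal U &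
                D.2 - chi_of U x P = cobar1 s)
             <-> P = pi (H2_class lambda rhoU D)) /\
          Aplus lambda rhoU x (pi (H2_class lambda rhoU D)) /\
          g (H2_orbit z lambda (H2_class lambda rhoU D)) =
            param_orbit z lambda x (pi (H2_class lambda rhoU D))].
Proof.
pose orb D := H2_orbit z lambda (H2_class lambda rhoU D).
have orbP D D' : PD_datum lambda rhoU D -> PD_datum lambda rhoU D' ->
    orb D = orb D' <-> transported z lambda rhoU D D' by apply: H2_orbitP.
split; first exact: quantum_group_classesE.
(* [f] collects the algebras isomorphic to u_z(D) for any D in the orbit; by [orbP] and
   [is_uz_transport] all these D give one isomorphism class. *)
- pose f O : hopfType k -> Prop := fun H' => exists D H,
    [/\ PD_datum lambda rhoU D, is_uz lambda rhoU D H, O = orb D & hopf_iso H H'].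
  have fE D H : PD_datum lambda rhoU D -> is_uz lambda rhoU D H -> f (orb D) = iso_class H.
    move=> PD uzH; apply/funext => H'; apply/propext; split=> [|HH']; last by exists D, H.
    case=> D0 [H0 [PD0 uz0 /(orbP _ _ PD PD0) tr H0H']]; have [_ D02 _] := PD0.
    by apply: hopf_iso_trans H0H'; apply: (uz_unique D02) uz0; apply: is_uz_transport tr uzH.
  exists f; split=> //; split=> [_ [_ [D PD <-] <-]|_ _ [_ [D PD <-] <-] [_ [D' PD' <-] <-]|].
  + by have [_ _ [H [uzH _ _ _]]] := PD; exists H; [exists D|apply: fE].
  + have [_ _ [H [uzH _ _ _]]] := PD; have [_ _ [H' [uzH' _ _ _]]] := PD'.
    rewrite (fE D H) // (fE D' H') // => /iso_classP iso.
    by apply/(orbP _ _ PD PD'); apply: (iso_transported char_k rhoU_ext PD PD' uzH uzH' iso).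
  move=> _ [H [D PD uzH] ->]; exists (orb D); last exact: fE.
  by exists (H2_class lambda rhoU D) => //; exists D.
move=> perm p_gt2; pose pi := @class_param k p n T U x.
(* The value is again defined over all representatives of the orbit, and [gE] shows that any one of
   them gives it. *)
pose g O : set (param k n) := fun P => exists2 D, PD_datum lambda rhoU D /\ O = orb D &
  param_orbit z lambda x (pi (H2_class lambda rhoU D)) P.
have trP := transportedP char_k p_gt2 rhoU_ext x_basis perm.
have gE D : PD_datum lambda rhoU D ->
    g (orb D) = param_orbit z lambda x (pi (H2_class lambda rhoU D)).
  move=> PD; apply/seteqP; split=> P; last by exists D.
  by case=> D' [PD' /(orbP _ _ PD PD')/(trP _ _ PD PD') <-].
have piA D : PD_datum lambda rhoU D -> Aplus lambda rhoU x (pi (H2_class lambda rhoU D)).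
  exact: (class_param_Aplus char_k p_gt2 z_rpow rhoU_ext x_basis).
exists g, pi; split.
  split=> [_ [_ [D PD <-] <-]|_ _ [_ [D PD <-] <-] [_ [D' PD' <-] <-]|_ [P AP <-]].
  - by exists (pi (H2_class lambda rhoU D)); [apply: piA|apply/esym/gE].
  - by rewrite -/(orb D) -/(orb D') !gE // => /(trP _ _ PD PD')/(orbP _ _ PD PD').
  have [D [PD DP]] := PD_of_Aplus char_k p_gt2 z_rpow rhoU_ext x_basis AP.
  exists (orb D); first by exists (H2_class lambda rhoU D) => //; exists D.
  by rewrite gE // [pi _]DP.
move=> D PD; split; last by split; [apply: piA|apply: gE].
by move=> P; apply: (class_paramP char_k p_gt2 x_basis).
Qed.
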